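(* Let $X$ be a compact connected Riemann surface with a Kähler metric $g_X$, and let $(E,\overline{\partial}_E,\theta)$ be a stable Higgs bundle on $X$ with $\deg(E)=0$ which is generically regular semisimple. Let $h_{\det E}$ be a flat metric of $\det(E)$ and, for $t>0$, let $h_t$ be the harmonic metric of $(E,\overline{\partial}_E,t\theta)$ with $\det(h_t)=h_{\det E}$. Let $N$ be any neighbourhood of the discriminant $D(E,\theta)$. Then there exist positive constants $C_0$ and $\epsilon_0$ such that for all $t>0$ the following holds on $X\setminus N$: \[ \bigl|R(h_t)\bigr|_{h_t,g_X} =|t|^2\bigl|\bigl[\theta,\theta^{\dagger}_{h_t}\bigr]\bigr|_{h_t,g_X} \leq C_0\exp(-\epsilon_0 t). \] The constants $C_0$ and $\epsilon_0$ may depend only on $(X,g_X)$, $N$ and the spectral curve $\Sigma(E,\theta)$.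
   Context: A Higgs bundle $(E,\overline{\partial}_E,\theta)$ on a Riemann surface is a holomorphic vector bundle with a holomorphic section $\theta$ of $\mathrm{End}(E)\otimes\Omega^1$. For a Hermitian metric $h$ of $E$, $R(h)$ is the curvature of the Chern connection of $(E,\overline{\partial}_E,h)$ and $\theta^\dagger_h$ is the adjoint of $\theta$ with respect to $h$. The metric $h$ is harmonic for $(E,\overline{\partial}_E,\theta)$ if $R(h)+[\theta,\theta_h^\dagger]=0$. For a stable Higgs bundle of degree $0$ on a compact connected Riemann surface and a flat metric $h_{\det E}$ on $\det E$, for each $t>0$ there is (Hitchin, Simpson) a unique harmonic metric $h_t$ of $(E,\overline{\partial}_E,t\theta)$ with $\det(h_t)=h_{\det E}$. The spectral curve $\Sigma(E,\theta)\subset T^*X$ is the support of the coherent sheaf on $T^*X$ associated to $(E,\theta)$; i.e. $\Sigma(E,\theta)\cap T^*_PX$ is the set of eigenvalues of $\theta_{|P}$. The discriminant is $D(E,\theta)=\{P\in X : |T_P^*X\cap\Sigma(E,\theta)|<\mathrm{rank}\,E\}$. The Higgs bundle is generically regular semisimple if there is a discrete subset $D\subset X$ with $|T_P^*X\cap\Sigma(E,\theta)|=\mathrm{rank}\,E$ for all $P\in X\setminus D$. For a section $s$ of $\mathrm{End}(E)\otimes\Omega^{p,q}$, $|s|_{h_t,g_X}$ is its pointwise norm with respect to $h_t$ and $g_X$. *)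

(* Defs.v *)
From HB Require Import structures.
From mathcomp Require Import all_boot all_order all_algebra.
From mathcomp Require Import perm complex.
From mathcomp Require Import all_classical all_reals all_analysis.
Set Implicit Arguments.
Unset Strict Implicit.
Unset Printing Implicit Defensive.
Import Order.TTheory GRing.Theory Num.Theory numFieldNormedType.Exports.
Local Open Scope classical_set_scope.
Local Open Scope card_scope.
Local Open Scope ring_scope.
Local Open Scope complex_scope.
Local Open Scope sesquilinear_scope.

(* Naming the numClosedFieldType structure of R[i] is what lets the topology and
   normed-module structures of numFieldNormedType apply to it. *)
Definition Cx (R : realType) : numClosedFieldType := R[i].

Section OneVariable.
Variable R : realType.
Notation C := (Cx R).
Implicit Types (F : C -> C) (z v : C).

(* Real directional derivatives of F : C -> C, with C seen as the real plane;
   complex differentiability is the library's [derivable F z 1], the scalars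
   being C itself. *)
Definition real_line F v z (t : R) : C := F (z + t%:C * v).

Definition pderivable v F z : Prop :=
  derivable (fun t : R => complex.Re (real_line F v z t)) 0 1 /\
  derivable (fun t : R => complex.Im (real_line F v z t)) 0 1.

Definition pderive v F z : C :=
  ('D_1 (fun t : R => complex.Re (real_line F v z t)) 0) +i*
  ('D_1 (fun t : R => complex.Im (real_line F v z t)) 0).

Definition ii : C := 0 +i* 1.

Fixpoint Ck_on (k : nat) (V : set C) F : Prop :=
  (forall z, V z -> {for z, continuous F}) /\
  match k with
  | 0 => True
  | k'.+1 => forall v, v = 1 \/ v = ii ->
      (forall z, V z -> pderivable v F z) /\ Ck_on k' V (pderive v F)
  end.

Definition d_z F z : C := (pderive 1 F z - ii * pderive ii F z) / 2.
Definition d_zbar F z : C := (pderive 1 F z + ii * pderive ii F z) / 2.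

Definition derive_mx m n (D : (C -> C) -> C -> C) (F : C -> 'M[C]_(m, n)) z
  : 'M[C]_(m, n) := \matrix_(a, b) D (fun w => F w a b) z.

End OneVariable.

(* A Riemann surface with a chosen holomorphic atlas.  [cinv c] is only
   meaningful on the open set [cmap c @` cdom c]. *)
Record riemannSurface (R : realType) := RiemannSurface {
  rs_space :> topologicalType;
  chart : Type;
  cdom : chart -> set rs_space;
  cmap : chart -> rs_space -> Cx R;
  cinv : chart -> Cx R -> rs_space;
  rs_hausdorff : hausdorff_space rs_space;
  cdom_open : forall c, open (cdom c);
  cimg_open : forall c, open (cmap c @` cdom c);
  cdom_cover : forall P, exists c, cdom c P;
  cmapK : forall c P, cdom c P -> cinv c (cmap c P) = P;
  cmap_continuous : forall c, {within cdom c, continuous (cmap c)};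
  cinv_continuous : forall c, {within cmap c @` cdom c, continuous (cinv c)};
  transition_holomorphic : forall c c' P, cdom c P -> cdom c' P ->
    derivable (cmap c \o cinv c') (cmap c' P) 1
}.

Section Geometry.
Variables (R : realType) (X : riemannSurface R).
Notation C := (Cx R).

(* dz_c / dz_c' at P *)
Definition dcoord (c c' : chart X) (P : X) : C :=
  'D_1 (cmap c \o cinv c') (cmap c' P).

(* The next three predicates are meant for open U. *)
Definition holomorphic_on (U : set X) (f : X -> C) : Prop :=
  forall c P, U P -> cdom c P -> derivable (f \o @cinv _ X c) (cmap c P) 1.

Definition holomorphic_mx_on m n (U : set X) (A : X -> 'M[C]_(m, n)) : Prop :=
  forall a b, holomorphic_on U (fun P => A P a b).

Definition smooth_on (U : set X) (f : X -> C) : Prop :=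
  forall c k, Ck_on k (@cmap _ X c @` (U `&` cdom c)) (f \o cinv c).

(* In the chart z = x + iy the metric is kcoef c * (dx^2 + dy^2).  In complex
   dimension one every Hermitian metric is Kaehler. *)
Record kahlerMetric := KahlerMetric {
  kcoef : chart X -> X -> R;
  kcoef_smooth : forall c, smooth_on (cdom c) (fun P => (kcoef c P)%:C);
  kcoef_gt0 : forall c P, cdom c P -> 0 < kcoef c P;
  kcoef_chart : forall c c' P, cdom c P -> cdom c' P ->
    (kcoef c' P)%:C = `|dcoord c c' P| ^+ 2 * (kcoef c P)%:C
}.

(* A holomorphic vector bundle, given by its transition cocycle: a section is a
   family of columns with s_i = trans i j *m s_j. *)
Record bundle (r : nat) := Bundle {
  frame : Type;
  fdom : frame -> set X;
  trans : frame -> frame -> X -> 'M[C]_r;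
  fdom_open : forall i, open (fdom i);
  fdom_cover : forall P, exists i, fdom i P;
  trans_holomorphic : forall i j,
    holomorphic_mx_on (fdom i `&` fdom j) (trans i j);
  trans_id : forall i P, fdom i P -> trans i i P = 1%:M;
  trans_cocycle : forall i j k P, fdom i P -> fdom j P -> fdom k P ->
    trans i j P *m trans j k P = trans i k P
}.

(* Holomorphic sections of End(E) (x) Omega^1: [hcoef i c] dz_c is the matrix of
   theta in the frame i. *)
Record higgsField r (E : bundle r) := HiggsField {
  hcoef : frame E -> chart X -> X -> 'M[C]_r;
  hcoef_holomorphic : forall i c,
    holomorphic_mx_on (fdom i `&` cdom c) (hcoef i c);
  hcoef_frame : forall i j c P, fdom i P -> fdom j P -> cdom c P ->
    hcoef i c P *m trans i j P = trans i j P *m hcoef j c P;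
  hcoef_chart : forall i c c' P, fdom i P -> cdom c P -> cdom c' P ->
    hcoef i c' P = dcoord c c' P *: hcoef i c P
}.

(* h(u, v) = v^* H u in each frame, for columns u and v. *)
Record hermMetric r (E : bundle r) := HermMetric {
  hmx : frame E -> X -> 'M[C]_r;
  hmx_smooth : forall i a b, smooth_on (fdom i) (fun P => hmx i P a b);
  hmx_herm : forall i P, fdom i P -> (hmx i P) ^t* = hmx i P;
  hmx_gt0 : forall i P, fdom i P -> forall v : 'cV[C]_r, v != 0 ->
    0 < (v ^t* *m hmx i P *m v) 0 0;
  hmx_frame : forall i j P, fdom i P -> fdom j P ->
    hmx j P = (trans i j P) ^t* *m hmx i P *m trans i j P
}.

Section Scale.
Variables (r : nat) (E : bundle r) (t : C) (theta : higgsField E).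
Let A i c P := t *: hcoef theta i c P.

Lemma scale_holomorphic i c : holomorphic_mx_on (fdom i `&` cdom c) (A i c).
Proof.
move=> a b c' P UP cP.
have -> : (fun Q => A i c Q a b) \o @cinv _ X c' =
    (fun=> t) * ((fun Q => hcoef theta i c Q a b) \o @cinv _ X c').
  by apply/funext => z /=; rewrite /A mxE.
apply: derivableM; first exact: derivable_cst.
exact: (@hcoef_holomorphic _ _ theta i c a b c' P UP cP).
Qed.

Lemma scale_frame i j c P : fdom i P -> fdom j P -> cdom c P ->
  A i c P *m trans i j P = trans i j P *m A j c P.
Proof. by move=> *; rewrite /A -scalemxAl -scalemxAr hcoef_frame. Qed.

Lemma scale_chart i c c' P : fdom i P -> cdom c P -> cdom c' P ->
  A i c' P = dcoord c c' P *: A i c P.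
Proof.
by move=> iP cP c'P; rewrite /A (hcoef_chart theta iP cP c'P) !scalerA mulrC.
Qed.

Definition scale_higgs : higgsField E :=
  HiggsField scale_holomorphic scale_frame scale_chart.
End Scale.

Lemma derivable_bigsum (I : Type) (s : seq I) (F : I -> C -> C) (z : C) :
  (forall i, derivable (F i) z 1) ->
  derivable (fun w => \sum_(i <- s) F i w) z 1.
Proof.
move=> dF; elim: s => [|i s IH].
  have -> : (fun w => \sum_(j <- [::]) F j w) = cst 0.
    by apply/funext => w; rewrite big_nil.
  exact: derivable_cst.
have -> : (fun w => \sum_(j <- i :: s) F j w) =
    F i + (fun w => \sum_(j <- s) F j w).
  by apply/funext => w; rewrite big_cons.
exact: (derivableD (dF i) IH).
Qed.

Lemma derivable_bigprod (I : Type) (s : seq I) (F : I -> C -> C) (z : C) :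
  (forall i, derivable (F i) z 1) ->
  derivable (fun w => \prod_(i <- s) F i w) z 1.
Proof.
move=> dF; elim: s => [|i s IH].
  have -> : (fun w => \prod_(j <- [::]) F j w) = cst 1.
    by apply/funext => w; rewrite big_nil.
  exact: derivable_cst.
have -> : (fun w => \prod_(j <- i :: s) F j w) =
    F i * (fun w => \prod_(j <- s) F j w).
  by apply/funext => w; rewrite big_cons.
exact: (derivableM (dF i) IH).
Qed.

Section Determinant.
Variables (r : nat) (E : bundle r).
Let g (i j : frame E) (P : X) : 'M[C]_1 := (\det (trans i j P))%:M.

Lemma det_holomorphic i j : holomorphic_mx_on (fdom i `&` fdom j) (g i j).
Proof.
move=> a b c P UP cP; rewrite (ord1 a) (ord1 b).
have -> : (fun Q => g i j Q 0 0) \o @cinv _ X c =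
    fun w => \sum_(s : 'S_r) (-1) ^+ s *
      \prod_k trans i j (cinv c w) k (s k).
  by apply/funext => w /=; rewrite /g mxE eqxx mulr1n.
apply: derivable_bigsum => s.
apply: (@derivableM _ _ (cst _)); first exact: derivable_cst.
apply: derivable_bigprod => k.
exact: (@trans_holomorphic _ E i j k (s k) c P UP cP).
Qed.

Lemma det_id i P : fdom i P -> g i i P = 1%:M.
Proof. by move=> iP; rewrite /g trans_id// det1. Qed.

Lemma det_cocycle i j k P : fdom i P -> fdom j P -> fdom k P ->
  g i j P *m g j k P = g i k P.
Proof.
move=> iP jP kP.
by rewrite /g -(trans_cocycle iP jP kP) det_mulmx scalar_mxM.
Qed.

Definition det_bundle : bundle 1 :=
  Bundle (@fdom_open _ E) (@fdom_cover _ E) det_holomorphic det_id det_cocycle.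

Definition det_metric_eq (h : hermMetric E) (k : hermMetric det_bundle) : Prop :=
  forall (i : frame E) P, fdom i P -> hmx k i P = (\det (hmx h i P))%:M.
End Determinant.

(* D is the divisor of the meromorphic section s (not identically zero on any
   component) of the line bundle L: near every P, in every frame and chart,
   s = (z - z(P))^(D P) * u with u holomorphic and u(P) != 0.  The values of s
   at its poles are irrelevant. *)
Definition is_divisor (L : bundle 1) (s : frame L -> X -> C) (D : X -> int)
  : Prop :=
  (forall i j P, fdom i P -> fdom j P -> 0 <= D P ->
     s i P = trans i j P 0 0 * s j P) /\
  (forall i c P, fdom i P -> cdom c P ->
     exists (V : set X) (u : X -> C),
       [/\ open V, V P, V `<=` fdom i `&` cdom c,
           holomorphic_on V u & u P != 0 /\
           forall Q, V Q -> Q <> P \/ 0 <= D P ->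
             s i Q = (cmap c Q - cmap c P) ^ (D P) * u Q]).

(* deg E = deg (det E), the degree of a line bundle on a compact Riemann surface
   being that of the divisor of any of its meromorphic sections. *)
Definition has_degree r (E : bundle r) (d : int) : Prop :=
  exists (s : frame (det_bundle E) -> X -> C) (D : X -> int),
    is_divisor s D /\ d = \sum_(P \in [set: X]) D P.

(* A holomorphic subbundle is the image of a fibrewise injective holomorphic
   bundle map phi : F -> E. *)
Definition is_subbundle r k (E : bundle r) (F : bundle k)
    (phi : frame E -> frame F -> X -> 'M[C]_(r, k)) : Prop :=
  [/\ forall i j, holomorphic_mx_on (fdom i `&` fdom j) (phi i j),
      forall i i' j j' P, fdom i P -> fdom i' P -> fdom j P -> fdom j' P ->
        trans i i' P *m phi i' j' P = phi i j P *m trans j j' P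
    & forall i j P, fdom i P -> fdom j P -> \rank (phi i j P) = k].

Definition invariant r k (E : bundle r) (theta : higgsField E) (F : bundle k)
    (phi : frame E -> frame F -> X -> 'M[C]_(r, k)) : Prop :=
  forall i j c P, fdom i P -> fdom j P -> cdom c P ->
    exists B : 'M[C]_k, hcoef theta i c P *m phi i j P = phi i j P *m B.

Definition stable r (E : bundle r) (theta : higgsField E) : Prop :=
  (0 < r)%N /\
  forall k (F : bundle k) phi (d e : int), (0 < k < r)%N ->
    @is_subbundle r k E F phi -> invariant theta phi ->
    has_degree F d -> has_degree E e -> d%:Q / k%:Q < e%:Q / r%:Q.

(* A covector at P is the family of its coefficients with respect to the dz_c,
   for all charts c around P (and 0 for the other ones). *)
Definition covector := chart X -> C.

Definition cotangent_space (P : X) : set covector :=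
  [set xi | (forall c, ~ cdom c P -> xi c = 0) /\
            (forall c c', cdom c P -> cdom c' P ->
               xi c' = dcoord c c' P * xi c)].

Definition cotangent_bundle : set (X * covector) :=
  [set p | cotangent_space p.1 p.2].

Definition spectral_curve r (E : bundle r) (theta : higgsField E)
  : set (X * covector) :=
  [set p | cotangent_bundle p /\
     forall i c, fdom i p.1 -> cdom c p.1 ->
       eigenvalue (hcoef theta i c p.1) (p.2 c)].

Definition spectral_fibre r (E : bundle r) (theta : higgsField E) (P : X)
  : set covector :=
  cotangent_space P `&` [set xi | spectral_curve theta (P, xi)].

Definition discriminant r (E : bundle r) (theta : higgsField E) : set X :=
  [set P | exists2 k, (k < r)%N & spectral_fibre theta P #= `I_k].

Definition generically_regular_semisimple r (E : bundle r)
    (theta : higgsField E) : Prop :=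
  exists D : set X, D `<=` isolated D /\
    forall P, ~ D P -> spectral_fibre theta P #= `I_r.

(* Chern connection and curvature in a holomorphic frame, with the convention of
   hermMetric: H^-1 dH and R(h) = dbar (H^-1 d H).  The value is the
   coefficient of dz /\ dzbar = - dzbar /\ dz. *)
Definition curvature r (E : bundle r) (h : hermMetric E)
    (i : frame E) (c : chart X) (P : X) : 'M[C]_r :=
  let H z := hmx h i (cinv c z) in
  - derive_mx (@d_zbar R)
      (fun z => invmx (H z) *m derive_mx (@d_z R) H z) (cmap c P).

Definition flat_metric r (E : bundle r) (h : hermMetric E) : Prop :=
  forall i c P, fdom i P -> cdom c P -> curvature h i c P = 0.

(* h(A u, v) = h(u, adjoint_h A v) *)
Definition adjoint_h r (E : bundle r) (h : hermMetric E) (i : frame E) (P : X)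
    (A : 'M[C]_r) : 'M[C]_r :=
  invmx (hmx h i P) *m A ^t* *m hmx h i P.

(* For theta = A dz one has theta^dagger = A^dagger dzbar, and the graded bracket
   of these one-forms is [theta, theta^dagger] = [A, A^dagger] dz /\ dzbar. *)
Definition higgs_bracket r (E : bundle r) (theta : higgsField E)
    (h : hermMetric E) (i : frame E) (c : chart X) (P : X) : 'M[C]_r :=
  let A := hcoef theta i c P in
  let Ad := adjoint_h h i P A in
  A *m Ad - Ad *m A.

Definition harmonic_metric r (E : bundle r) (theta : higgsField E)
    (h : hermMetric E) : Prop :=
  forall i c P, fdom i P -> cdom c P ->
    curvature h i c P + higgs_bracket theta h i c P = 0.

(* Norm at P of the End(E)-valued (1,1)-form B dz /\ dzbar: the Hilbert-Schmidt
   norm of B for h, times |dz /\ dzbar| = |2 dx /\ dy| = 2 / kcoef.  For a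
   section it does not depend on the frame i and the chart c around P. *)
Definition norm11 r (E : bundle r) (h : hermMetric E) (g : kahlerMetric)
    (i : frame E) (c : chart X) (P : X) (B : 'M[C]_r) : R :=
  Num.sqrt (complex.Re (\tr (B *m adjoint_h h i P B))) * (2 / kcoef g c P).

End Geometry.

(* Main.v *)
Require Import Defs.
From mathcomp Require Import all_boot all_order all_algebra.
From mathcomp Require Import complex.
From mathcomp Require Import all_classical all_reals all_analysis.
From mathcomp Require Import ring lra.
Import Order.TTheory GRing.Theory Num.Theory numFieldNormedType.Exports.
Local Open Scope classical_set_scope.
Local Open Scope ring_scope.
Local Open Scope complex_scope.
Local Open Scope sesquilinear_scope.
Local Open Scope card_scope.
Set Implicit Arguments.
Unset Strict Implicit.
Unset Printing Implicit Defensive.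

(* For a section s of End E commuting with B = t theta, Hitchin's equation gives
   the Bochner inequality |s|^2 d dbar |s|^2 >= |d |s|^2|^2 + |s|^2 |[B, s^*]|^2,
   the adjoint being taken for h_t.
   Applied to s = B, together with the linear algebra bound
   |B|^2 <= r max|eigenvalue|^2 + r^2 |[B, B^*]|, it is a superlinear inequality
   for |B|^2, which the maximum principle on discs of fixed radius turns into
   |theta|^2 <= const, uniformly in t >= 1.
   Away from the discriminant the eigenvalues of theta are holomorphic and
   separated, and so are the spectral projections pi_i, which commute with theta.
   Since |[theta, pi_i^*]|^2 >= const |pi_i|^2 (|pi_i|^2 - 1), the function
   u = |pi_i|^2 - 1 >= 0 satisfies d dbar u >= const t^2 u; comparing it with
   exp(kappa (|z|^2 - rho^2)), kappa = const t, shows that it is exponentially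
   small in t, and [theta, theta^*] is controlled by the u's.
   Compactness of the complement of the interior of N gives uniform constants. *)

(** The constants may depend on the Higgs bundle only through its curve [Sigma], so the quantities
    behind them (a bound on the eigenvalues, their gap, the radius of a disc) are read off [Sigma].
    One Higgs bundle with this curve serves as reference: its eigenvalue branches are the sheets of
    [Sigma], hence the branches for all the others, whose rank is forced to agree as well. All norms
    are invariant under change of frame, so they are functions on a fixed disc, although the frames
    of an arbitrary bundle may live on much smaller sets. The Laplacian is handled pointwise, by
    second-order expansions along the two coordinate axes; the second derivative test asks for no
    more. Holomorphic data come with complex differentiability alone: their second derivatives are
    produced by Goursat's theorem and a Cauchy formula. The mixed partial derivatives of the metric
    are controlled by its Hermitian symmetry together with Hitchin's equation. For t <= 1 there is
    no decay to prove: t^2 |theta|^2 stays bounded and a larger constant absorbs it. *)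

Local Notation Re := complex.Re.
Local Notation Im := complex.Im.

(** * Topology of the complex plane through a real-valued modulus *)

Section ComplexTopology.
Variable R : realType.
Notation C := (Cx R).
Implicit Types (z w : C).

Lemma Re_add z w : Re (z + w) = Re z + Re w.
Proof. by case: z w => [a b] [c d]. Qed.
Lemma Im_add z w : Im (z + w) = Im z + Im w.
Proof. by case: z w => [a b] [c d]. Qed.
Lemma Re_opp z : Re (- z) = - Re z.
Proof. by case: z. Qed.
Lemma Im_opp z : Im (- z) = - Im z.
Proof. by case: z. Qed.
Lemma Re_mul z w : Re (z * w) = Re z * Re w - Im z * Im w.
Proof. by case: z w => [a b] [c d]. Qed.
Lemma Im_mul z w : Im (z * w) = Re z * Im w + Im z * Re w.
Proof. by case: z w => [a b] [c d]. Qed.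
Lemma eq_ReIm z w : Re z = Re w -> Im z = Im w -> z = w.
Proof. by case: z w => [a b] [c d] /= -> ->. Qed.
Lemma conjCE z : (z^*)%R = Re z -i* Im z.
Proof. by case: z. Qed.
Lemma Re_conjE z : Re (z^*)%R = Re z.
Proof. by rewrite conjCE. Qed.
Lemma Im_conjE z : Im (z^*)%R = - Im z.
Proof. by rewrite conjCE. Qed.

(** The norm of [C] takes its values in [C] itself; [nm] is the same number seen in [R], where real
    inequalities apply. *)
Definition nm z : R := Re `|z|.

Lemma nmE z : `|z| = (nm z)%:C.
Proof. by rewrite /nm normc_def. Qed.
Lemma nm_sqrt z : nm z = Num.sqrt (Re z ^+ 2 + Im z ^+ 2).
Proof. by rewrite /nm normc_def. Qed.
Lemma nm_ge0 z : 0 <= nm z.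
Proof. by rewrite nm_sqrt sqrtr_ge0. Qed.
Lemma nm_sqr z : nm z ^+ 2 = Re z ^+ 2 + Im z ^+ 2.
Proof. by rewrite nm_sqrt sqr_sqrtr// addr_ge0// sqr_ge0. Qed.
Lemma nm0 : nm 0 = 0.
Proof. by rewrite /nm normr0. Qed.
Lemma nm_eq0 z : (nm z == 0) = (z == 0).
Proof. by rewrite -(normr_eq0 z) nmE; apply/eqP/eqP => [->//|[]]. Qed.
Lemma nmM z w : nm (z * w) = nm z * nm w.
Proof. by apply: complexI; rewrite rmorphM /= -!nmE normrM. Qed.
Lemma nmV z : nm z^-1 = (nm z)^-1.
Proof. by apply: complexI; rewrite fmorphV /= -!nmE normfV. Qed.
Lemma nmN z : nm (- z) = nm z.
Proof. by rewrite /nm normrN. Qed.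
Lemma nmB z w : nm (z - w) = nm (w - z).
Proof. by rewrite /nm distrC. Qed.
Lemma nm_triangle z w : nm (z + w) <= nm z + nm w.
Proof. by rewrite -lecR rmorphD /= -!nmE ler_normD. Qed.
Lemma nm_triangleB z w : nm z - nm w <= nm (z - w).
Proof. by rewrite lerBlDr; apply: le_trans (nm_triangle _ _); rewrite subrK. Qed.
Lemma nm_real (x : R) : nm x%:C = `|x|.
Proof. by rewrite nm_sqrt /= expr0n /= addr0 sqrtr_sqr. Qed.
Lemma nm_conj z : nm (z^*)%R = nm z.
Proof. by rewrite !nm_sqrt Re_conjE Im_conjE sqrrN. Qed.
Lemma nm_mulconj z : z * (z^*)%R = (nm z ^+ 2)%:C.
Proof. by rewrite -normCK nmE rmorphXn. Qed.
Lemma nmX z n : nm (z ^+ n) = nm z ^+ n.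
Proof. by apply: complexI; rewrite rmorphXn /= -!nmE normrX. Qed.
Lemma le_Re_nm z : `|Re z| <= nm z.
Proof. by rewrite -lecR -nmE normc_ge_Re. Qed.
Lemma le_Im_nm z : `|Im z| <= nm z.
Proof.
rewrite nm_sqrt -sqrtr_sqr ler_sqrt ?sqr_ge0//.
by rewrite lerDr sqr_ge0.
by rewrite addr_ge0// sqr_ge0.
Qed.
Lemma nm_le_ReIm z : nm z <= `|Re z| + `|Im z|.
Proof.
rewrite {1}(complexE z); apply: le_trans (nm_triangle _ _) _.
rewrite nmM !nm_real lerD2l; suff -> : nm 'i%C = 1 by rewrite mul1r.
by rewrite nm_sqrt /= expr0n expr1n add0r sqrtr1.
Qed.

(** The radii of balls are elements of [C], but a positive complex number is real, so balls are
    discs of real radius. *)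
Lemma nbhsCP z (P : set C) :
  nbhs z P <-> exists2 d : R, 0 < d & forall w, nm (w - z) < d -> P w.
Proof.
split.
  move=> /nbhs_ballP[e /= e0 eP]; exists (Re e).
    by move: e0; rewrite ltcE => /andP[].
  move=> w we; apply: eP; rewrite /ball /= -normrN opprB.
  rewrite nmE; move: e0; rewrite ltcE /= => /andP[/eqP ei er].
  by rewrite ltcE /= ei eqxx.
move=> [d d0 dP]; apply/nbhs_ballP; exists d%:C; first by rewrite /= ltcR.
by move=> w; rewrite /ball /= -normrN opprB nmE ltcR => /dP.
Qed.

Lemma openCP (V : set C) z : open V -> V z ->
  exists2 d : R, 0 < d & forall w, nm (w - z) < d -> V w.
Proof. by move=> oV Vz; apply/nbhsCP; exact: open_nbhs_nbhs. Qed.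

Lemma open_discC (c : C) (d : R) : open [set w | nm (w - c) < d].
Proof.
rewrite openE => w /= wd; apply/nbhsCP; exists (d - nm (w - c)).
  by rewrite subr_gt0.
move=> v vw /=; have -> : v - c = (v - w) + (w - c) by rewrite addrA subrK.
by apply: le_lt_trans (nm_triangle _ _) _; rewrite -ltrBrDr.
Qed.

Lemma cvgCP (T : Type) (F : set_system T) (FF : Filter F) (f : T -> C) (l : C) :
  (f x @[x --> F] --> l) <-> forall e : R, 0 < e -> \forall x \near F, nm (f x - l) < e.
Proof.
split.
  move=> fl e e0; apply: (fl [set w | nm (w - l) < e]).
  by apply/nbhsCP; exists e.
move=> H P /nbhsCP[d d0 dP]; rewrite /nbhs /=; near=> x.
by apply: dP; near: x; exact: H.
Unshelve. all: by end_near. Qed.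

Lemma Re_continuous : continuous (fun z : C => Re z).
Proof.
move=> z P /nbhs_ballP[e /= e0 eP]; apply/nbhsCP; exists e => // w we.
apply: eP; rewrite /ball /= -Re_opp -Re_add.
by apply: le_lt_trans (le_Re_nm _) _; rewrite nmB.
Qed.

Lemma Im_continuous : continuous (fun z : C => Im z).
Proof.
move=> z P /nbhs_ballP[e /= e0 eP]; apply/nbhsCP; exists e => // w we.
apply: eP; rewrite /ball /= -Im_opp -Im_add.
by apply: le_lt_trans (le_Im_nm _) _; rewrite nmB.
Qed.

Lemma nm_continuous : continuous (fun z : C => nm z).
Proof.
move=> z P /nbhs_ballP[e /= e0 eP]; apply/nbhsCP; exists e => // w we; apply: eP.
rewrite /ball /= ltr_norml; apply/andP; split.
  by rewrite ltrNl opprB; apply: le_lt_trans (nm_triangleB _ _) _.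
by apply: le_lt_trans (nm_triangleB _ _) _; rewrite nmB.
Qed.

Lemma cvgC_ReIm (T : Type) (F : set_system T) (FF : Filter F) (f : T -> C) (l : C) :
  (Re (f x) @[x --> F] --> Re l) -> (Im (f x) @[x --> F] --> Im l) -> f x @[x --> F] --> l.
Proof.
move=> fr fi; apply/cvgCP => e e0.
have e2 : 0 < e / 2 by rewrite divr_gt0.
move/cvgrPdist_lt/(_ _ e2) : fr => fr.
move/cvgrPdist_lt/(_ _ e2) : fi => fi.
near=> x; apply: le_lt_trans (nm_le_ReIm _) _.
rewrite !Re_add !Im_add !Re_opp !Im_opp [ltRHS](splitr e) distrC (distrC (Im _)) ltrD//.
  by near: x.
by near: x.
Unshelve. all: by end_near. Qed.

Lemma cvgCxP (F : C -> C) (z l : C) :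
  F @ z --> l <-> forall e : R, 0 < e ->
    exists2 d : R, 0 < d & forall w, nm (w - z) < d -> nm (F w - l) < e.
Proof.
split.
  move=> Fl e e0; have /Fl /nbhsCP[d d0 dP] : nbhs l [set w | nm (w - l) < e].
    by apply/nbhsCP; exists e.
  by exists d.
move=> H P /nbhsCP[e e0 eP]; have [d d0 dP] := H _ e0.
by apply/nbhsCP; exists d => // w /dP/eP.
Qed.

Lemma conjC_continuous : continuous (fun z : C => (z^*)%R).
Proof.
move=> z; apply/cvgCxP => e e0; exists e => // w we.
by rewrite -rmorphB nm_conj.
Qed.

Lemma closed_disc_compact (c : C) (d : R) : compact [set w | nm (w - c) <= d].
Proof.
pose A := `[(Re c - d), (Re c + d)]%classic `*` `[(Im c - d), (Im c + d)]%classic.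
have cA : compact A by apply: compact_setX; exact: segment_compact.
pose f (p : R * R) : C := p.1 +i* p.2.
have cf : continuous f.
  move=> p; apply: cvgC_ReIm => /=; [exact: cvg_fst|exact: cvg_snd].
have cfA : compact (f @` A).
  by apply: continuous_compact => //; exact: continuous_subspaceT.
apply: (subclosed_compact _ cfA).
  rewrite -openC openE => w /= /negP; rewrite -ltNge => wd.
  apply/nbhsCP; exists (nm (w - c) - d); rewrite ?subr_gt0// => v vw /= vd.
  have : nm (w - c) <= nm (w - v) + nm (v - c).
    by apply: le_trans (nm_triangle _ _); rewrite addrA subrK.
  by rewrite leNgt => /negP; apply; rewrite nmB; move: vw vd; lra.
move=> w /= wd; exists (Re w, Im w); last by case: (w).
have := le_trans (le_Re_nm _) wd; have := le_trans (le_Im_nm _) wd.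
rewrite Re_add Im_add Re_opp Im_opp !ler_norml => /andP[i1 i2] /andP[r1 r2].
by split; rewrite /= in_itv /=; apply/andP; split; move: i1 i2 r1 r2; lra.
Qed.

End ComplexTopology.

(** * Complex differentiability and derivatives of plane curves *)

Section Differentiation.
Variable R : realType.
Notation C := (Cx R).
Implicit Types (z w : C).

(** Error form of complex differentiability: without a quotient the point w = z need not be
    excluded, and restriction to real lines is direct ([cder_line]). *)
Definition cdiff (F : C -> C) z (l : C) := forall e : R, 0 < e ->
  exists2 d : R, 0 < d & forall w, nm (w - z) < d ->
    nm (F w - F z - l * (w - z)) <= e * nm (w - z).

Lemma derivable_cdiff (F : C -> C) z : derivable F z 1 -> cdiff F z ('D_1 F z).
Proof.
move=> dF e e0.
have := dF; rewrite /derivable => /(_ _) H.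
have /(_ [set w | nm (w - 'D_1 F z) < e]) := H.
rewrite -/(derive F z 1) => /(_ _)/nbhs_ballP[|d /= d0 dP].
  by apply/nbhsCP; exists e.
have := d0; rewrite ltcE /= => /andP[/eqP d0i d0r].
exists (Re d) => // w wd; have [->|wz] := eqVneq w z.
  by rewrite !subrr mulr0 subr0 nm0 mulr0.
have wz0 : w - z != 0 by rewrite subr_eq0.
have /= := dP (w - z) _ wz0; rewrite /ball /= sub0r normrN nmE ltcE /= d0i eqxx /=.
move=> /(_ wd); rewrite [_ *: 1]mulr1 subrK => H1.
have -> : F w - F z - 'D_1 F z * (w - z) =
  ((w - z)^-1 *: (F w - F z) - 'D_1 F z) * (w - z).
  by rewrite mulrBl /GRing.scale /= mulrAC mulVf// mul1r.
by rewrite nmM ler_wpM2r ?nm_ge0// ltW.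
Qed.

Lemma cdiff_derivable (F : C -> C) z l : cdiff F z l ->
  derivable F z 1 /\ 'D_1 F z = l.
Proof.
move=> dF; suff H : (fun h : C => h^-1 *: ((F \o shift z) (h *: 1) - F z)) @ 0^' --> l.
  by split; [apply/cvg_ex; exists l|exact: cvg_lim].
move=> P /nbhsCP[e e0 eP].
have e2 : 0 < e / 2 by rewrite divr_gt0.
have [d d0 dP] := dF _ e2.
apply/nbhs_ballP; exists d%:C; first by rewrite /= ltcR.
move=> w; rewrite /ball /= sub0r normrN nmE ltcR => wd w0; apply: eP.
rewrite [_ *: 1]mulr1; have := dP (w + z); rewrite addrK => /(_ wd) H.
have -> : w^-1 *: (F (w + z) - F z) - l = (F (w + z) - F z - l * w) / w.
  by rewrite mulrBl mulfK// /GRing.scale /= mulrC.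
rewrite nmM nmV ltr_pdivrMr; last by rewrite lt0r nm_eq0 w0 nm_ge0.
apply: le_lt_trans H _; rewrite ltr_pM2r; last by rewrite lt0r nm_eq0 w0 nm_ge0.
by rewrite ltr_pdivrMr// mulr_natr mulr2n ltrDl.
Qed.

Lemma derivable_continuous (F : C -> C) z : derivable F z 1 -> {for z, continuous F}.
Proof. by move=> /derivable1_diffP/differentiable_continuous. Qed.

Lemma is_derive_eps (g : R -> R) t l :
  (forall e : R, 0 < e -> exists2 d : R, 0 < d & forall x, `|x - t| < d ->
    `|g x - g t - (x - t) * l| <= e * `|x - t|) -> is_derive t 1 g l.
Proof.
move=> dF; suff H : (fun h : R => h^-1 *: ((g \o shift t) (h *: 1) - g t)) @ 0^' --> l.
  by split; [apply/cvg_ex; exists l|exact: cvg_lim].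
apply/cvgrPdist_lt => e e0.
have e2 : 0 < e / 2 by rewrite divr_gt0.
have [d d0 dP] := dF _ e2.
apply/nbhs_ballP; exists d; first by [].
move=> w; rewrite /ball /= sub0r normrN => wd w0.
rewrite [_ *: 1]mulr1; have := dP (w + t); rewrite addrK => /(_ wd) H.
have -> : l - w^-1 *: (g (w + t) - g t) = - ((g (w + t) - g t - w * l) / w).
  by rewrite /GRing.scale /=; field.
rewrite normrN normrM normfV ltr_pdivrMr ?normr_gt0//.
apply: le_lt_trans H _; rewrite ltr_pM2r ?normr_gt0//.
by rewrite ltr_pdivrMr// mulr_natr mulr2n ltrDl.
Qed.

Definition cder (g : R -> C) (t : R) (l : C) :=
  is_derive t 1 (fun x => Re (g x)) (Re l) /\ is_derive t 1 (fun x => Im (g x)) (Im l).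

Lemma cder_eq g t l l' : cder g t l -> l = l' -> cder g t l'.
Proof. by move=> + <-. Qed.

Lemma cder_uniq g t l l' : cder g t l -> cder g t l' -> l = l'.
Proof.
move=> [a b] [a' b']; apply: eq_ReIm.
  by rewrite -(@derive_val _ _ _ _ _ _ _ a) -(@derive_val _ _ _ _ _ _ _ a').
by rewrite -(@derive_val _ _ _ _ _ _ _ b) -(@derive_val _ _ _ _ _ _ _ b').
Qed.

Lemma cder_near g g' t l : (\forall x \near t, g x = g' x) -> cder g t l -> cder g' t l.
Proof.
move=> gg [a b]; split; [apply: near_eq_is_derive a|apply: near_eq_is_derive b];
  by apply: filterS gg => x ->.
Qed.

Lemma cder_cst (c : C) t : cder (fun=> c) t 0.
Proof. by split; exact: is_derive_cst. Qed.

Lemma cderD g g' t l l' : cder g t l -> cder g' t l' -> cder (fun x => g x + g' x) t (l + l').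
Proof.
move=> [a b] [a' b']; split.
  have -> : (fun x => Re (g x + g' x)) = (fun x => Re (g x)) + (fun x => Re (g' x)).
    by apply/funext => x; rewrite Re_add.
  by rewrite Re_add; exact: is_deriveD.
have -> : (fun x => Im (g x + g' x)) = (fun x => Im (g x)) + (fun x => Im (g' x)).
  by apply/funext => x; rewrite Im_add.
by rewrite Im_add; exact: is_deriveD.
Qed.

Lemma cderN g t l : cder g t l -> cder (fun x => - g x) t (- l).
Proof.
move=> [a b]; split.
  have -> : (fun x => Re (- g x)) = - (fun x => Re (g x)).
    by apply/funext => x; rewrite Re_opp.
  by rewrite Re_opp; exact: is_deriveN.
have -> : (fun x => Im (- g x)) = - (fun x => Im (g x)).
  by apply/funext => x; rewrite Im_opp.
by rewrite Im_opp; exact: is_deriveN.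
Qed.

Lemma cder_conj g t l : cder g t l -> cder (fun x => (g x)^*%R) t (l^*)%R.
Proof.
move=> [a b]; split.
  have -> : (fun x => Re ((g x)^*%R)) = (fun x => Re (g x)).
    by apply/funext => x; rewrite Re_conjE.
  by rewrite Re_conjE.
have -> : (fun x => Im ((g x)^*%R)) = - (fun x => Im (g x)).
  by apply/funext => x; rewrite Im_conjE.
by rewrite Im_conjE; exact: is_deriveN.
Qed.

Lemma cderM g g' t l l' : cder g t l -> cder g' t l' ->
  cder (fun x => g x * g' x) t (l * g' t + g t * l').
Proof.
move=> [a b] [a' b']; split.
  have -> : (fun x => Re (g x * g' x)) = (fun x => Re (g x)) * (fun x => Re (g' x)) -
    (fun x => Im (g x)) * (fun x => Im (g' x)).
    by apply/funext => x; rewrite Re_mul.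
  apply: (@is_derive_eq _ _ _ _ _ _ _ _ (is_deriveB (is_deriveM a a') (is_deriveM b b'))).
  by rewrite /GRing.scale /= Re_add !Re_mul; ring.
have -> : (fun x => Im (g x * g' x)) = (fun x => Re (g x)) * (fun x => Im (g' x)) +
    (fun x => Im (g x)) * (fun x => Re (g' x)).
  by apply/funext => x; rewrite Im_mul.
apply: (@is_derive_eq _ _ _ _ _ _ _ _ (is_deriveD (is_deriveM a b') (is_deriveM b a'))).
by rewrite /GRing.scale /= Im_add !Im_mul; ring.
Qed.

Lemma cder_continuous g t l : cder g t l -> {for t, continuous g}.
Proof.
move=> [[a _] [b _]]; apply: cvgC_ReIm.
  by move: a => /derivable1_diffP/differentiable_continuous.
by move: b => /derivable1_diffP/differentiable_continuous.
Qed.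

Lemma cder_near_neq0 g t l : cder g t l -> g t != 0 -> \forall x \near t, g x != 0.
Proof.
move=> /cder_continuous gc gt0.
have : \forall x \near t, nm (g x - g t) < nm (g t).
  by move/cvgCP: gc; apply; rewrite lt0r nm_ge0 nm_eq0 gt0.
apply: filterS => x; apply: contraTneq => ->.
by rewrite sub0r nmN ltxx.
Qed.

(** Writing 1/g as the conjugate of g over |g|^2 leaves only a real function to invert. The value of
    the derivative is left open here; [cderV_eq] recovers it by differentiating g / g = 1. *)
Lemma cderV g t l : cder g t l -> g t != 0 -> exists l', cder (fun x => (g x)^-1) t l'.
Proof.
move=> dg gt0.
pose n x := Re (g x) ^+ 2 + Im (g x) ^+ 2.
have ng x : n x = nm (g x) ^+ 2 by rewrite nm_sqr.
have nt0 : n t != 0 by rewrite ng expf_eq0 /= nm_eq0.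
have [a b] := dg.
have [dn _] : is_derive t 1 ((fun x => Re (g x)) * (fun x => Re (g x)) +
   (fun x => Im (g x)) * (fun x => Im (g x))) _ :=
   is_deriveD (is_deriveM a a) (is_deriveM b b).
have nE : (fun x => Re (g x)) * (fun x => Re (g x)) +
   (fun x => Im (g x)) * (fun x => Im (g x)) = n.
  by apply/funext => x; rewrite /n !expr2.
rewrite nE in dn.
have dV := derivableV nt0 dn.
have HE x : (g x)^-1 = (n x)^-1%:C * ((g x)^*)%R.
  have [g0|g0] := eqVneq (g x) 0; first by rewrite g0 invr0 rmorph0 mulr0.
  apply: (mulfI g0); rewrite mulfV// mulrCA nm_mulconj -ng -rmorphM /= mulVf//.
  by rewrite ng expf_eq0 /= nm_eq0.
have := @cderM (fun x => (n x)^-1%:C) _ t ('D_1 (fun x => (n x)^-1) t)%:C _ _ (cder_conj dg).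
case.
  split; first exact: derivableP.
  exact: is_derive_cst.
move=> h1 h2; eexists; split.
  by under eq_fun do rewrite HE; exact: h1.
by under eq_fun do rewrite HE; exact: h2.
Qed.

Lemma cder_line (F : C -> C) z v t l : cdiff F (z + t%:C * v) l ->
  cder (real_line F v z) t (l * v).
Proof.
move=> dF.
have H e : 0 < e -> exists2 d : R, 0 < d & forall x, `|x - t| < d ->
    nm (real_line F v z x - real_line F v z t - (x - t)%:C * (l * v)) <= e * `|x - t|.
  (* The summand 1 keeps the divisor positive when v = 0. *)
  move=> e0; have v0 : 0 < nm v + 1 by rewrite ltr_wpDl// nm_ge0.
  have [d d0 dP] := dF (e / (nm v + 1)) (divr_gt0 e0 v0).
  exists (d / (nm v + 1)) => [|x]; first by rewrite divr_gt0.
  rewrite ltr_pdivlMr// => xd.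
  have xE : z + x%:C * v - (z + t%:C * v) = (x - t)%:C * v.
    by rewrite rmorphB /=; ring.
  have := dP (z + x%:C * v); rewrite xE nmM nm_real => /(_ _) H.
  apply: le_trans (_ : e / (nm v + 1) * (`|x - t| * nm v) <= _).
    rewrite /real_line; have -> : (x - t)%:C * (l * v) = l * ((x - t)%:C * v) by ring.
    apply: H; apply: le_lt_trans xd; rewrite ler_wpM2l// lerDl//.
  rewrite -mulrA ler_pM2l// mulrCA ler_piMr//.
  by rewrite mulrC ler_pdivrMr// mul1r lerDl.
split; apply: is_derive_eps => e e0; have [d d0 dP] := H _ e0; exists d => // x xd;
  apply: le_trans (dP x xd).
  by apply: le_trans (le_Re_nm _); rewrite !(Re_add, Re_opp, Re_mul) /= mul0r subr0.
by apply: le_trans (le_Im_nm _); rewrite !(Im_add, Im_opp, Im_mul) /= mul0r addr0.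
Qed.

End Differentiation.

(** * Integrals of complex functions over real segments *)

Section CurveIntegral.
Variable R : realType.
Notation C := (Cx R).
Notation mu := (@lebesgue_measure R).

Definition ccont (a b : R) (g : R -> C) :=
  forall t, t \in `[a, b]%R -> {for t, continuous g}.

Definition cint (a b : R) (g : R -> C) : C :=
  (\int[mu]_(x in `[a, b]) Re (g x)) +i* (\int[mu]_(x in `[a, b]) Im (g x)).

Lemma cont_Re_Im (g : R -> C) t : {for t, continuous g} ->
  {for t, continuous (fun x => Re (g x))} /\ {for t, continuous (fun x => Im (g x))}.
Proof.
move=> gt; split.
  by apply: continuous_comp gt _; exact: Re_continuous.
by apply: continuous_comp gt _; exact: Im_continuous.
Qed.

Lemma ccont_integrable a b g : ccont a b g ->
  mu.-integrable `[a, b] (EFin \o (fun x => Re (g x))) /\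
  mu.-integrable `[a, b] (EFin \o (fun x => Im (g x))).
Proof.
move=> cg; split; (apply: continuous_compact_integrable; first exact: segment_compact);
  apply: continuous_in_subspaceT => t; rewrite inE => /cg/cont_Re_Im[].
  by [].
by [].
Qed.

Lemma ccontZ a b (k : C) g : ccont a b g -> ccont a b (fun x => k * g x).
Proof. by move=> cg t tab; apply: cvgMr; exact: cg. Qed.

Lemma cintD a b g h : ccont a b g -> ccont a b h ->
  cint a b (fun x => g x + h x) = cint a b g + cint a b h.
Proof.
move=> /ccont_integrable[g1 g2] /ccont_integrable[h1 h2].
apply: eq_ReIm; rewrite ?(Re_add, Im_add) /=; rewrite -RintegralD//;
  by apply: eq_Rintegral => x _; rewrite (Re_add, Im_add).
Qed.

Lemma cintZ a b k g : ccont a b g -> cint a b (fun x => k * g x) = k * cint a b g.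
Proof.
move=> /ccont_integrable[g1 g2].
have zi (r : R) (h : R -> R) : mu.-integrable `[a, b] (EFin \o h) ->
    mu.-integrable `[a, b] (EFin \o (fun x => r * h x)).
  by move=> ih; exact: (@integrableZl _ _ _ mu `[a, b] _ r _ ih).
apply: eq_ReIm; rewrite ?(Re_mul, Im_mul) /=.
  rewrite -!RintegralZl// -RintegralB//; try exact: zi.
  by apply: eq_Rintegral => x _; rewrite Re_mul.
rewrite -!RintegralZl// -RintegralD//; try exact: zi.
by apply: eq_Rintegral => x _; rewrite Im_mul.
Qed.

Lemma eq_cint a b g h : (forall x, x \in `[a, b]%R -> g x = h x) ->
  cint a b g = cint a b h.
Proof.
move=> gh; apply: eq_ReIm; apply: eq_Rintegral => x; rewrite inE => xab;
  by rewrite gh.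
Qed.

Lemma le_Rint (a b m M : R) (f : R -> R) : a <= b ->
  mu.-integrable `[a, b] (EFin \o f) ->
  (forall x, x \in `[a, b]%R -> m <= f x <= M) ->
  m * (b - a) <= \int[mu]_(x in `[a, b]) f x <= M * (b - a).
Proof.
move=> ab fi fM.
have ic (k : R) : mu.-integrable `[a, b] (EFin \o cst k).
  apply: continuous_compact_integrable; first exact: segment_compact.
  by apply: continuous_subspaceT => x; exact: cvg_cst.
have cE (k : R) : \int[mu]_(x in `[a, b]) (cst k x) = k * (b - a).
  rewrite Rintegral_cst//= lebesgue_measure_itv /= lte_fin.
  by move: ab; rewrite le_eqVlt => /predU1P[->|->//]; rewrite ltxx subrr.
by rewrite -!cE; apply/andP; split; apply: le_Rintegral => // x; rewrite /= => /fM/andP[].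
Qed.

(** The factor 2 comes from bounding real and imaginary parts separately; it is harmless, since the
    arguments below only need the order of magnitude. *)
Lemma cint_bound a b M g : a <= b -> ccont a b g ->
  (forall x, x \in `[a, b]%R -> nm (g x) <= M) -> nm (cint a b g) <= 2 * (M * (b - a)).
Proof.
move=> ab /ccont_integrable[g1 g2] gM.
have H1 : `|Re (cint a b g)| <= M * (b - a).
  rewrite ler_norml -mulNr; apply: le_Rint => // x /gM; rewrite -ler_norml.
  by apply: le_trans; exact: le_Re_nm.
have H2 : `|Im (cint a b g)| <= M * (b - a).
  rewrite ler_norml -mulNr; apply: le_Rint => // x /gM; rewrite -ler_norml.
  by apply: le_trans; exact: le_Im_nm.
by apply: le_trans (nm_le_ReIm _) _; rewrite mulr_natl mulr2n lerD.
Qed.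

Lemma cint_split a x b g : a <= x <= b -> ccont a b g ->
  cint a b g = cint a x g + cint x b g.
Proof.
move=> /andP[ax xb] cg; have [g1 g2] := ccont_integrable cg.
have H (h : R -> R) : mu.-integrable `[a, b] (EFin \o h) ->
   \int[mu]_(x in `[a, b]) h x = \int[mu]_(x in `[a, x]) h x + \int[mu]_(x in `[x, b]) h x.
  move=> ih; have := @Rintegral_itvB _ h (BLeft a) (BRight b) x ih.
  rewrite !bnd_simp => /(_ ax xb)/eqP; rewrite subr_eq => /eqP ->.
  rewrite addrC; congr (_ + _); rewrite Rintegral_itv_obnd_cbnd//.
  by apply: integrableS ih => //; apply: subset_itv; rewrite bnd_simp.
by apply: eq_ReIm; rewrite ?(Re_add, Im_add) /=; exact: H.
Qed.

Lemma cint_FTC a b (G g : R -> C) : a <= b -> ccont a b g ->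
  (forall t, t \in `[a, b]%R -> cder G t (g t)) -> cint a b g = G b - G a.
Proof.
rewrite le_eqVlt => /predU1P[<-|ab] cg dG.
  by rewrite subrr; apply: eq_ReIm; rewrite /cint set_itv1 /= Rintegral_set1.
have H (f F : R -> R) : (forall t, t \in `[a, b]%R -> {for t, continuous f}) ->
   (forall t, t \in `[a, b]%R -> is_derive t 1 F (f t)) ->
   \int[mu]_(x in `[a, b]) f x = F b - F a.
  move=> cf dF; rewrite /Rintegral (@continuous_FTC2 _ f F)//.
  - by apply: continuous_in_subspaceT => t; rewrite inE => /cf.
  - have cF t : t \in `[a, b]%R -> F x @[x --> t] --> F t.
      by move=> /dF [/derivable1_diffP/differentiable_continuous].
    split.
    + by move=> t tab; have [] := dF t (subset_itv_oo_cc tab).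
    + by apply: cvg_at_right_filter; apply: cF; rewrite in_itv /= lexx ltW.
    + by apply: cvg_at_left_filter; apply: cF; rewrite in_itv /= lexx ltW.
  - by move=> t tab; have [_ <-] := dF t (subset_itv_oo_cc tab); rewrite derive1E.
apply: eq_ReIm; rewrite ?(Re_add, Im_add, Re_opp, Im_opp) /=.
  apply: (H _ (fun x => Re (G x))) => t tab; first by have [] := cont_Re_Im (cg t tab).
  by have [] := dG t tab.
apply: (H _ (fun x => Im (G x))) => t tab; first by have [] := cont_Re_Im (cg t tab).
by have [] := dG t tab.
Qed.

End CurveIntegral.

(** * Contour integrals along the boundary of a rectangle *)

Section Goursat.
Variable R : realType.
Notation C := (Cx R).
Implicit Types (f g : C -> C) (z w : C) (a b c d : R).

Definition rect a b c d : set C :=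
  [set z | Re z \in `[a, b]%R /\ Im z \in `[c, d]%R].

Definition horline f c : R -> C := fun x => f (x +i* c).
Definition vertline f a : R -> C := fun y => f (a +i* y).

(** The contour integral of f dz, counterclockwise; on the vertical sides dz = i dy. *)
Definition bdint a b c d f : C :=
  cint a b (horline f c) + 'i%C * cint c d (vertline f b)
  - cint a b (horline f d) - 'i%C * cint c d (vertline f a).

Definition cont_on (A : set C) f := forall z, A z -> {for z, continuous f}.

Lemma hline_ccont a b c d e f : cont_on (rect a b c d) f -> e \in `[c, d]%R ->
  ccont a b (horline f e).
Proof.
move=> cf ed t tab; apply: (@continuous_comp _ _ _ (fun x : R => x +i* e : C) f).
  by apply: cvgC_ReIm => //=; exact: cvg_cst.
exact: cf.
Qed.

Lemma vline_ccont a b c d e f : cont_on (rect a b c d) f -> e \in `[a, b]%R ->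
  ccont c d (vertline f e).
Proof.
move=> cf ed t tab; apply: (@continuous_comp _ _ _ (fun x : R => e +i* x : C) f).
  by apply: cvgC_ReIm => //=; exact: cvg_cst.
exact: cf.
Qed.

Lemma lowb a b : a <= b -> a \in `[a, b]%R.
Proof. by move=> ab; rewrite in_itv /= lexx. Qed.
Lemma uppb a b : a <= b -> b \in `[a, b]%R.
Proof. by move=> ab; rewrite in_itv /= lexx andbT. Qed.

Lemma cont_onS (A B : set C) f : A `<=` B -> cont_on B f -> cont_on A f.
Proof. by move=> AB cf z /AB; exact: cf. Qed.

Lemma rectS a b c d a' b' c' d' : a <= a' -> b' <= b -> c <= c' -> d' <= d ->
  rect a' b' c' d' `<=` rect a b c d.
Proof.
by move=> h1 h2 h3 h4 z [zx zy]; split; move: zx zy; rewrite !in_itv /= =>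
 /andP[? ?] /andP[? ?]; apply/andP; split; lra.
Qed.

Lemma bdint_vsplit a x b c d f : a <= x <= b -> c <= d -> cont_on (rect a b c d) f ->
  bdint a b c d f = bdint a x c d f + bdint x b c d f.
Proof.
move=> axb cd cf; have ab : a <= b by case/andP: axb; exact: le_trans.
rewrite /bdint (@cint_split _ a x b (horline f c))//; last first.
  by apply: hline_ccont cf _; exact: lowb.
rewrite (@cint_split _ a x b (horline f d))//; last first.
  by apply: hline_ccont cf _; exact: uppb.
ring.
Qed.

Lemma bdint_hsplit a b c y d f : a <= b -> c <= y <= d -> cont_on (rect a b c d) f ->
  bdint a b c d f = bdint a b c y f + bdint a b y d f.
Proof.
move=> ab cyd cf; have cd : c <= d by case/andP: cyd; exact: le_trans.
rewrite /bdint (@cint_split _ c y d (vertline f b))//; last first.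
  by apply: vline_ccont cf _; exact: uppb.
rewrite (@cint_split _ c y d (vertline f a))//; last first.
  by apply: vline_ccont cf _; exact: lowb.
ring.
Qed.

(** Linearity and bounds are stated with continuity on the boundary only, because the Cauchy kernels
    have their pole inside the rectangle. *)
Definition bnd a b c d : set C := [set z | rect a b c d z /\
  [\/ Re z = a, Re z = b, Im z = c | Im z = d]].

Lemma bhline_ccont a b c d e f : cont_on (bnd a b c d) f -> c <= d ->
  e = c \/ e = d -> ccont a b (horline f e).
Proof.
move=> cf cd ed t tab; apply: (@continuous_comp _ _ _ (fun x : R => x +i* e : C) f).
  by apply: cvgC_ReIm => //=; exact: cvg_cst.
by apply: cf; case: ed => ->; split; [split=> //=; exact: lowb|exact: Or43|
 split=> //=; exact: uppb|exact: Or44].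
Qed.

Lemma bvline_ccont a b c d e f : cont_on (bnd a b c d) f -> a <= b ->
  e = a \/ e = b -> ccont c d (vertline f e).
Proof.
move=> cf cd ed t tab; apply: (@continuous_comp _ _ _ (fun x : R => e +i* x : C) f).
  by apply: cvgC_ReIm => //=; exact: cvg_cst.
by apply: cf; case: ed => ->; split; [split=> //=; exact: lowb|exact: Or41|
 split=> //=; exact: uppb|exact: Or42].
Qed.

Lemma bnd_rect a b c d : bnd a b c d `<=` rect a b c d.
Proof. by move=> z []. Qed.

Lemma bdintD a b c d f g : a <= b -> c <= d ->
  cont_on (bnd a b c d) f -> cont_on (bnd a b c d) g ->
  bdint a b c d (fun z => f z + g z) = bdint a b c d f + bdint a b c d g.
Proof.
move=> ab cd cf cg.
have hD e : e = c \/ e = d -> cint a b (horline (fun z => f z + g z) e) =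
    cint a b (horline f e) + cint a b (horline g e).
  by move=> ee; apply: (@cintD _ a b (horline f e) (horline g e));
    [exact: bhline_ccont cf cd ee|exact: bhline_ccont cg cd ee].
have vD e : e = a \/ e = b -> cint c d (vertline (fun z => f z + g z) e) =
    cint c d (vertline f e) + cint c d (vertline g e).
  by move=> ee; apply: (@cintD _ c d (vertline f e) (vertline g e));
    [exact: bvline_ccont cf ab ee|exact: bvline_ccont cg ab ee].
rewrite /bdint !hD ?vD; [|by left|by right|by right|by left].
by move: (cint _ _ (horline f c)) (cint _ _ (horline g c)) (cint _ _ (horline f d))
  (cint _ _ (horline g d)) (cint _ _ (vertline f a)) (cint _ _ (vertline g a))
  (cint _ _ (vertline f b)) (cint _ _ (vertline g b)) => *; ring.
Qed.

Lemma bdintZ a b c d k f : a <= b -> c <= d -> cont_on (bnd a b c d) f ->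
  bdint a b c d (fun z => k * f z) = k * bdint a b c d f.
Proof.
move=> ab cd cf.
have hZ e : e = c \/ e = d -> cint a b (horline (fun z => k * f z) e) =
    k * cint a b (horline f e).
  by move=> ee; apply: (@cintZ _ a b k (horline f e)); exact: bhline_ccont cf cd ee.
have vZ e : e = a \/ e = b -> cint c d (vertline (fun z => k * f z) e) =
    k * cint c d (vertline f e).
  by move=> ee; apply: (@cintZ _ c d k (vertline f e)); exact: bvline_ccont cf ab ee.
rewrite /bdint !hZ ?vZ; [|by left|by right|by right|by left].
by rewrite !mulrBr mulrDr !(mulrCA k).
Qed.

Lemma eq_bdint a b c d f g : a <= b -> c <= d ->
  (forall z, bnd a b c d z -> f z = g z) -> bdint a b c d f = bdint a b c d g.
Proof.
move=> ab cd fg; rewrite /bdint; congr (_ + 'i%C * _ - _ - 'i%C * _);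
  apply: eq_cint => x xab; apply: fg; split; (try by split=> //=; (exact: lowb || exact: uppb)).
- exact: Or43.
- exact: Or42.
- exact: Or44.
- exact: Or41.
Qed.

Lemma bdint_bound a b c d M f : a <= b -> c <= d -> cont_on (bnd a b c d) f ->
  (forall z, bnd a b c d z -> nm (f z) <= M) ->
  nm (bdint a b c d f) <= 4 * (M * (b - a)) + 4 * (M * (d - c)).
Proof.
move=> ab cd cf fM.
have n1 : nm ('i%C : C) = 1 by rewrite nm_sqrt /= expr0n expr1n add0r sqrtr1.
have b1 : nm (cint a b (horline f c)) <= 2 * (M * (b - a)).
  apply: cint_bound => //; first by apply: bhline_ccont cf cd _; left.
  move=> x xab; apply: fM; split; [split=> //=; exact: lowb|exact: Or43].
have b2 : nm (cint a b (horline f d)) <= 2 * (M * (b - a)).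
  apply: cint_bound => //; first by apply: bhline_ccont cf cd _; right.
  move=> x xab; apply: fM; split; [split=> //=; exact: uppb|exact: Or44].
have b3 : nm (cint c d (vertline f a)) <= 2 * (M * (d - c)).
  apply: cint_bound => //; first by apply: bvline_ccont cf ab _; left.
  move=> x xab; apply: fM; split; [split=> //=; exact: lowb|exact: Or41].
have b4 : nm (cint c d (vertline f b)) <= 2 * (M * (d - c)).
  apply: cint_bound => //; first by apply: bvline_ccont cf ab _; right.
  move=> x xab; apply: fM; split; [split=> //=; exact: uppb|exact: Or42].
rewrite /bdint; apply: le_trans (nm_triangle _ _) _.
rewrite nmN nmM n1 mul1r.
have := nm_triangle (cint a b (horline f c) + 'i%C * cint c d (vertline f b))
  (- cint a b (horline f d)).
have := nm_triangle (cint a b (horline f c)) ('i%C * cint c d (vertline f b)).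
rewrite nmN nmM n1 mul1r; lra.
Qed.

End Goursat.

(** * Goursat's theorem for rectangles *)

Section GoursatTheorem.
Variable R : realType.
Notation C := (Cx R).
Implicit Types (f g : C -> C) (z w : C) (a b c d : R).

Lemma cder_hline c t : cder (fun x : R => x +i* c : C) t 1.
Proof. by split => /=; [exact: is_derive_id|exact: is_derive_cst]. Qed.

Lemma cder_vline a t : cder (fun y : R => a +i* y : C) t 'i%C.
Proof. by split => /=; [exact: is_derive_cst|exact: is_derive_id]. Qed.

Lemma continuous_affine (k l z : C) : {for z, continuous (fun v : C => k + l * v)}.
Proof.
have -> : (fun v : C => k + l * v) = cst k + cst l * id by [].
apply: derivable_continuous; apply: derivableD; first exact: derivable_cst.
by apply: derivableM; [exact: derivable_cst|exact: derivable_id].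
Qed.

Lemma cont_onD (A : set C) f g : cont_on A f -> cont_on A g ->
  cont_on A (fun z => f z + g z).
Proof. by move=> cf cg z Az; exact: (continuousD (cf z Az) (cg z Az)). Qed.

Lemma cont_onM (A : set C) f g : cont_on A f -> cont_on A g ->
  cont_on A (fun z => f z * g z).
Proof. by move=> cf cg z Az; exact: (continuousM (cf z Az) (cg z Az)). Qed.

Lemma bdint_affine (k l : C) a b c d : a <= b -> c <= d ->
  bdint a b c d (fun z => k + l * z) = 0.
Proof.
move=> ab cd; set f := fun z => _.
have cf (z : C) : {for z, continuous f} by exact: continuous_affine.
pose G (z : C) := k * z + l / 2 * (z * z).
have dG (p : R -> C) t v : cder p t v -> cder (fun x => G (p x)) t (v * f (p t)).
  move=> dp; apply: (cder_eq (cderD (cderM (cder_cst k t) dp)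
    (cderM (cder_cst (l / 2) t) (cderM dp dp)))).
  by rewrite /f /=; field.
have H e : cint a b (horline f e) = G (b +i* e) - G (a +i* e).
  apply: (@cint_FTC _ a b (fun x => G (x +i* e))) => //.
    by apply: (@hline_ccont _ a b e e) => [z _|]; [exact: cf|rewrite in_itv /= lexx].
  move=> t _; have := dG _ _ _ (cder_hline e t); rewrite mul1r; exact.
have V e : 'i%C * cint c d (vertline f e) = G (e +i* d) - G (e +i* c).
  rewrite -cintZ; last first.
    by apply: (@vline_ccont _ e e c d) => [z _|]; [exact: cf|rewrite in_itv /= lexx].
  apply: (@cint_FTC _ c d (fun x => G (e +i* x))) => //.
    apply: ccontZ.
    by apply: (@vline_ccont _ e e c d) => [z _|]; [exact: cf|rewrite in_itv /= lexx].
  move=> t _; exact: dG _ _ _ (cder_vline e t).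
rewrite /bdint !H !V.
by move: (G _) (G _) (G _) (G _) => *; ring.
Qed.

Lemma lt_pow2 (x : R) : exists n, x < 2 ^+ n.
Proof.
exists (Num.Def.archi_bound x).
have [x0|x0] := leP 0 x; last by apply: lt_le_trans x0 _; rewrite exprn_ge0.
apply: lt_trans (archi_boundP x0) _.
by rewrite -natrX ltr_nat ltn_expl.
Qed.

(** One coordinate of a nested sequence of halved rectangles: [u] lists the left ends, and their
    supremum is the common point. *)
Lemma nested_dyadic (u : nat -> R) (w : R) : 0 <= w ->
  (forall n, u n <= u n.+1 <= u n + w / 2 ^+ n.+1) ->
  exists x, forall n, u n <= x <= u n + w / 2 ^+ n.
Proof.
move=> w0 uS.
have p0 n : 0 < (2 : R) ^+ n by rewrite exprn_gt0.
have half n : w / 2 ^+ n = w / 2 ^+ n.+1 + w / 2 ^+ n.+1.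
  by rewrite exprS; field; rewrite gt_eqF.
have H n k : u n <= u (n + k)%N /\ u (n + k)%N + w / 2 ^+ (n + k) <= u n + w / 2 ^+ n.
  elim: k => [|k [IH1 IH2]]; first by rewrite addn0.
  have /andP[h1 h2] := uS (n + k)%N; have := half (n + k)%N.
  by rewrite addnS; split; lra.
have wn n : 0 <= w / 2 ^+ n by rewrite divr_ge0// ltW.
have H2 n m : u m <= u n + w / 2 ^+ n.
  have [/subnKC <-|/ltnW/subnKC <-] := leqP m n.
    by have [h _] := H m (n - m)%N; apply: le_trans h _; rewrite lerDl.
  by have [_ h] := H n (m - n)%N; apply: le_trans h; rewrite lerDl.
exists (sup (range u)) => n; apply/andP; split.
  apply: ub_le_sup; last by exists n.
  by exists (u 0%N + w / 2 ^+ 0) => _ [m _ <-]; exact: H2.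
by apply: ge_sup; [exists (u 0%N), 0%N|move=> _ [m _ <-]; exact: H2].
Qed.

Lemma bdint_quarter a b c d f : a <= b -> c <= d -> cont_on (rect a b c d) f ->
  let x := (a + b) / 2 in let y := (c + d) / 2 in
  bdint a b c d f = bdint a x c y f + bdint x b c y f + (bdint a x y d f + bdint x b y d f).
Proof.
move=> ab cd cf x y.
have ax : a <= x by rewrite /x; lra.
have xb : x <= b by rewrite /x; lra.
have cy : c <= y by rewrite /y; lra.
have yd : y <= d by rewrite /y; lra.
rewrite (@bdint_hsplit _ a b c y d)//; last by rewrite cy.
by rewrite !(@bdint_vsplit _ a x b) ?ax//; apply: cont_onS cf; apply: rectS.
Qed.

Lemma dyadic_child (a b x v v2 u : R) : a <= x -> x + v <= b -> v = v2 + v2 ->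
  0 <= v2 -> u = x \/ u = x + v2 -> [/\ a <= u, u + v2 <= b & x <= u <= x + v2].
Proof. by move=> ? ? ? ? [|] ->; split; lra. Qed.

Lemma quarter_le (m0 m1 m2 m3 m4 : R) : 4 * m1 < m0 -> 4 * m2 < m0 -> 4 * m3 < m0 ->
  4 * m4 < m0 -> m0 <= m1 + m2 + (m3 + m4) -> False.
Proof. by move=> *; lra. Qed.

(** Goursat's bisection: one of the four quarters carries at least a quarter of the integral, and
    the chosen rectangles shrink to a point z. Near z, f differs from its affine tangent by e times
    the distance to z; the tangent has zero integral, so the integral over the n-th rectangle is at
    most a constant times e / 4^n, which contradicts the lower bound when e is small. *)
Lemma goursat a b c d f : a <= b -> c <= d ->
  (forall z, rect a b c d z -> derivable f z 1) -> bdint a b c d f = 0.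
Proof.
move=> ab cd df; apply/eqP; apply: contraT => mu0.
have cf : cont_on (rect a b c d) f by move=> z /df; exact: derivable_continuous.
set w := b - a; set h := d - c.
have w0 : 0 <= w by rewrite subr_ge0.
have h0 : 0 <= h by rewrite subr_ge0.
have p0 n : 0 < (2 : R) ^+ n by rewrite exprn_gt0.
have half (v : R) n : v / 2 ^+ n = v / 2 ^+ n.+1 + v / 2 ^+ n.+1.
  by rewrite exprS; field; rewrite gt_eqF.
have ge0 (v : R) n : 0 <= v -> 0 <= v / 2 ^+ n by move=> v0; rewrite divr_ge0// ltW.
pose Q n (p : R * R) := bdint p.1 (p.1 + w / 2 ^+ n) p.2 (p.2 + h / 2 ^+ n) f.
pose inside n (p : R * R) := [/\ a <= p.1, p.1 + w / 2 ^+ n <= b, c <= p.2 &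
  p.2 + h / 2 ^+ n <= d].
(* The condition of lying inside is put under the existential so that [choice] yields a total
   function; elsewhere the value is the dummy (0, 0). *)
have step (np : nat * (R * R)) : exists q : R * R, inside np.1 np.2 ->
    [/\ inside np.1.+1 q, np.2.1 <= q.1 <= np.2.1 + w / 2 ^+ np.1.+1,
     np.2.2 <= q.2 <= np.2.2 + h / 2 ^+ np.1.+1 &
     nm (Q np.1 np.2) <= 4 * nm (Q np.1.+1 q)].
  case: np => n [x y] /=; case: (pselect (inside n (x, y))) => [[/= i1 i2 i3 i4]|]; last first.
    by move=> ni; exists (0, 0).
  have wn := ge0 w n w0; have hn := ge0 h n h0.
  have ws := half w n; have hs := half h n.
  have wn1 := ge0 w n.+1 w0; have hn1 := ge0 h n.+1 h0.
  have qE := @bdint_quarter x (x + w / 2 ^+ n) y (y + h / 2 ^+ n) f.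
  move: qE; set x' := _ / 2; set y' := _ / 2 => qE.
  have xE : x' = x + w / 2 ^+ n.+1 by rewrite /x'; lra.
  have yE : y' = y + h / 2 ^+ n.+1 by rewrite /y'; lra.
  have {qE} := qE _ _ _.
  rewrite !lerDl => /(_ wn hn) qE.
  have {}qE : Q n (x, y) = Q n.+1 (x, y) + Q n.+1 (x', y) + (Q n.+1 (x, y') + Q n.+1 (x', y')).
    rewrite /Q /= qE; last by apply: cont_onS cf; apply: rectS.
    have -> : x' + w / 2 ^+ n.+1 = x + w / 2 ^+ n by lra.
    have -> : y' + h / 2 ^+ n.+1 = y + h / 2 ^+ n by lra.
    by rewrite -xE -yE.
  have : nm (Q n (x, y)) <= nm (Q n.+1 (x, y)) + nm (Q n.+1 (x', y)) +
      (nm (Q n.+1 (x, y')) + nm (Q n.+1 (x', y'))).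
    rewrite qE; apply: le_trans (nm_triangle _ _) _.
    by rewrite lerD// nm_triangle.
  have ok (u v : R) : u = x \/ u = x' -> v = y \/ v = y' ->
      nm (Q n (x, y)) <= 4 * nm (Q n.+1 (u, v)) ->
      [/\ inside n.+1 (u, v), x <= u <= x + w / 2 ^+ n.+1,
     y <= v <= y + h / 2 ^+ n.+1 & nm (Q n (x, y)) <= 4 * nm (Q n.+1 (u, v))].
    rewrite xE yE => ux vy Quv.
    have [u1 u2 u3] := dyadic_child i1 i2 ws wn1 ux.
    by have [v1 v2 v3] := dyadic_child i3 i4 hs hn1 vy.
  have [q1|q1] := leP (nm (Q n (x, y))) (4 * nm (Q n.+1 (x, y))).
    by move=> _; exists (x, y) => _; apply: ok => //; left.
  have [q2|q2] := leP (nm (Q n (x, y))) (4 * nm (Q n.+1 (x', y))).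
    by move=> _; exists (x', y) => _; apply: ok => //; [right|left].
  have [q3|q3] := leP (nm (Q n (x, y))) (4 * nm (Q n.+1 (x, y'))).
    by move=> _; exists (x, y') => _; apply: ok => //; [left|right].
  have [q4|q4] := leP (nm (Q n (x, y))) (4 * nm (Q n.+1 (x', y'))).
    by move=> _; exists (x', y') => _; apply: ok => //; right.
  by move=> q5; exfalso; exact: quarter_le q1 q2 q3 q4 q5.
have [nxt nxtP] := choice step.
pose s := fix s n := if n is n'.+1 then nxt (n', s n') else (a, c).
have ins n : inside n (s n).
  elim: n => [|n IH].
    by rewrite /inside /= expr0 !divr1 /w /h; split; rewrite // addrC subrK.
  by have [] := nxtP (n, s n) IH.
have [x xP] : exists x, forall n, (s n).1 <= x <= (s n).1 + w / 2 ^+ n.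
  by apply: nested_dyadic => // n; have [] := nxtP (n, s n) (ins n).
have [y yP] : exists x, forall n, (s n).2 <= x <= (s n).2 + h / 2 ^+ n.
  by apply: nested_dyadic => // n; have [] := nxtP (n, s n) (ins n).
have muQ n : nm (bdint a b c d f) <= 4 ^+ n * nm (Q n (s n)).
  elim: n => [|n IH].
    by rewrite expr0 mul1r /Q /= expr0 !divr1 /w /h !(addrC _ (_ - _)) !subrK.
  apply: le_trans IH _; rewrite exprSr -mulrA ler_pM2l ?exprn_gt0//.
  by have [] := nxtP (n, s n) (ins n).
pose z : C := x +i* y.
have rz : rect a b c d z.
  have := xP 0%N; have := yP 0%N; rewrite expr0 /= !divr1 /w /h => h1 h2.
  by split; rewrite /= in_itv /=; lra.
have /derivable_cdiff dz := df z rz.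
set eta := nm (bdint a b c d f) in muQ.
have eta0 : 0 < eta by rewrite lt0r nm_ge0 nm_eq0 mu0.
set W := w + h; have W0 : 0 <= W by rewrite addr_ge0.
have W2 : 0 < W ^+ 2 + 1 by rewrite ltr_wpDl ?sqr_ge0.
have W8 : 0 < 8 * (W ^+ 2 + 1) by rewrite mulr_gt0.
(* Makes the final bound 4 e W^2 smaller than eta; the summand 1 covers a degenerate rectangle with
   W = 0. *)
set e := eta / (8 * (W ^+ 2 + 1)).
have e0 : 0 < e by rewrite divr_gt0.
have [r r0 rP] := dz e e0.
have [n nP] := lt_pow2 (W / r).
have Wn : W / 2 ^+ n < r.
  by rewrite ltr_pdivrMr// mulrC -ltr_pdivrMr.
have [i1 i2 i3 i4] := ins n.
have /andP[x1 x2] := xP n; have /andP[y1 y2] := yP n.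
set p := s n in i1 i2 i3 i4 x1 x2 y1 y2.
have wn := ge0 w n w0; have hn := ge0 h n h0.
have sub : rect p.1 (p.1 + w / 2 ^+ n) p.2 (p.2 + h / 2 ^+ n) `<=` rect a b c d.
  by apply: rectS.
have le1 : p.1 <= p.1 + w / 2 ^+ n by rewrite lerDl.
have le2 : p.2 <= p.2 + h / 2 ^+ n by rewrite lerDl.
have cont_sub : cont_on (bnd p.1 (p.1 + w / 2 ^+ n) p.2 (p.2 + h / 2 ^+ n)) f.
  by apply: cont_onS cf => v /bnd_rect/sub.
pose l := 'D_1 f z; pose k := f z - l * z.
have caff : cont_on (bnd p.1 (p.1 + w / 2 ^+ n) p.2 (p.2 + h / 2 ^+ n))
    (fun v => - k + (- l) * v).
  by move=> v _; exact: continuous_affine.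
have QE : Q n p = bdint p.1 (p.1 + w / 2 ^+ n) p.2 (p.2 + h / 2 ^+ n)
    (fun v => f v + (- k + (- l) * v)).
  by rewrite bdintD// bdint_affine// addr0.
have WE : W / 2 ^+ n = w / 2 ^+ n + h / 2 ^+ n by rewrite -mulrDl.
have Qb : nm (Q n p) <= 4 * (e * (W / 2 ^+ n) * (w / 2 ^+ n)) +
    4 * (e * (W / 2 ^+ n) * (h / 2 ^+ n)).
  have := @bdint_bound _ p.1 (p.1 + w / 2 ^+ n) p.2 (p.2 + h / 2 ^+ n)
    (e * (W / 2 ^+ n)) (fun v => f v + (- k + (- l) * v)) le1 le2.
  rewrite -QE !(addrAC _ _ (- _)) !subrr !add0r; apply.
    exact: cont_onD.
  move=> v [[v1 v2] _].
  have vz : nm (v - z) <= W / 2 ^+ n.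
    apply: le_trans (nm_le_ReIm _) _; rewrite !(Re_add, Im_add, Re_opp, Im_opp) WE /=.
    move: v1 v2; rewrite !in_itv /= => /andP[? ?] /andP[? ?].
    by apply: lerD; rewrite ler_norml; apply/andP; split; lra.
  apply: le_trans (_ : e * nm (v - z) <= _); last by rewrite ler_pM2l.
  have -> : f v + (- k + - l * v) = f v - f z - l * (v - z) by rewrite /k; ring.
  by apply: rP; exact: le_lt_trans Wn.
have := muQ n; suff : 4 ^+ n * nm (Q n p) < eta by rewrite leNgt => ->.
apply: le_lt_trans (_ : 4 * (e * W ^+ 2) < _).
  apply: le_trans (_ : 4 ^+ n * (4 * (e * (W / 2 ^+ n) * (w / 2 ^+ n)) +
    4 * (e * (W / 2 ^+ n) * (h / 2 ^+ n))) <= _).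
    by rewrite ler_pM2l ?exprn_gt0.
  have -> : (4 : R) ^+ n = 2 ^+ n * 2 ^+ n by rewrite -exprMn; congr (_ ^+ _); lra.
  rewrite le_eqVlt; apply/orP; left; apply/eqP.
  by rewrite /W; field; rewrite gt_eqF.
have -> : 4 * (e * W ^+ 2) = eta * (W ^+ 2 / (2 * (W ^+ 2 + 1))).
  by rewrite /e; field; rewrite gt_eqF.
rewrite gtr_pMr// ltr_pdivrMr ?mulr_gt0// mul1r.
have := sqr_ge0 W; lra.
Qed.

End GoursatTheorem.

(** * A Cauchy formula on squares; the derivative of a holomorphic function is holomorphic *)

Section HolomorphicRegularity.
Variable R : realType.
Notation C := (Cx R).
Implicit Types (f g : C -> C) (z w : C) (a b c d : R).

(** Two horizontal and two vertical cuts detach four rectangles that avoid the exceptional point,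
    and [goursat] annihilates each of them. *)
Lemma goursat_shrink a b c d x y s f : 0 < s ->
  a < x - s -> x + s < b -> c < y - s -> y + s < d -> cont_on (rect a b c d) f ->
  (forall z, rect a b c d z -> z != x +i* y -> derivable f z 1) ->
  bdint a b c d f = bdint (x - s) (x + s) (y - s) (y + s) f.
Proof.
move=> s0 axs xsb cys ysd cf df.
have xx : x - s < x by rewrite gtrBl.
have xx' : x < x + s by rewrite ltrDl.
have yy : y - s < y by rewrite gtrBl.
have yy' : y < y + s by rewrite ltrDl.
have xss := lt_trans xx xx'; have yss := lt_trans yy yy'.
have axs' := lt_trans axs xss; have xsb' := lt_trans xss xsb.
have cys' := lt_trans cys yss; have ysd' := lt_trans yss ysd.
have ab := lt_trans axs xsb'; have cd := lt_trans cys ysd'.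
have off (a' b' c' d' : R) : a <= a' -> b' <= b -> c <= c' -> d' <= d ->
    a' <= b' -> c' <= d' -> [\/ x < a', b' < x, y < c' | d' < y] ->
    bdint a' b' c' d' f = 0.
  move=> ? ? ? ? ab' cd' o; apply: goursat => // z zr; apply: df.
    by move: zr; exact: rectS.
  apply/eqP => zxy; move: zr; rewrite zxy => -[]; rewrite !in_itv /= => /andP[h1 h2] /andP[h3 h4].
  case: o; rewrite ltNge.
  - by rewrite h1.
  - by rewrite h2.
  - by rewrite h3.
  - by rewrite h4.
have sub (a' b' c' d' : R) : a <= a' -> b' <= b -> c <= c' -> d' <= d ->
    cont_on (rect a' b' c' d') f.
  by move=> *; apply: cont_onS cf; exact: rectS.
rewrite (@bdint_hsplit _ a b c (y - s) d); [|exact: ltW|by rewrite !ltW|by []].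
rewrite (@bdint_hsplit _ a b (y - s) (y + s) d);
  [|exact: ltW|by rewrite !ltW|by apply: sub; rewrite // ltW].
rewrite (@bdint_vsplit _ a (x - s) b (y - s));
  [|by rewrite !ltW|exact: ltW|by apply: sub; rewrite // ltW].
rewrite (@bdint_vsplit _ (x - s) (x + s) b (y - s));
  [|by rewrite !ltW|exact: ltW|by apply: sub; rewrite // ltW].
rewrite (off a b c (y - s) (lexx _) (lexx _) (lexx _) (ltW ysd') (ltW ab) (ltW cys)
  (Or44 _ _ _ yy)).
rewrite (off a b (y + s) d (lexx _) (lexx _) (ltW cys') (lexx _) (ltW ab) (ltW ysd)
  (Or43 _ _ _ yy')).
rewrite (off a (x - s) (y - s) (y + s) (lexx _) (ltW xsb') (ltW cys) (ltW ysd) (ltW axs)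
  (ltW yss) (Or42 _ _ _ xx)).
rewrite (off (x + s) b (y - s) (y + s) (ltW axs') (lexx _) (ltW cys) (ltW ysd) (ltW xsb)
  (ltW yss) (Or41 _ _ _ xx')).
by rewrite !(add0r, addr0).
Qed.

(** Continuity bounds f by M near w, so the integral over the square of half side s around w is at
    most 16 M s, which is as small as desired. The intended f is a difference quotient at w. *)
Lemma goursat_punctured a b c d f w : a < Re w < b -> c < Im w < d ->
  cont_on (rect a b c d) f ->
  (forall z, rect a b c d z -> z != w -> derivable f z 1) -> bdint a b c d f = 0.
Proof.
move=> /andP[ax xb] /andP[cy yd] cf df; apply/eqP; apply: contraT => mu0.
have rw : rect a b c d w by split; rewrite in_itv /= !ltW.
have [r r0 rP] := (cvgCxP _ _ _).1 (cf w rw) 1 ltr01.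
set M := nm (f w) + 1.
have M0 : 0 < M by rewrite ltr_wpDl ?nm_ge0.
set eta := nm (bdint a b c d f).
have eta0 : 0 < eta by rewrite lt0r nm_ge0 nm_eq0 mu0.
have [s [s0 s1 [s2 s3 s4 s5] s6]] : exists s, [/\ 0 < s, s < r / 2,
    [/\ s < Re w - a, s < b - Re w, s < Im w - c & s < d - Im w] & s < eta / (16 * M)].
  near (0 : R)^'+ => s; exists s; split=> //; last first.
    by near: s; apply: nbhs_right_lt; rewrite divr_gt0// mulr_gt0.
    by split; near: s; apply: nbhs_right_lt; rewrite subr_gt0.
  by near: s; apply: nbhs_right_lt; rewrite divr_gt0.
have E := @goursat_shrink a b c d (Re w) (Im w) s f s0.
have {}E : bdint a b c d f = bdint (Re w - s) (Re w + s) (Im w - s) (Im w + s) f.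
  apply: E => //.
  - by rewrite ltrBrDr -ltrBrDl.
  - by rewrite -ltrBrDl.
  - by rewrite ltrBrDr -ltrBrDl.
  - by rewrite -ltrBrDl.
  - by move=> z zr zw; apply: df => //; apply: contraNneq zw => ->; case: (w).
have Ns : - s <= s by rewrite (le_trans _ (ltW s0))// oppr_le0 ltW.
have xss : Re w - s <= Re w + s by rewrite lerD2l.
have yss : Im w - s <= Im w + s by rewrite lerD2l.
have sub : rect (Re w - s) (Re w + s) (Im w - s) (Im w + s) `<=` rect a b c d.
  apply: rectS; apply: ltW.
  - by rewrite ltrBrDr -ltrBrDl.
  - by rewrite -ltrBrDl.
  - by rewrite ltrBrDr -ltrBrDl.
  - by rewrite -ltrBrDl.
have : eta <= 4 * (M * (Re w + s - (Re w - s))) + 4 * (M * (Im w + s - (Im w - s))).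
  rewrite /eta E; apply: bdint_bound => //.
    by apply: cont_onS cf => z /bnd_rect/sub.
  move=> z [[z1 z2] _].
  rewrite -lerBlDl; apply: le_trans (nm_triangleB _ _) _; apply: ltW; apply: rP.
  apply: le_lt_trans (nm_le_ReIm _) _; rewrite !(Re_add, Im_add, Re_opp, Im_opp).
  have h (u v : R) : u \in `[(v - s), (v + s)]%R -> `|u - v| < r / 2.
    by rewrite in_itv /= -ler_distl => h; exact: le_lt_trans s1.
  by rewrite [ltRHS]splitr; apply: ltrD; exact: h.
have -> : 4 * (M * (Re w + s - (Re w - s))) + 4 * (M * (Im w + s - (Im w - s))) =
  s * (16 * M) by ring.
by move: s6; rewrite ltr_pdivlMr ?mulr_gt0// ltNge => /negbTE ->.
Unshelve. all: by end_near. Qed.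

Lemma inv_nm z : z^-1 = ((nm z ^+ 2)^-1)%:C * (z^*)%R.
Proof.
have [->|z0] := eqVneq z 0; first by rewrite invr0 rmorph0 mulr0.
apply: (mulfI z0); rewrite mulfV// mulrCA nm_mulconj -rmorphM /= mulVf//.
by rewrite expf_eq0 /= nm_eq0.
Qed.

(** Differentiation under the integral sign, by a remainder of K that is quadratic in w' - w
    uniformly on the boundary. *)
Lemma bdint_diff (a b c d : R) (K : C -> C -> C) (K' : C -> C) w (B m : R) :
  a <= b -> c <= d -> 0 < m -> 0 <= B ->
  (forall w', nm (w' - w) < m -> cont_on (bnd a b c d) (fun z => K z w')) ->
  cont_on (bnd a b c d) K' ->
  (forall z, bnd a b c d z -> forall w', nm (w' - w) < m ->
     nm (K z w' - K z w - K' z * (w' - w)) <= B * nm (w' - w) ^+ 2) ->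
  cdiff (fun w' => bdint a b c d (fun z => K z w')) w (bdint a b c d K').
Proof.
move=> ab cd m0 B0 cK cK' KB e e0.
pose L := 4 * (B * (b - a)) + 4 * (B * (d - c)).
have L0 : 0 <= L by rewrite /L addr_ge0// !mulr_ge0// subr_ge0.
have L1 : 0 < L + 1 by rewrite ltr_wpDl.
exists (Num.min m (e / (L + 1))); first by rewrite lt_min m0 divr_gt0.
move=> w'; rewrite lt_min => /andP[w1]; rewrite ltr_pdivlMr// => w2.
have cw := cK _ w1.
have cw0 : cont_on (bnd a b c d) (fun z => K z w) by apply: cK; rewrite subrr nm0.
have cz (k : C) g : cont_on (bnd a b c d) g -> cont_on (bnd a b c d) (fun z => k * g z).
  by move=> cg; apply: cont_onM cg => z _; exact: cst_continuous.
have -> : bdint a b c d (fun z => K z w') - bdint a b c d (fun z => K z w) -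
    bdint a b c d K' * (w' - w) =
    bdint a b c d (fun z => K z w' + (- 1 * K z w + (- (w' - w)) * K' z)).
  rewrite (bdintD ab cd cw (cont_onD (cz _ _ cw0) (cz _ _ cK'))).
  rewrite (bdintD ab cd (cz _ _ cw0) (cz _ _ cK')) !bdintZ//.
  by rewrite mulN1r mulNr addrA (mulrC (w' - w)).
apply: le_trans (_ : 4 * (B * nm (w' - w) ^+ 2 * (b - a)) +
    4 * (B * nm (w' - w) ^+ 2 * (d - c)) <= _).
  apply: (@bdint_bound _ a b c d (B * nm (w' - w) ^+ 2) _ ab cd).
    exact: (cont_onD cw (cont_onD (cz _ _ cw0) (cz _ _ cK'))).
  move=> z /KB/(_ w' w1); apply: le_trans; rewrite le_eqVlt; apply/orP; left; apply/eqP.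
  by congr nm; ring.
have -> : 4 * (B * nm (w' - w) ^+ 2 * (b - a)) + 4 * (B * nm (w' - w) ^+ 2 * (d - c)) =
  nm (w' - w) * L * nm (w' - w) by rewrite /L; ring.
apply: ler_wpM2r; first exact: nm_ge0.
apply: le_trans (ltW w2).
by apply: ler_wpM2l; [exact: nm_ge0|rewrite lerDl].
Qed.

Lemma rect_compact a b c d : compact (rect a b c d).
Proof.
have cA : compact (`[a, b]%classic `*` `[c, d]%classic).
  by apply: compact_setX; exact: segment_compact.
pose f (p : R * R) : C := p.1 +i* p.2.
have cf : continuous f.
  by move=> p; apply: cvgC_ReIm => /=; [exact: cvg_fst|exact: cvg_snd].
have -> : rect a b c d = f @` (`[a, b]%classic `*` `[c, d]%classic).
  apply/seteqP; split=> z /=; first by move=> [z1 z2]; exists (Re z, Im z) => //; case: (z).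
  by move=> [[x y] /= [h1 h2] <-].
by apply: continuous_compact => //; exact: continuous_subspaceT.
Qed.

Lemma compact_nm_bounded (K : set C) f : compact K -> cont_on K f ->
  exists2 B : R, 0 <= B & forall z, K z -> nm (f z) <= B.
Proof.
move=> cK cf; have [[z0 Kz0]|K0] := pselect (K !=set0); last first.
  by exists 0 => // z Kz; exfalso; apply: K0; exists z.
have [] := @compact_EVT_max _ R (fun z => nm (f z)) K.
- by exists z0.
- by [].
- apply: continuous_in_subspaceT => z; rewrite inE => /cf cz.
  exact: (continuous_comp cz (@nm_continuous R _)).
move=> z1 Kz1 H; exists (nm (f z1)); first exact: nm_ge0.
by move=> z Kz; apply: H; rewrite ?inE.
Qed.

Lemma bnd_far z w d : 0 < d -> bnd (Re z - d) (Re z + d) (Im z - d) (Im z + d) w ->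
  d <= nm (w - z).
Proof.
move=> d0 [_ wb]; case: wb => wE.
- apply: le_trans (le_Re_nm _); rewrite Re_add Re_opp wE addrAC subrr add0r normrN.
  by rewrite gtr0_norm.
- apply: le_trans (le_Re_nm _); rewrite Re_add Re_opp wE addrAC subrr add0r.
  by rewrite gtr0_norm.
- apply: le_trans (le_Im_nm _); rewrite Im_add Im_opp wE addrAC subrr add0r normrN.
  by rewrite gtr0_norm.
- apply: le_trans (le_Im_nm _); rewrite Im_add Im_opp wE addrAC subrr add0r.
  by rewrite gtr0_norm.
Qed.

Lemma derivable_kernel w z k : z != w -> derivable (fun v : C => ((v - w) ^+ k)^-1) z 1.
Proof.
move=> zw; have d1 : derivable (fun v : C => v - w) z 1.
  by apply: derivableB; [exact: derivable_id|exact: derivable_cst].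
apply: (@derivableV _ _ (fun v : C => (v - w) ^+ k)).
  by rewrite expf_neq0// subr_eq0.
have -> : (fun v : C => (v - w) ^+ k) = (fun v : C => v - w) ^+ k.
  elim: k => [|k IH]; first by apply/funext => v; rewrite !expr0.
  by rewrite exprS -IH; apply/funext => v; rewrite exprS.
exact: derivableX.
Qed.

Lemma cont_kernel (A : set C) g k w : ~ A w -> cont_on A g ->
  cont_on A (fun z => g z / (z - w) ^+ k).
Proof.
move=> Aw cg; apply: (cont_onM cg) => z Az; apply: derivable_continuous.
by apply: derivable_kernel; apply: contraPneq Az => ->.
Qed.

Lemma square_le d z : 0 < d -> Re z - d <= Re z + d /\ Im z - d <= Im z + d.
Proof. by move=> d0; split; rewrite lerD2l (le_trans _ (ltW d0))// oppr_le0 ltW. Qed.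

(** The winding number in a weak form: the value is 2 pi i, but it is enough that each of the four
    sides contributes at least 1 to the imaginary part. *)
Lemma bdint_inv_neq0 z d : 0 < d ->
  bdint (Re z - d) (Re z + d) (Im z - d) (Im z + d) (fun v => 1 / (v - z) ^+ 1) != 0.
Proof.
move=> d0; set F := fun v => _; have [nd nd'] := square_le z d0.
set x := Re z in nd *; set y := Im z in nd' *.
have cb : cont_on (bnd (x - d) (x + d) (y - d) (y + d)) F.
  apply: cont_kernel => [/(bnd_far d0)|v _]; last exact: cst_continuous.
  by rewrite subrr nm0 leNgt d0.
(* Up to sign, the relevant part of 1/(v - z) on a side at distance d from z is d/(u^2 + d^2); a
   side has length 2d. *)
have bd (u : R) : `|u| <= d -> d^-1 / 2 <= d / (u ^+ 2 + d ^+ 2) <= d^-1.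
  move=> ud; have u2 : u ^+ 2 <= d ^+ 2.
    by rewrite -[leLHS]real_normK ?num_real// ler_sqr// nnegrE ltW.
  have p0 : 0 < u ^+ 2 + d ^+ 2 by rewrite ltr_wpDl ?sqr_ge0// exprn_gt0.
  have dE : d = d^-1 * d ^+ 2 by rewrite expr2 mulrA mulVf ?mul1r// gt_eqF.
  have i0 : 0 < d^-1 by rewrite invr_gt0.
  rewrite ler_pdivlMr// ler_pdivrMr//; apply/andP; split; last first.
    by rewrite [leLHS]dE (ler_pM2l i0) lerDr sqr_ge0.
  rewrite [leRHS]dE -mulrA (ler_pM2l i0) mulrC ler_pdivrMr// mulr_natr mulr2n.
  by rewrite lerD2r.
have FE (v : C) : F v = ((Re (v - z) ^+ 2 + Im (v - z) ^+ 2)^-1)%:C * ((v - z)^*)%R.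
  by rewrite /F div1r expr1 inv_nm nm_sqr.
have ReF (v : C) : Re (F v) = Re (v - z) / (Re (v - z) ^+ 2 + Im (v - z) ^+ 2).
  by rewrite FE Re_mul Re_conjE /= mul0r subr0 mulrC.
have ImF (v : C) : Im (F v) = - (Im (v - z) / (Re (v - z) ^+ 2 + Im (v - z) ^+ 2)).
  by rewrite FE Im_mul Im_conjE /= mul0r addr0 mulrN mulrC.
have xu u : u \in `[(x - d), (x + d)]%R -> `|u - x| <= d by rewrite in_itv /= ler_distl.
have yu u : u \in `[(y - d), (y + d)]%R -> `|u - y| <= d by rewrite in_itv /= ler_distl.
have one k : (d^-1 / 2) * (k + d - (k - d)) = 1.
  by field; rewrite gt_eqF.
have h1 : 1 <= Im (cint (x - d) (x + d) (horline F (y - d))).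
  have /ccont_integrable[_ ig] := bhline_ccont cb nd' (or_introl erefl).
  have H u : u \in `[(x - d), (x + d)]%R -> d^-1 / 2 <= Im (horline F (y - d) u) <= d^-1.
    move=> /xu/bd; rewrite /horline ImF !(Re_add, Re_opp, Im_add, Im_opp) /= -/x -/y (addrAC y) subrr
      add0r sqrrN mulNr opprK; exact.
  by case/andP: (le_Rint nd ig H) => + _; rewrite one.
have h2 : 1 <= Re (cint (y - d) (y + d) (vertline F (x + d))).
  have /ccont_integrable[ig _] := bvline_ccont cb nd (or_intror erefl).
  have H u : u \in `[(y - d), (y + d)]%R -> d^-1 / 2 <= Re (vertline F (x + d) u) <= d^-1.
    move=> /yu/bd; rewrite /vertline ReF !(Re_add, Re_opp, Im_add, Im_opp) /= -/x -/y (addrAC x) subrr add0r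
      (addrC (d ^+ 2)); exact.
  by case/andP: (le_Rint nd' ig H) => + _; rewrite one.
have h3 : Im (cint (x - d) (x + d) (horline F (y + d))) <= - 1.
  have /ccont_integrable[_ ig] := bhline_ccont cb nd' (or_intror erefl).
  have H u : u \in `[(x - d), (x + d)]%R -> - d^-1 <= Im (horline F (y + d) u) <= - (d^-1 / 2).
    move=> /xu/bd; rewrite /horline ImF !(Re_add, Re_opp, Im_add, Im_opp) /= -/x -/y (addrAC y) subrr
      add0r !lerN2 andbC; exact.
  by case/andP: (le_Rint nd ig H) => _; rewrite mulNr one.
have h4 : Re (cint (y - d) (y + d) (vertline F (x - d))) <= - 1.
  have /ccont_integrable[ig _] := bvline_ccont cb nd (or_introl erefl).
  have H u : u \in `[(y - d), (y + d)]%R -> - d^-1 <= Re (vertline F (x - d) u) <= - (d^-1 / 2).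
    move=> /yu/bd; rewrite /vertline ReF !(Re_add, Re_opp, Im_add, Im_opp) /= -/x -/y (addrAC x) subrr add0r sqrrN mulNr
      !lerN2 (addrC (d ^+ 2)) andbC; exact.
  by case/andP: (le_Rint nd' ig H) => _; rewrite mulNr one.
apply: contraPneq h1 => /(congr1 (@complex.Im R)).
rewrite /bdint !(Im_add, Im_opp, Im_mul) /= !mul0r !mul1r !add0r => + h1.
move: h1 h2 h3 h4; rewrite /=.
move: (\int[_]_(_ in _) _) (\int[_]_(_ in _) _) (\int[_]_(_ in _) _) (\int[_]_(_ in _) _).
by clear => *; lra.
Qed.

(** Remainder of the expansion of the Cauchy kernel to first order in its pole, with u = z - w and h
    = w' - w; m measures the distance of the pole from the contour. [kernel2] is the same for the
    squared kernel. *)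
Lemma kernel1 (u h : C) (m : R) : 0 < m -> 2 * m <= nm u -> nm h < m ->
  nm ((u - h)^-1 - u^-1 - (u ^- 2) * h) <= m ^- 3 * nm h ^+ 2.
Proof.
move=> m0 um hm.
have u0 : 0 < nm u by apply: lt_le_trans um; rewrite mulr_gt0.
have uh : m <= nm (u - h) by apply: le_trans (nm_triangleB _ _); lra.
have uh0 : 0 < nm (u - h) by exact: lt_le_trans uh.
have un : u != 0 by rewrite -nm_eq0 gt_eqF.
have uhn : u - h != 0 by rewrite -nm_eq0 gt_eqF.
have -> : (u - h)^-1 - u^-1 - (u ^- 2) * h = h ^+ 2 / (u ^+ 2 * (u - h)).
  by field; rewrite un uhn.
rewrite nmM nmV nmM !nmX mulrC ler_wpM2r ?exprn_ge0 ?nm_ge0//.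
rewrite lef_pV2 ?posrE ?mulr_gt0 ?exprn_gt0//.
have mu : m <= nm u by lra.
rewrite exprSr; apply: ler_pM => //; rewrite ?exprn_ge0 ?(ltW m0)//.
by rewrite lerXn2r// nnegrE ltW.
Qed.

Lemma kernel2 (u h : C) (m : R) : 0 < m -> 2 * m <= nm u -> nm h < m ->
  nm ((u - h) ^- 2 - u ^- 2 - (2 * u ^- 3) * h) <= 5 * m ^- 4 * nm h ^+ 2.
Proof.
move=> m0 um hm.
have u0 : 0 < nm u by apply: lt_le_trans um; rewrite mulr_gt0.
have uh : m <= nm (u - h) by apply: le_trans (nm_triangleB _ _); lra.
have uh0 : 0 < nm (u - h) by exact: lt_le_trans uh.
have un : u != 0 by rewrite -nm_eq0 gt_eqF.
have uhn : u - h != 0 by rewrite -nm_eq0 gt_eqF.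
have -> : (u - h) ^- 2 - u ^- 2 - (2 * u ^- 3) * h =
   h ^+ 2 * (3 * u - 2 * h) / (u ^+ 3 * (u - h) ^+ 2).
  by field; rewrite un uhn.
rewrite nmM nmV [nm (h ^+ 2 * _)]nmM [nm (u ^+ 3 * _)]nmM !nmX [leRHS]mulrC
  -[leLHS]mulrA ler_wpM2l ?exprn_ge0 ?nm_ge0//.
have mu : m <= nm u by lra.
have n3 : nm (3 * u - 2 * h) <= 5 * nm u.
  apply: le_trans (nm_triangle _ _) _; rewrite nmN !nmM.
  have -> : nm (3 : C) = 3 by have := nm_real (3 : R); rewrite rmorph_nat normr_nat.
  have -> : nm (2 : C) = 2 by have := nm_real (2 : R); rewrite rmorph_nat normr_nat.
  lra.
have u3 : nm u ^+ 3 = nm u * nm u ^+ 2 by rewrite exprS.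
rewrite ler_pdivrMr ?mulr_gt0 ?exprn_gt0//; apply: le_trans n3 _.
have -> : 5 * nm u = 5 * m ^- 4 * (nm u * m ^+ 4) by field; rewrite gt_eqF.
rewrite ler_pM2l; last by rewrite mulr_gt0// invr_gt0 exprn_gt0.
rewrite u3 -mulrA ler_pM2l//.
have -> : m ^+ 4 = m ^+ 2 * m ^+ 2 by rewrite -exprD.
by apply: ler_pM; rewrite ?exprn_ge0 ?(ltW m0)// lerXn2r// nnegrE ltW.
Qed.

(** Let N g k w be the integral of g(z)/(z - w)^k along a square. Goursat's theorem for the
    difference quotient of f gives N f 1 = f N 1 1, a Cauchy formula in which the constant is not
    evaluated. Differentiating in w gives f' N 1 1 = N f 2 - f N 1 2. The right-hand side is again
    differentiable, as is N 1 1, which does not vanish at z0; dividing by it shows that f' is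
    differentiable. *)
Lemma derivable_derive f (V : set C) z0 : open V -> V z0 ->
  (forall z, V z -> derivable f z 1) -> derivable ('D_1 f) z0 1.
Proof.
move=> oV Vz df.
have [r r0 rV] := openCP oV Vz.
(* Points of the closed square of half side d satisfy |Re| + |Im| <= 2d < r relative to z0, so the
   square lies in V. *)
pose d := r / 3; have d0 : 0 < d by rewrite divr_gt0.
pose a := Re z0 - d; pose b := Re z0 + d; pose c := Im z0 - d; pose e := Im z0 + d.
have ab : a <= b by rewrite lerD2l (le_trans _ (ltW d0))// oppr_le0 ltW.
have ce : c <= e by rewrite lerD2l (le_trans _ (ltW d0))// oppr_le0 ltW.
have rectV : rect a b c e `<=` V.
  move=> z [z1 z2]; apply: rV; apply: le_lt_trans (nm_le_ReIm _) _.
  rewrite !(Re_add, Im_add, Re_opp, Im_opp).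
  move: z1 z2; rewrite !in_itv /= -!ler_distl => h1 h2.
  by apply: le_lt_trans (lerD h1 h2) _; rewrite /d; move: r0; clear; lra.
have cf : cont_on (rect a b c e) f by move=> z /rectV/df/derivable_continuous.
have [B B0 fB] := compact_nm_bounded (@rect_compact a b c e) cf.
(* A pole within d/2 of the centre stays at distance d/2 = 2m from the contour, the margin that
   [kernel1] and [kernel2] require. *)
pose m := d / 4; have m0 : 0 < m by rewrite divr_gt0.
pose near0 w := nm (w - z0) < d / 2.
have far w : near0 w -> forall z, bnd a b c e z -> 2 * m <= nm (z - w).
  move=> nw z /(bnd_far d0) dz; have -> : 2 * m = d - d / 2 by rewrite /m; field.
  rewrite lerBlDr; apply: le_trans dz _.
  rewrite -(subrK w z) -addrA; apply: le_trans (nm_triangle _ _) _.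
  by rewrite addrK lerD2l ltW.
have near_far w w' : near0 w -> nm (w' - w) < m -> ~ bnd a b c e w'.
  move=> nw ww /(far _ nw); rewrite leNgt; apply/negP/negPn; apply: lt_trans ww _.
  by rewrite mulrC mulr_natr mulr2n ltrDl.
pose N g k w := bdint a b c e (fun z => g z / (z - w) ^+ k).
have cN g k w : ~ bnd a b c e w -> cont_on (rect a b c e) g ->
    cont_on (bnd a b c e) (fun z => g z / (z - w) ^+ k).
  by move=> nw cg; apply: cont_kernel nw _; apply: cont_onS cg => z [].
have sub_h (z w w' : C) : z - w' = z - w - (w' - w) by rewrite opprB addrA subrK.
have nw0 w : near0 w -> ~ bnd a b c e w.
  by move=> nw; apply: (near_far w w nw); rewrite subrr nm0.
have N1 g w : near0 w -> cont_on (rect a b c e) g -> cdiff (N g 1) w (N g 2 w).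
  move=> nw cg; have [G G0 GB] := compact_nm_bounded (@rect_compact a b c e) cg.
  apply: (@bdint_diff a b c e (fun z w => g z / (z - w) ^+ 1) _ w (G * m ^- 3) m) => //.
  - by rewrite mulr_ge0// invr_ge0 exprn_ge0// ltW.
  - by move=> w' ww; apply: cN => //; exact: near_far ww.
  - by apply: cN => //; exact: nw0.
  move=> z zb w' ww; have [zr _] := zb; rewrite !expr1 (sub_h z w w').
  set h := w' - w; set u := z - w; rewrite -mulrBr -mulrA -mulrBr nmM -mulrA.
  by apply: ler_pM; rewrite ?nm_ge0 ?GB//; apply: kernel1 => //; exact: far.
have N2 g w : near0 w -> cont_on (rect a b c e) g -> cdiff (N g 2) w (2 * N g 3 w).
  move=> nw cg; have [G G0 GB] := compact_nm_bounded (@rect_compact a b c e) cg.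
  rewrite /N -bdintZ//; last by apply: cN => //; exact: nw0.
  apply: (@bdint_diff a b c e (fun z w => g z / (z - w) ^+ 2) _ w (G * (5 * m ^- 4)) m) => //.
  - by rewrite !mulr_ge0// invr_ge0 exprn_ge0// ltW.
  - by move=> w' ww; apply: cN => //; exact: near_far ww.
  - have := cN _ 3 w (nw0 _ nw) cg => cg3.
    by apply: (cont_onM _ cg3) => z _; exact: cst_continuous.
  move=> z zb w' ww; have [zr _] := zb; rewrite (sub_h z w w').
  set h := w' - w; set u := z - w.
  have -> : g z / (u - h) ^+ 2 - g z / u ^+ 2 - 2 * (g z / u ^+ 3) * h =
    g z * ((u - h) ^- 2 - u ^- 2 - (2 * u ^- 3) * h) by ring.
  rewrite nmM -(mulrA G).
  by apply: ler_pM; rewrite ?nm_ge0 ?GB//; apply: kernel2 => //; exact: far.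
have near_in w : near0 w -> a < Re w < b /\ c < Im w < e.
  move=> nw; have h := le_lt_trans (le_Re_nm _) nw; have h' := le_lt_trans (le_Im_nm _) nw.
  move: h h'; rewrite !(Re_add, Im_add, Re_opp, Im_opp) !ltr_norml.
  by rewrite /a /b /c /e; move: d0; clear => ? /andP[? ?] /andP[? ?]; split; lra.
have c1 : cont_on (rect a b c e) (fun=> 1 : C) by move=> z _; exact: cst_continuous.
have cauchy w : near0 w -> N f 1 w = f w * N (fun=> 1) 1 w.
  move=> nw; have [wx wy] := near_in w nw.
  have Vw : V w by apply: rectV; move: wx wy => /andP[? ?] /andP[? ?]; split;
    rewrite in_itv /= !ltW.
  (* Filling in the derivative at w makes the quotient continuous there, as [goursat_punctured]
     demands. *)
  pose q z := if z == w then 'D_1 f w else (f z - f w) / (z - w).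
  have dq z : V z -> z != w -> derivable q z 1.
    move=> Vz' zw; apply: (@near_eq_derivable _ _ _ ((f - cst (f w)) * (fun v => ((v - w) ^+ 1)^-1))).
      apply/nbhsCP; exists (nm (z - w)).
        by rewrite lt0r nm_ge0 nm_eq0 subr_eq0 zw.
      move=> v vz; rewrite /q /=; case: eqVneq => // vw.
      by move: vz; rewrite vw nmB ltxx.
    apply: derivableM; last exact: derivable_kernel.
    by apply: derivableB; [exact: df|exact: derivable_cst].
  have q0 : bdint a b c e q = 0.
    apply: (@goursat_punctured a b c e q w wx wy).
      move=> z zr; have [->|zw] := eqVneq z w.
        apply/cvgCxP => ep ep0; have e2 : 0 < ep / 2 by rewrite divr_gt0.
        have [dl dl0 dlP] := derivable_cdiff (df _ Vw) e2.
        exists dl => // v vw; rewrite /q eqxx; have [_|vw0] := eqVneq v w.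
          by rewrite subrr nm0.
        have n0 : 0 < nm (v - w) by rewrite lt0r nm_ge0 nm_eq0 subr_eq0 vw0.
        have -> : (f v - f w) / (v - w) - 'D_1 f w =
           (f v - f w - 'D_1 f w * (v - w)) / (v - w).
          by rewrite [RHS]mulrBl mulfK// subr_eq0.
        rewrite nmM nmV ltr_pdivrMr//; apply: le_lt_trans (dlP _ vw) _.
        by rewrite ltr_pM2r// ltr_pdivrMr// mulr_natr mulr2n ltrDl.
      by apply: derivable_continuous; apply: dq => //; exact: rectV.
    by move=> z /rectV Vz' zw; exact: dq.
  have cf1 := cN f 1 w (nw0 _ nw) cf; have c11 := cN _ 1 w (nw0 _ nw) c1.
  have c11' : cont_on (bnd a b c e) (fun z => - f w * (1 / (z - w) ^+ 1)).
    by apply: (cont_onM _ c11) => z _; exact: cst_continuous.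
  apply/eqP; rewrite -subr_eq0 -mulNr /N -bdintZ// -bdintD//; apply/eqP; rewrite -[RHS]q0.
  apply: eq_bdint => // z zb; rewrite /q; have [zw|zw] := eqVneq z w.
    by case: (nw0 _ nw); rewrite -zw.
  by rewrite expr1 mulrBl mul1r mulNr.
have z0n : near0 z0 by rewrite /near0 subrr nm0 divr_gt0.
have near0_near w : near0 w -> \forall v \near w, near0 v.
  by move=> nw; apply: open_nbhs_nbhs; split=> //; exact: open_discC.
pose g1 := N (fun=> 1) 1; pose g2 := N (fun=> 1) 2.
have der w : near0 w -> 'D_1 f w * g1 w = N f 2 w - f w * g2 w.
  move=> nw; have [wx wy] := near_in w nw.
  have Vw : V w by apply: rectV; move: wx wy => /andP[? ?] /andP[? ?]; split;
    rewrite in_itv /= !ltW.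
  have [dN DN] := cdiff_derivable (N1 f w nw cf).
  have [dg Dg] := cdiff_derivable (N1 _ w nw c1).
  have {}Dg : 'D_1 g1 w = g2 w := Dg.
  rewrite -DN -Dg (_ : 'D_1 (N f 1) w = 'D_1 (f * g1) w); last first.
    by apply: near_eq_derive; apply: filterS (near0_near w nw) => v /cauchy.
  rewrite (deriveM (df _ Vw) dg).
  by rewrite /GRing.scale /= addrAC subrr add0r mulrC.
have dg1 : derivable g1 z0 1 by have [] := cdiff_derivable (N1 _ z0 z0n c1).
have dg2 : derivable g2 z0 1 by have [] := cdiff_derivable (N2 _ z0 z0n c1).
have dN2 : derivable (N f 2) z0 1 by have [] := cdiff_derivable (N2 _ z0 z0n cf).
have g10 : g1 z0 != 0 by exact: bdint_inv_neq0.
have g1n : \forall w \near z0, g1 w != 0.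
  have /cvgCxP/(_ (nm (g1 z0))) [|dl dl0 dlP] := derivable_continuous dg1.
    by rewrite lt0r nm_ge0 nm_eq0 g10.
  apply/nbhsCP; exists dl => // w /dlP; apply: contraTneq => ->.
  by rewrite sub0r nmN ltxx.
apply: (@near_eq_derivable _ _ _ ((N f 2 - f * g2) * (fun w => (g1 w)^-1))).
  near=> w; have nw : near0 w by near: w; exact: near0_near.
  have gw : g1 w != 0 by near: w.
  by rewrite /= -[RHS](mulfK gw) der.
exact: (derivableM (derivableB dN2 (derivableM (df _ Vz) dg2)) (derivableV g10 dg1)).
Unshelve. all: by end_near. Qed.

End HolomorphicRegularity.

Section Conjugation.
Variable K : numClosedFieldType.
Implicit Types x y : K.
Lemma cjM x y : ((x * y)^*)%R = (x^*)%R * (y^*)%R. Proof. exact: rmorphM. Qed.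
Lemma cjD x y : ((x + y)^*)%R = (x^*)%R + (y^*)%R. Proof. exact: rmorphD. Qed.
Lemma cjN x : ((- x)^*)%R = - (x^*)%R. Proof. exact: rmorphN. Qed.
Lemma cjB x y : ((x - y)^*)%R = (x^*)%R - (y^*)%R. Proof. exact: rmorphB. Qed.
Lemma cjV x : ((x^-1)^*)%R = ((x^*)%R)^-1. Proof. exact: fmorphV. Qed.
Lemma cjn n : (n%:R^*)%R = n%:R :> K. Proof. exact: rmorph_nat. Qed.
Lemma cj0 : (0^*)%R = 0 :> K. Proof. exact: rmorph0. Qed.
Lemma cj1 : (1^*)%R = 1 :> K. Proof. exact: rmorph1. Qed.
Lemma cj_sum (I : Type) (s : seq I) (P : pred I) (F : I -> K) :
  ((\sum_(i <- s | P i) F i)^*)%R = \sum_(i <- s | P i) (F i)^*%R.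
Proof. exact: rmorph_sum. Qed.
End Conjugation.

(** * Second-order expansions: first derivatives in z and its conjugate, and the Laplacian *)

Section Jets.
Variable R : realType.
Notation C := (Cx R).
Notation ii := (ii R).
Implicit Types (F G : C -> C) (z w v : C).

Lemma cderV_eq (g : R -> C) t l : cder g t l -> g t != 0 ->
  cder (fun x => (g x)^-1) t (- l * ((g t)^-1 * (g t)^-1)).
Proof.
move=> dg gt0; have [l' dg'] := cderV dg gt0.
apply: (cder_eq dg').
have := cderM dg dg' => /(cder_near (g' := fun=> 1)) H.
have {}H : cder (fun=> 1) t (l / g t + g t * l').
  by apply: H; apply: filterS (cder_near_neq0 dg gt0) => x gx; rewrite mulfV.
have /eqP := cder_uniq H (cder_cst 1 t).
rewrite addrC addr_eq0 => /eqP E; apply: (mulfI gt0); rewrite E.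
by field.
Qed.

Definition jet1 (g : R -> C) (b c : C) := exists g1 : R -> C,
  [/\ \forall t \near (0 : R), cder g t (g1 t), g1 0 = b & cder g1 0 c].

Lemma jet1_cder g b c : jet1 g b c -> cder g 0 b.
Proof. by move=> [g1 [/nbhs_singleton + <-]]. Qed.

Lemma jet1_cst k : jet1 (fun=> k) 0 0.
Proof.
exists (fun=> 0); split=> //; last exact: cder_cst.
by apply: filterE => t; exact: cder_cst.
Qed.

Lemma jet1D g h b c b' c' : jet1 g b c -> jet1 h b' c' ->
  jet1 (fun x => g x + h x) (b + b') (c + c').
Proof.
move=> [g1 [dg g10 dg1]] [h1 [dh h10 dh1]].
exists (fun x => g1 x + h1 x); split; [|by rewrite g10 h10|exact: cderD].
by apply: filterS2 dg dh => t; exact: cderD.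
Qed.

Lemma jet1M g h b c b' c' : jet1 g b c -> jet1 h b' c' ->
  jet1 (fun x => g x * h x) (b * h 0 + g 0 * b') (c * h 0 + 2 * (b * b') + g 0 * c').
Proof.
move=> jg jh; have d1 := jet1_cder jg; have d2 := jet1_cder jh.
move: jg jh => [g1 [dg g10 dg1]] [h1 [dh h10 dh1]].
exists (fun x => g1 x * h x + g x * h1 x); split; [|by rewrite g10 h10|].
  by apply: filterS2 dg dh => t; exact: cderM.
apply: (cder_eq (cderD (cderM dg1 d2) (cderM d1 dh1))).
by rewrite g10 h10; ring.
Qed.

Lemma jet1V g b c : jet1 g b c -> g 0 != 0 -> exists b' c', jet1 (fun x => (g x)^-1) b' c'.
Proof.
move=> jg g0; have d1 := jet1_cder jg; move: jg => [g1 [dg g10 dg1]].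
eexists _, _, (fun x => - g1 x * ((g x)^-1 * (g x)^-1)); split; [|reflexivity|].
  by apply: filterS2 dg (cder_near_neq0 d1 g0) => t; exact: cderV_eq.
exact: (cderM (cderN dg1) (cderM (cderV_eq d1 g0) (cderV_eq d1 g0))).
Qed.

Lemma jet1_conj g b c : jet1 g b c -> jet1 (fun x => (g x)^*%R) (b^*)%R (c^*)%R.
Proof.
move=> [g1 [dg g10 dg1]]; exists (fun x => (g1 x)^*%R); split; [|by rewrite g10|exact: cder_conj].
by apply: filterS dg => t; exact: cder_conj.
Qed.

Lemma jet1_near g h b c : (\forall t \near (0 : R), g t = h t) -> jet1 g b c -> jet1 h b c.
Proof.
move=> /near_join gh [g1 [dg g10 dg1]]; exists g1; split=> //.
by apply: filterS2 dg gh => t dgt ght; exact: cder_near dgt.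
Qed.

Lemma jet1_uniq g b c b' c' : jet1 g b c -> jet1 g b' c' -> b = b' /\ c = c'.
Proof.
move=> jg jg'; split; first exact: cder_uniq (jet1_cder jg) (jet1_cder jg').
move: jg jg' => [g1 [dg g10 dg1]] [h1 [dh h10 dh1]].
apply: cder_uniq dh1; apply: cder_near dg1.
by apply: filterS2 dg dh => t; exact: cder_uniq.
Qed.

Lemma real_line0 F v z : real_line F v z 0 = F z.
Proof. by rewrite /real_line rmorph0 mul0r addr0. Qed.

Lemma real_line_near v z (P : set C) : nbhs z P ->
  \forall t \near (0 : R), P (z + t%:C * v).
Proof.
move=> /nbhsCP[d d0 dP].
have v0 : 0 < nm v + 1 by rewrite ltr_wpDl// nm_ge0.
apply/nbhs_ballP; exists (d / (nm v + 1)); first by rewrite /= divr_gt0.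
move=> t; rewrite /ball /= sub0r normrN ltr_pdivlMr// => td; apply: dP.
rewrite addrAC subrr add0r nmM nm_real; apply: le_lt_trans td.
by rewrite ler_wpM2l// lerDl.
Qed.

(* [jet F z a b l]: F has second derivatives along the lines through z, with
   a = dF/dz, b = dF/dzbar and l a quarter of the Laplacian at z. *)
Definition jet F z (a b l : C) := exists bx b_y cx cy : C,
  [/\ jet1 (real_line F 1 z) bx cx, jet1 (real_line F ii z) b_y cy,
   a = (bx - ii * b_y) / 2, b = (bx + ii * b_y) / 2 & l = (cx + cy) / 4].

Lemma jet_eq F z a b l a' b' l' : jet F z a b l -> a = a' -> b = b' -> l = l' ->
  jet F z a' b' l'.
Proof. by move=> + <- <- <-. Qed.

Lemma jet_cst k z : jet (fun=> k) z 0 0 0.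
Proof.
exists 0, 0, 0, 0; split; try exact: jet1_cst.
all: by rewrite ?mulr0 ?subr0 ?addr0 mul0r.
Qed.

Lemma jetD F G z a b l a' b' l' : jet F z a b l -> jet G z a' b' l' ->
  jet (fun w => F w + G w) z (a + a') (b + b') (l + l').
Proof.
move=> [bx [b_y [cx [cy [jx jy -> -> ->]]]]] [bx' [b_y' [cx' [cy' [jx' jy' -> -> ->]]]]].
exists (bx + bx'), (b_y + b_y'), (cx + cx'), (cy + cy').
by split; [exact: jet1D|exact: jet1D|ring|ring|ring].
Qed.

Lemma ii2 : ii * ii = -1.
Proof. exact: (@sqr_i R). Qed.

Lemma jetM F G z a b l a' b' l' : jet F z a b l -> jet G z a' b' l' ->
  jet (fun w => F w * G w) z (a * G z + F z * a') (b * G z + F z * b')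
    (l * G z + (a * b' + b * a') + F z * l').
Proof.
move=> [bx [b_y [cx [cy [jx jy -> -> ->]]]]] [bx' [b_y' [cx' [cy' [jx' jy' -> -> ->]]]]].
have := jet1M jx jx'; have := jet1M jy jy'; rewrite !real_line0 => Jy Jx.
do 4 eexists; split; [exact: Jx|exact: Jy|by field|by field|].
(* To [field] the unit [ii] is an opaque constant, so the relation i^2 = -1 is brought in by
   exhibiting the factor 1 + i^2. *)
apply/eqP; rewrite -subr_eq0; set L := (X in X == 0).
have -> : L = (1 + ii * ii) * (- b_y * b_y' / 2) by rewrite /L; field.
by rewrite ii2 subrr mul0r.
Qed.

Lemma jetV F z a b l : jet F z a b l -> F z != 0 ->
  exists a' b' l', jet (fun w => (F w)^-1) z a' b' l'.
Proof.
move=> [bx [b_y [cx [cy [jx jy _ _ _]]]]] F0.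
have := jet1V jx; rewrite real_line0 => /(_ F0)[b1 [c1 J1]].
have := jet1V jy; rewrite real_line0 => /(_ F0)[b2 [c2 J2]].
by do 3 eexists; exists b1, b2, c1, c2.
Qed.

Lemma conj_ii : (ii^*)%R = - ii.
Proof. by apply: eq_ReIm; rewrite ?(Re_conjE, Im_conjE, Re_opp, Im_opp) /= ?oppr0. Qed.

Lemma jet_conj F z a b l : jet F z a b l ->
  jet (fun w => (F w)^*%R) z (b^*)%R (a^*)%R (l^*)%R.
Proof.
move=> [bx [b_y [cx [cy [jx jy -> -> ->]]]]].
exists (bx^*)%R, (b_y^*)%R, (cx^*)%R, (cy^*)%R.
split; [exact: jet1_conj|exact: jet1_conj| | |].
- by rewrite !(cjn, cjV, cjM, cjD) conj_ii mulNr.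
- by rewrite !(cjn, cjV, cjM, cjB) conj_ii mulNr opprK.
- by rewrite !(cjn, cjV, cjM, cjD).
Qed.

Lemma jet_near F G z a b l : (\forall w \near z, F w = G w) -> jet F z a b l -> jet G z a b l.
Proof.
move=> FG [bx [b_y [cx [cy [jx jy -> -> ->]]]]].
exists bx, b_y, cx, cy; split=> //.
  by apply: jet1_near jx; exact: real_line_near FG.
by apply: jet1_near jy; exact: real_line_near FG.
Qed.

Lemma jet_uniq F z a b l a' b' l' : jet F z a b l -> jet F z a' b' l' ->
  [/\ a = a', b = b' & l = l'].
Proof.
move=> [bx [b_y [cx [cy [jx jy -> -> ->]]]]] [bx' [b_y' [cx' [cy' [jx' jy' -> -> ->]]]]].
by have [-> ->] := jet1_uniq jx jx'; have [-> ->] := jet1_uniq jy jy'.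
Qed.

Lemma jet1_line F F1 (V : set C) z v D2 : open V -> V z ->
  (forall w, V w -> cdiff F w (F1 w)) -> cdiff F1 z D2 ->
  jet1 (real_line F v z) (F1 z * v) (D2 * v * v).
Proof.
move=> oV Vz dF ddF; exists (fun t => real_line F1 v z t * v); split.
- have := @real_line_near v z V (open_nbhs_nbhs (conj oV Vz)).
  by apply: filterS => t Vt; apply: cder_line; exact: dF.
- by rewrite real_line0.
- have dl : cder (real_line F1 v z) 0 (D2 * v).
    by apply: cder_line; rewrite rmorph0 mul0r addr0.
  by apply: (cder_eq (cderM dl (cder_cst v 0))); rewrite mulr0 addr0.
Qed.

(** The second derivative in the direction v is F'' v^2, where F'' exists by [derivable_derive]; the
    sum over v = 1 and v = i vanishes since 1 + i^2 = 0. *)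
Lemma jet_holo F (V : set C) z : open V -> V z -> (forall w, V w -> derivable F w 1) ->
  jet F z ('D_1 F z) 0 0.
Proof.
move=> oV Vz dF.
have dd := derivable_cdiff (derivable_derive oV Vz dF).
have d1 w : V w -> cdiff F w ('D_1 F w) by move=> /dF/derivable_cdiff.
have J v := jet1_line v oV Vz d1 dd.
move: J dd; set D2 := derive ('D_1 F) z 1; set D1 := derive F z 1 => J _.
move: D1 D2 J => D1 D2 J.
exists D1, (D1 * ii), D2, (D2 * ii * ii).
split.
- by have := J 1; rewrite !mulr1.
- exact: J.
- by rewrite mulrCA ii2 mulrN1 opprK; field.
- by rewrite mulrCA ii2 mulrN1 subrr mul0r.
- by rewrite -mulrA ii2 mulrN1 subrr mul0r.
Qed.

Lemma jet_id z : jet id z 1 0 0.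
Proof.
have := @jet_holo id setT z openT I (fun w _ => @derivable_id _ _ w 1).
by rewrite derive_id.
Qed.

Definition pder v F z l := cder (real_line F v z) 0 l.

Lemma pder_pderive v F z l : pder v F z l -> pderive v F z = l.
Proof.
by move=> [[_ a] [_ b]]; apply: eq_ReIm.
Qed.

Lemma pderivable_pder v F z : pderivable v F z -> pder v F z (pderive v F z).
Proof. by move=> [a b]; split; [exact: (derivableP a)|exact: (derivableP b)]. Qed.

Lemma pder_shift v F z t l : pder v F (z + t%:C * v) l -> cder (real_line F v z) t l.
Proof.
have E : real_line F v z = real_line F v (z + t%:C * v) \o (fun s => s - t).
  by apply/funext => s; rewrite /real_line /= rmorphB /=; congr F; ring.
have sh : is_derive t 1 (fun s : R => s - t) 1.
  by apply: (@is_derive_eq _ _ _ _ _ _ _ _ (is_deriveB (is_derive_id t 1) (is_derive_cst t t 1)));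
  rewrite subr0.
move=> [a b]; rewrite E; split.
  rewrite -[complex.Re l]mulr1.
  by apply: (@is_derive1_comp _ (fun s => complex.Re (real_line F v (z + t%:C * v) s))
   (fun s => s - t)); rewrite ?subrr.
rewrite -[complex.Im l]mulr1.
by apply: (@is_derive1_comp _ (fun s => complex.Im (real_line F v (z + t%:C * v) s))
   (fun s => s - t)); rewrite ?subrr.
Qed.

Lemma jet1_smooth (V : set C) F v z : open V -> V z ->
  (forall w, V w -> pderivable v F w) -> pderivable v (pderive v F) z ->
  jet1 (real_line F v z) (pderive v F z) (pderive v (pderive v F) z).
Proof.
move=> oV Vz dF ddF; exists (real_line (pderive v F) v z); split.
- have := @real_line_near v z V (open_nbhs_nbhs (conj oV Vz)).
  by apply: filterS => t Vt; apply: pder_shift; apply: pderivable_pder; exact: dF.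
- exact: real_line0.
- exact: pderivable_pder.
Qed.

Lemma jet_smooth (V : set C) F z : open V -> V z -> Ck_on 2 V F ->
  jet F z (d_z F z) (d_zbar F z)
   ((pderive 1 (pderive 1 F) z + pderive ii (pderive ii F) z) / 4).
Proof.
move=> oV Vz [_ H]; have [d1 [_ D1]] := H 1 (or_introl erefl).
have [d2 [_ D2]] := H ii (or_intror erefl).
do 4 eexists; split.
- by apply: (jet1_smooth oV Vz d1); case: (D1 1 (or_introl erefl)) => + _; apply.
- by apply: (jet1_smooth oV Vz d2); case: (D2 ii (or_intror erefl)) => + _; apply.
- by [].
- by [].
- by [].
Qed.

End Jets.

(** * The Frobenius norm [fn] of matrices and its square [frob] *)

Section Frobenius.
Variable R : realType.
Notation C := (Cx R).

(** Lagrange's identity: twice the defect is the sum of the squares (a_i b_j - a_j b_i)^2. *)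
Lemma real_CS (I : finType) (a b : I -> R) :
  (\sum_i a i * b i) ^+ 2 <= (\sum_i a i ^+ 2) * (\sum_i b i ^+ 2).
Proof.
have : 0 <= \sum_i \sum_j (a i * b j - a j * b i) ^+ 2.
  by apply: sumr_ge0 => i _; apply: sumr_ge0 => j _; exact: sqr_ge0.
have -> : \sum_i \sum_j (a i * b j - a j * b i) ^+ 2 =
   2 * ((\sum_i a i ^+ 2) * (\sum_i b i ^+ 2) - (\sum_i a i * b i) ^+ 2).
  have E1 : (\sum_i a i ^+ 2) * (\sum_i b i ^+ 2) = \sum_i \sum_j (a i ^+ 2 * b j ^+ 2).
    by rewrite mulr_suml; apply: eq_bigr => i _; rewrite mulr_sumr.
  have E2 : (\sum_i a i ^+ 2) * (\sum_i b i ^+ 2) = \sum_i \sum_j (a j ^+ 2 * b i ^+ 2).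
    by rewrite E1 exchange_big.
  have E3 : (\sum_i a i * b i) ^+ 2 = \sum_i \sum_j (a i * b i * (a j * b j)).
    by rewrite expr2 mulr_suml; apply: eq_bigr => i _; rewrite mulr_sumr.
  have dbl (p q : R) : 2 * (p - q) = p + p - (q + q) by ring.
  rewrite dbl {1}E1 E2 E3 -!big_split /= -sumrB.
  apply: eq_bigr => i _; rewrite -!big_split /= -sumrB; apply: eq_bigr => j _.
  ring.
by rewrite pmulr_rge0// subr_ge0.
Qed.

Lemma nm_sum (I : finType) (x : I -> C) : nm (\sum_i x i) <= \sum_i nm (x i).
Proof.
by elim/big_ind2 : _ => [|a b c d h1 h2|//]; [rewrite nm0|
  apply: le_trans (nm_triangle _ _) (lerD h1 h2)].
Qed.

Lemma complex_CS (I : finType) (x y : I -> C) :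
  nm (\sum_i x i * y i) ^+ 2 <= (\sum_i nm (x i) ^+ 2) * (\sum_i nm (y i) ^+ 2).
Proof.
apply: le_trans (real_CS _ _); rewrite ler_sqr ?nnegrE ?nm_ge0//; last first.
  by apply: sumr_ge0 => i _; rewrite mulr_ge0 ?nm_ge0.
by apply: le_trans (nm_sum _) _; apply: ler_sum => i _; rewrite nmM.
Qed.

Definition frob m n (X : 'M[C]_(m, n)) : R := \sum_i \sum_j nm (X i j) ^+ 2.
Definition fn m n (X : 'M[C]_(m, n)) : R := Num.sqrt (frob X).

Lemma frob_ge0 m n (X : 'M[C]_(m, n)) : 0 <= frob X.
Proof. by apply: sumr_ge0 => i _; apply: sumr_ge0 => j _; exact: sqr_ge0. Qed.

Lemma fn_ge0 m n (X : 'M[C]_(m, n)) : 0 <= fn X.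
Proof. exact: sqrtr_ge0. Qed.

Lemma fn_sqr m n (X : 'M[C]_(m, n)) : fn X ^+ 2 = frob X.
Proof. by rewrite sqr_sqrtr// frob_ge0. Qed.

Lemma frob_tr m n (X : 'M[C]_(m, n)) : \tr (X *m X ^t*) = (frob X)%:C.
Proof.
rewrite /frob rmorph_sum; apply: eq_bigr => i _; rewrite !mxE rmorph_sum.
by apply: eq_bigr => j _; rewrite !mxE nm_mulconj.
Qed.

Lemma frob_ct m n (X : 'M[C]_(m, n)) : frob (X ^t*) = frob X.
Proof.
rewrite /frob exchange_big /=; apply: eq_bigr => i _; apply: eq_bigr => j _.
by rewrite !mxE nm_conj.
Qed.

Lemma fn_ct m n (X : 'M[C]_(m, n)) : fn (X ^t*) = fn X.
Proof. by rewrite /fn frob_ct. Qed.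

Lemma frob_pair m n (X : 'M[C]_(m, n)) :
  frob X = \sum_(p : 'I_m * 'I_n) nm (X p.1 p.2) ^+ 2.
Proof. by rewrite /frob pair_big. Qed.

Lemma fn_CS m n (X Y : 'M[C]_(m, n)) : nm (\tr (X *m Y ^t*)) <= fn X * fn Y.
Proof.
rewrite -(ler_sqr (nm_ge0 _)) ?nnegrE ?mulr_ge0 ?fn_ge0// exprMn !fn_sqr !frob_pair.
have -> : \tr (X *m Y ^t*) = \sum_(p : 'I_m * 'I_n) X p.1 p.2 * (Y p.1 p.2)^*%R.
  rewrite -(pair_big xpredT xpredT (fun i j => X i j * (Y i j)^*%R)) /=.
  by apply: eq_bigr => i _; rewrite !mxE; apply: eq_bigr => j _; rewrite !mxE.
apply: le_trans (complex_CS _ _) _.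
by under [X in _ * X <= _]eq_bigr do rewrite nm_conj.
Qed.

Lemma fnM m n p (X : 'M[C]_(m, n)) (Y : 'M[C]_(n, p)) : fn (X *m Y) <= fn X * fn Y.
Proof.
rewrite -(ler_sqr (fn_ge0 _)) ?nnegrE ?mulr_ge0 ?fn_ge0// exprMn !fn_sqr.
have -> : frob X * frob Y = \sum_i \sum_j ((\sum_k nm (X i k) ^+ 2) * (\sum_k nm (Y k j) ^+ 2)).
  rewrite {1}/frob mulr_suml; apply: eq_bigr => i _; rewrite -mulr_sumr; congr (_ * _).
  by rewrite /frob exchange_big.
apply: ler_sum => i _; apply: ler_sum => j _; rewrite mxE; exact: complex_CS.
Qed.

Lemma fnD m n (X Y : 'M[C]_(m, n)) : fn (X + Y) <= fn X + fn Y.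
Proof.
rewrite -(ler_sqr (fn_ge0 _)) ?nnegrE ?addr_ge0 ?fn_ge0// sqrrD !fn_sqr.
have H : \sum_(p : 'I_m * 'I_n) nm (X p.1 p.2) * nm (Y p.1 p.2) <= fn X * fn Y.
  rewrite -ler_sqr ?nnegrE ?mulr_ge0 ?fn_ge0//; last first.
    by apply: sumr_ge0 => i _; rewrite mulr_ge0 ?nm_ge0.
  by rewrite exprMn !fn_sqr !frob_pair; exact: real_CS.
apply: le_trans (_ : _ <= frob X + (\sum_(p : 'I_m * 'I_n) nm (X p.1 p.2) * nm (Y p.1 p.2)) *+ 2
  + frob Y) _; last by rewrite lerD2r lerD2l ler_pMn2r.
rewrite !frob_pair -sumrMnl -!big_split /=; apply: ler_sum => p _; rewrite mxE -sqrrD.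
by rewrite ler_sqr ?nnegrE ?addr_ge0 ?nm_ge0// nm_triangle.
Qed.

Lemma fnZ m n k (X : 'M[C]_(m, n)) : fn (k *: X) = nm k * fn X.
Proof.
rewrite /fn; have -> : frob (k *: X) = nm k ^+ 2 * frob X.
  rewrite /frob mulr_sumr; apply: eq_bigr => i _; rewrite mulr_sumr; apply: eq_bigr => j _.
  by rewrite mxE nmM exprMn.
by rewrite sqrtrM ?sqr_ge0// sqrtr_sqr ger0_norm// nm_ge0.
Qed.

Lemma fnN m n (X : 'M[C]_(m, n)) : fn (- X) = fn X.
Proof.
by rewrite -scaleN1r fnZ nmN -[X in nm X]/((1 : R)%:C) nm_real normr1 mul1r.
Qed.

Lemma fnB m n (X Y : 'M[C]_(m, n)) : fn (X - Y) <= fn X + fn Y.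
Proof. by apply: le_trans (fnD _ _) _; rewrite fnN. Qed.

Lemma fn0 m n : fn (0 : 'M[C]_(m, n)) = 0.
Proof.
rewrite /fn /frob big1 ?sqrtr0// => i _; rewrite big1// => j _.
by rewrite mxE nm0 expr0n.
Qed.

Lemma fn_sum m n (I : Type) (s : seq I) (F : I -> 'M[C]_(m, n)) :
  fn (\sum_(i <- s) F i) <= \sum_(i <- s) fn (F i).
Proof.
by elim/big_ind2 : _ => [|a b c d h1 h2|//]; [rewrite fn0|
  apply: le_trans (fnD _ _) (lerD h1 h2)].
Qed.

End Frobenius.

(** * Bounding a matrix by its eigenvalues and its commutator with its adjoint *)

Section LinearAlgebra.
Variable R : realType.
Notation C := (Cx R).

Lemma eigenvalue_det n (A : 'M[C]_n) a : eigenvalue A a = (\det (A - a%:M) == 0).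
Proof.
rewrite /eigenvalue /eigenspace kermx_eq0 row_free_unit unitmxE unitfE negbK.
by [].
Qed.

Lemma ctM m n p (A : 'M[C]_(m, n)) (B : 'M[C]_(n, p)) : (A *m B) ^t* = B ^t* *m A ^t*.
Proof. by rewrite trmx_mul map_mxM. Qed.

Lemma ctD m n (A B : 'M[C]_(m, n)) : (A + B) ^t* = A ^t* + B ^t*.
Proof. by apply/matrixP => i j; rewrite !mxE cjD. Qed.

Lemma ctN m n (A : 'M[C]_(m, n)) : (- A) ^t* = - A ^t*.
Proof. by apply/matrixP => i j; rewrite !mxE cjN. Qed.

Lemma ctB m n (A B : 'M[C]_(m, n)) : (A - B) ^t* = A ^t* - B ^t*.
Proof. by rewrite ctD ctN. Qed.

Lemma ctZ m n k (A : 'M[C]_(m, n)) : (k *: A) ^t* = (k^*)%R *: A ^t*.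
Proof. by apply/matrixP => i j; rewrite !mxE cjM. Qed.

Lemma ct1 n : (1%:M : 'M[C]_n) ^t* = 1%:M.
Proof. by apply/matrixP => i j; rewrite !mxE eq_sym; case: eqP => _; rewrite ?cj1 ?cj0. Qed.

Lemma ct_tr n (A : 'M[C]_n) : \tr (A ^t*) = (\tr A)^*%R.
Proof. by rewrite /mxtrace cj_sum; apply: eq_bigr => i _; rewrite !mxE. Qed.

Lemma trB (K : comNzRingType) n (A B : 'M[K]_n) : \tr (A - B) = \tr A - \tr B.
Proof. exact: raddfB. Qed.

Lemma trD (K : comNzRingType) n (A B : 'M[K]_n) : \tr (A + B) = \tr A + \tr B.
Proof. exact: raddfD. Qed.

Lemma fn_unitary n (P A : 'M[C]_n) : P \is unitarymx -> frob (P *m A *m P ^t*) = frob A.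
Proof.
move=> Pu; apply: complexI; rewrite -!frob_tr !ctM trmxCK.
have PP : P ^t* *m P = 1%:M by rewrite -(invmx_unitary Pu) mulVmx// unitarymx_unit.
rewrite !mulmxA -(mulmxA (P *m A)) PP mulmx1 -!mulmxA mxtrace_mulC -!mulmxA PP.
by rewrite mulmx1.
Qed.

(** Weights that grow along the flag of the Schur form. Pairing the self-commutator of T with them
    weighs |T_ij|^2 by i - j, which is at least 1 wherever a strictly lower triangular entry can be
    nonzero. *)
Definition idx n : 'M[C]_n := diag_mx (\row_i (i : nat)%:R).

Lemma tr_idx n (A : 'M[C]_n) : \tr (A *m idx n) = \sum_(i < n) A i i * (i : nat)%:R.
Proof. by apply: eq_bigr => i _; rewrite mul_mx_diag !mxE. Qed.

Lemma idx_commutator n (T : 'M[C]_n) :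
  \tr ((T *m T ^t* - T ^t* *m T) *m idx n) =
  \sum_(i < n) \sum_(j < n) ((i : nat)%:R - (j : nat)%:R) * (nm (T i j) ^+ 2)%:C.
Proof.
rewrite mulmxBl raddfB /= !tr_idx.
have -> : \sum_(i < n) (T ^t* *m T) i i * (i : nat)%:R =
    \sum_(i < n) \sum_(j < n) (j : nat)%:R * (nm (T i j) ^+ 2)%:C.
  rewrite [RHS]exchange_big /=; apply: eq_bigr => i _; rewrite mxE mulr_suml.
  by apply: eq_bigr => j _; rewrite !mxE mulrC [X in _ * X]mulrC nm_mulconj.
rewrite -sumrB; apply: eq_bigr => i _; rewrite mxE mulr_suml -sumrB; apply: eq_bigr => j _.
by rewrite !mxE nm_mulconj mulrBl; congr (_ - _); rewrite mulrC.
Qed.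

Lemma fn_idx n : fn (idx n) <= n%:R ^+ 2.
Proof.
rewrite -ler_sqr ?nnegrE ?fn_ge0 ?exprn_ge0// fn_sqr /frob.
apply: le_trans (_ : \sum_(i < n) n%:R ^+ 2 <= _).
  apply: ler_sum => i _; rewrite (bigD1 i) //= big1 => [|j ji]; last first.
    by rewrite !mxE eq_sym (negbTE ji) nm0 expr0n.
  rewrite addr0 !mxE eqxx mulr1n.
  have -> : nm ((i : nat)%:R : C) = i%:R by have := nm_real (i%:R : R); rewrite rmorph_nat normr_nat.
  by rewrite lerXn2r ?nnegrE// ler_nat ltnW.
rewrite sumr_const card_ord -[leLHS]mulr_natr -exprSr -exprM.
by case: n => [|n]; [rewrite !expr0n|rewrite ler_weXn2l ?ler1n].
Qed.

(** In Schur form the diagonal consists of eigenvalues and gives the first term. The part below the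
    diagonal is dominated by the trace of the self-commutator against [idx]; Cauchy-Schwarz and
    [fn_idx] bound it by the second term. *)
Lemma frob_eigen_bound n (A : 'M[C]_n) (M : R) : 0 <= M ->
  (forall a, eigenvalue A a -> nm a <= M) ->
  frob A <= n%:R * M ^+ 2 + n%:R ^+ 2 * fn (A *m A ^t* - A ^t* *m A).
Proof.
case: n A => [|n] A M0 AM.
  by rewrite /frob big_ord0 mul0r expr0n mul0r addr0.
have [P Pu tP] := Schur A (ltn0Sn n).
have Puu := unitarymx_unit Pu.
set T := P *m A *m P ^t*; have TE0 : T = P *m A *m P ^t* by [].
have trT : is_trig_mx T by move: tP; rewrite /similar_to conjumx// invmx_unitary.
clearbody T.
have PP : P ^t* *m P = 1%:M by rewrite -(invmx_unitary Pu) mulVmx.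
have PP' : P *m P ^t* = 1%:M by apply/unitarymxP.
have diagT i : nm (T i i) <= M.
  apply: AM; rewrite eigenvalue_det.
  have TE : T - (T i i)%:M = P *m (A - (T i i)%:M) *m P ^t*.
    rewrite mulmxBr mulmxBl -TE0; congr (_ - _).
    by rewrite mul_mx_scalar -scalemxAl PP' scalemx1.
  have : \det (T - (T i i)%:M) = 0.
    rewrite det_trig; last first.
      apply/is_trig_mxP => k l kl; rewrite !mxE (is_trig_mxP trT _ _ kl).
      by rewrite -val_eqE /= (ltn_eqF kl) mulr0n subr0.
    by rewrite (bigD1 i) //= !mxE eqxx mulr1n subrr mul0r.
  have dP : \det P * \det (P ^t*) = 1 by rewrite -det_mulmx PP' det1.
  by rewrite TE !det_mulmx mulrAC dP mul1r => ->.
set X := A *m A ^t* - A ^t* *m A.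
have XE : T *m T ^t* - T ^t* *m T = P *m X *m P ^t*.
  rewrite TE0 !ctM trmxCK !mulmxA -(mulmxA (P *m A)) PP mulmx1.
  rewrite -(mulmxA (P *m A ^t*)) PP mulmx1 /X mulmxBr mulmxBl.
  by rewrite !mulmxA.
have fX : fn (T *m T ^t* - T ^t* *m T) = fn X by rewrite /fn XE fn_unitary.
have tb : \sum_(i < n.+1) \sum_(j < n.+1) ((i : nat)%:R - (j : nat)%:R) * nm (T i j) ^+ 2
    <= n.+1%:R ^+ 2 * fn X.
  rewrite mulrC -fX; apply: le_trans (ler_wpM2l (fn_ge0 _) (fn_idx _)).
  have idxC : (idx n.+1) ^t* = idx n.+1.
    apply/matrixP => i j; rewrite !mxE eq_sym; case: eqP => [->|_]; last by rewrite cj0.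
    by rewrite !mulr1n cjn.
  apply: le_trans (fn_CS _ _); rewrite idxC idx_commutator.
  apply: le_trans (le_Re_nm _); apply: le_trans (ler_norm _).
  rewrite le_eqVlt; apply/orP; left; apply/eqP; rewrite -[LHS]/(complex.Re (_%:C)).
  congr complex.Re; rewrite rmorph_sum; apply: eq_bigr => i _; rewrite rmorph_sum.
  by apply: eq_bigr => j _; rewrite rmorphM rmorphB /= !rmorph_nat.
rewrite -(fn_unitary A Pu) -TE0.
apply: le_trans (_ : \sum_(i < n.+1) (M ^+ 2 + \sum_(j < n.+1) ((i : nat)%:R - (j : nat)%:R) * nm (T i j) ^+ 2) <= _); last first.
  by rewrite big_split /= sumr_const card_ord -[X in X + _]mulr_natl lerD2l.
apply: ler_sum => i _; rewrite (bigD1 i) //= [X in _ <= _ + X](bigD1 i) //= subrr mul0r add0r.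
apply: lerD; first by rewrite lerXn2r ?nnegrE ?nm_ge0.
apply: ler_sum => j ji; have [ij|ij|ij] := ltngtP i j; last first.
- by move: ji; rewrite -val_eqE /= ij eqxx.
- by rewrite ler_peMl ?sqr_ge0// -natrB ?(ltnW ij)// ler1n subn_gt0.
- by rewrite (is_trig_mxP trT _ _ ij) nm0 expr0n mulr0.
Qed.

End LinearAlgebra.

(** * Spectral projections of a matrix with simple eigenvalues, and their defect from
    orthogonality *)

Section SpectralProjections.
Variable R : realType.
Notation C := (Cx R).
Variable n : nat.
Implicit Types (A X : 'M[C]_n.+1) (d : 'I_n.+1 -> C).

(** Lagrange interpolation: the projection to the eigenline of d i as a polynomial in A. In this
    form it visibly depends holomorphically on A and d and commutes with changes of frame. *)
Definition lagr A d i : 'M[C]_n.+1 :=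
  (\prod_(j | j != i) (d i - d j))^-1 *: \prod_(j | j != i) (A - (d j)%:M).

Lemma lagr_row A d i k (v : 'rV[C]_n.+1) : injective d -> v *m A = d k *: v ->
  v *m lagr A d i = (i == k)%:R *: v.
Proof.
move=> dinj vA.
have E : v *m \prod_(j | j != i) (A - (d j)%:M) = \prod_(j | j != i) (d k - d j) *: v.
  elim/big_rec2: _ => [|j x X _ IH]; first by rewrite scale1r mulmx1.
  by rewrite mulmxA mulmxBr vA mul_mx_scalar -scalerBl -scalemxAl IH scalerA.
rewrite /lagr -scalemxAr E scalerA; have [->|ik] := eqVneq i k.
  rewrite mulVf//; apply/prodf_neq0 => j jk; rewrite subr_eq0 eq_sym.
  by apply: contra jk => /eqP/dinj ->.
by rewrite [X in _ * X](bigD1 k) 1?eq_sym //= subrr mul0r mulr0.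
Qed.

(** The rows of S are eigenvectors v_i, matrices acting on row vectors. If u S = 0, applying the
    i-th projection leaves u_i v_i = 0, so u = 0 and S is invertible. *)
Lemma lagr_diag A d : injective d -> (forall i, eigenvalue A (d i)) ->
  exists2 S : 'M[C]_n.+1, S \in unitmx &
    (forall i, lagr A d i = invmx S *m delta_mx i i *m S) /\
    A = invmx S *m diag_mx (\row_i d i) *m S.
Proof.
move=> dinj ev.
have /choice[v vP] : forall i, exists v : 'rV[C]_n.+1, v *m A = d i *: v /\ v != 0.
  by move=> i; have /eigenvalueP[v v1 v2] := ev i; exists v.
pose S := \matrix_i v i.
have rS i : row i S = v i by rewrite rowK.
have SL i : S *m lagr A d i = delta_mx i i *m S.
  apply/row_matrixP => k; rewrite !row_mul rS (lagr_row i dinj (vP k).1).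
  rewrite rowE mul_delta_mx_cond; have [->|ik] := eqVneq i k.
    by rewrite mulr1n scale1r -rowE rS.
  by rewrite mulr0n mul0mx scale0r.
have uS : S \in unitmx.
  rewrite -row_free_unit -kermx_eq0; apply/eqP/row_matrixP => k; rewrite row0.
  set u := row k _; have uS0 : u *m S = 0.
    by apply/eqP; rewrite -sub_kermx row_sub.
  clearbody u.
  apply/rowP => i; rewrite mxE.
  have : u *m S *m lagr A d i = 0 by rewrite uS0 mul0mx.
  rewrite -mulmxA SL mulmxA.
  have -> : u *m delta_mx i i = u 0 i *: delta_mx 0 i.
    apply/rowP => j; rewrite !mxE (bigD1 i) //= !mxE eqxx big1 ?addr0 //=.
    by move=> l li; rewrite !mxE (negbTE li) mulr0.
  rewrite -scalemxAl -rowE rS => /eqP; rewrite scaler_eq0 (negbTE (vP i).2) orbF.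
  by move=> /eqP.
exists S => //; split=> [i|]; first by rewrite -mulmxA -SL mulKmx.
have SA : S *m A = diag_mx (\row_i d i) *m S.
  apply/row_matrixP => k; rewrite row_mul rS (vP k).1 mul_diag_mx.
  by apply/rowP => j; rewrite !mxE.
by rewrite -mulmxA -SA mulKmx.
Qed.

Lemma conj_real (x : R) : (x%:C^*)%R = x%:C :> C.
Proof. by apply: eq_ReIm; rewrite ?Re_conjE ?Im_conjE //= oppr0. Qed.

Lemma tr_delta i X : \tr (delta_mx i i *m X) = X i i.
Proof.
rewrite /mxtrace (bigD1 i) //= big1 => [|k ki].
  rewrite addr0 mxE (bigD1 i) //= big1 => [|l li]; last by rewrite !mxE (negbTE li) andbF mul0r.
  by rewrite !mxE !eqxx mul1r addr0.
by rewrite mxE big1 // => l _; rewrite !mxE (negbTE ki) mul0r.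
Qed.

Section Facts.
Variables (A : 'M[C]_n.+1) (d : 'I_n.+1 -> C).
Hypotheses (dinj : injective d) (ev : forall i, eigenvalue A (d i)).
Local Notation pi := (lagr A d).

(** Holds because the projection has rank one. With its adjoint for X it becomes [sf_adj], from
    which all norms below are computed. *)
Lemma lagr_sandwich i X : pi i *m X *m pi i = \tr (pi i *m X) *: pi i.
Proof.
have [S uS [piE _]] := lagr_diag dinj ev; rewrite piE.
have dd (Y : 'M[C]_n.+1) : delta_mx i i *m Y *m delta_mx i i = Y i i *: (delta_mx i i : 'M[C]_n.+1).
  rewrite -(mulmxA (delta_mx i i)); apply/matrixP => a b; rewrite !mxE.
  rewrite (bigD1 i) //= big1 => [|l li]; last by rewrite !mxE (negbTE li) andbF mul0r.
  rewrite !mxE (bigD1 i) //= big1 => [|l li]; last by rewrite !mxE (negbTE li) mulr0.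
  by rewrite !mxE !eqxx /= !addr0 andbT; case: (a == i); case: (b == i);
    rewrite ?mul1r ?mulr1 ?mul0r ?mulr0.
have -> : \tr (invmx S *m delta_mx i i *m S *m X) = (S *m X *m invmx S) i i.
  by rewrite -!mulmxA mxtrace_mulC -!mulmxA tr_delta !mulmxA.
rewrite -!mulmxA (mulmxA S X) (mulmxA (S *m X)) (mulmxA (S *m X *m invmx S)).
rewrite (mulmxA (delta_mx i i)) (mulmxA (delta_mx i i)) dd.
by rewrite -scalemxAl -scalemxAr !mulmxA.
Qed.

Lemma lagr_mul i j : pi i *m pi j = (i == j)%:R *: pi i.
Proof.
have [S uS [piE _]] := lagr_diag dinj ev; rewrite !piE.
rewrite -!mulmxA (mulmxA S) mulmxV// mul1mx (mulmxA (delta_mx i i)) mul_delta_mx_cond.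
by case: eqVneq => [->|_]; rewrite ?mulr1n ?scale1r// mulr0n mul0mx mulmx0 scale0r.
Qed.

Lemma tr_lagr i : \tr (pi i) = 1.
Proof.
have [S uS [piE _]] := lagr_diag dinj ev; rewrite piE -mulmxA mxtrace_mulC -mulmxA mulmxV//.
by rewrite tr_delta mxE eqxx.
Qed.

Lemma sum_lagr : \sum_i pi i = 1%:M.
Proof.
have [S uS [piE _]] := lagr_diag dinj ev; under eq_bigr do rewrite piE.
rewrite -mulmx_suml -mulmx_sumr -mx1_sum_delta mulmx1 mulVmx//.
Qed.

Lemma sum_lagr_eigen : \sum_i d i *: pi i = A.
Proof.
have [S uS [piE AE]] := lagr_diag dinj ev; rewrite [RHS]AE.
have -> : diag_mx (\row_i d i) = \sum_i d i *: (delta_mx i i : 'M[C]_n.+1).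
  rewrite diag_mx_sum_delta; apply: eq_bigr => i _; by rewrite mxE.
rewrite mulmx_sumr mulmx_suml; apply: eq_bigr => i _.
by rewrite piE -scalemxAr -scalemxAl.
Qed.

End Facts.

(** The relations on which the norm estimates rest, separated from the Lagrange formula so that they
    can be used for projections conjugated by a factor of the metric. *)
Record spectral_family A d (pi : 'I_n.+1 -> 'M[C]_n.+1) : Prop := SpectralFamily {
  sf_inj : injective d;
  sf_sandwich : forall i X, pi i *m X *m pi i = \tr (pi i *m X) *: pi i;
  sf_mul : forall i j, pi i *m pi j = (i == j)%:R *: pi i;
  sf_tr : forall i, \tr (pi i) = 1;
  sf_sum : \sum_i pi i = 1%:M;
  sf_eigen : \sum_i d i *: pi i = A }.

Lemma lagr_spectral_family A d : injective d -> (forall i, eigenvalue A (d i)) ->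
  spectral_family A d (lagr A d).
Proof.
move=> dinj ev; split=> //.
- exact: lagr_sandwich.
- exact: lagr_mul.
- exact: tr_lagr.
- exact: sum_lagr.
- exact: sum_lagr_eigen.
Qed.

Section SpectralFamily.
Variables (A : 'M[C]_n.+1) (d : 'I_n.+1 -> C) (pi : 'I_n.+1 -> 'M[C]_n.+1).
Hypothesis sf : spectral_family A d pi.

Lemma sf_eigenl i : A *m pi i = d i *: pi i.
Proof.
rewrite -[X in X *m _ = _](sf_eigen sf) mulmx_suml (bigD1 i) //= big1 => [|j ji].
  by rewrite addr0 -scalemxAl (sf_mul sf) eqxx scale1r.
by rewrite -scalemxAl (sf_mul sf) (negbTE ji) scale0r scaler0.
Qed.

Lemma sf_eigenr i : pi i *m A = d i *: pi i.
Proof.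
rewrite -[X in _ *m X = _](sf_eigen sf) mulmx_sumr (bigD1 i) //= big1 => [|j ji].
  by rewrite addr0 -scalemxAr (sf_mul sf) eqxx scale1r.
by rewrite -scalemxAr (sf_mul sf) eq_sym (negbTE ji) scale0r scaler0.
Qed.

(** The reduced resolvent of A at d i: it inverts A - d i on the sum of the other eigenlines. *)
Definition resolvent i : 'M[C]_n.+1 := \sum_(j | j != i) (d j - d i)^-1 *: pi j.

Lemma resolventE i : resolvent i *m (A - (d i)%:M) = 1%:M - pi i.
Proof.
rewrite /resolvent mulmx_suml -(sf_sum sf) [in RHS](bigD1 i) //= [RHS]addrC addKr.
apply: eq_bigr => j ji; rewrite -scalemxAl mulmxBr sf_eigenr mul_mx_scalar -scalerBl.
rewrite scalerA mulVf ?scale1r// subr_eq0.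
by apply: contra ji => /eqP/(sf_inj sf) ->.
Qed.

Local Notation p i := (frob (pi i)).

Lemma sf_adj i : pi i *m (pi i) ^t* *m pi i = (p i)%:C *: pi i.
Proof. by rewrite (sf_sandwich sf) frob_tr. Qed.

Lemma sf_adj' i : (pi i) ^t* *m pi i *m (pi i) ^t* = (p i)%:C *: (pi i) ^t*.
Proof.
by rewrite -(conj_real (p i)) -(ctZ (p i)%:C) -sf_adj !ctM trmxCK mulmxA.
Qed.

(** By [sf_adj] and [sf_adj'] every product of the projection and its adjoint collapses to a
    multiple, so the norm is a polynomial in p. It vanishes at p = 1, the orthogonal case, and its
    positivity forces p >= 1. *)
Lemma sf_defect i :
  frob ((1%:M - pi i) *m (pi i) ^t* *m pi i) = p i ^+ 3 - p i ^+ 2.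
Proof.
have XE : (1%:M - pi i) *m (pi i) ^t* *m pi i = (pi i) ^t* *m pi i - (p i)%:C *: pi i.
  by rewrite mulmxBl mul1mx mulmxBl sf_adj.
have XE' : ((pi i) ^t* *m pi i - (p i)%:C *: pi i) ^t* =
    (pi i) ^t* *m pi i - (p i)%:C *: (pi i) ^t*.
  by rewrite ctB (ctZ (p i)%:C) conj_real ctM trmxCK.
set a := (pi i) ^t* *m pi i; set k := (p i)%:C.
have t1 : a *m a = k *: a by rewrite /a mulmxA sf_adj' -scalemxAl.
have t2 : a *m (pi i) ^t* = k *: (pi i) ^t* by exact: sf_adj'.
have t3 : pi i *m a = k *: pi i by rewrite /a mulmxA sf_adj.
have ta : \tr a = k by rewrite /a mxtrace_mulC frob_tr.
apply: complexI; rewrite -frob_tr XE XE' -/a -/k.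
have -> : (a - k *: pi i) *m (a - k *: (pi i) ^t*) =
    k *: a - k *: (k *: (pi i) ^t*) - (k *: (k *: pi i) - k *: (k *: (pi i *m (pi i) ^t*))).
  by rewrite mulmxBl !mulmxBr t1 -!scalemxAr -!scalemxAl t2 t3.
have tp := frob_tr (pi i); rewrite -/k in tp.
have tc := ct_tr (pi i); rewrite (sf_tr sf) cj1 in tc.
have kE : (p i ^+ 3 - p i ^+ 2)%:C = k ^+ 3 - k ^+ 2 by rewrite rmorphB /= !rmorphXn.
rewrite kE; clear XE XE' kE; clearbody a k.
have trs (x y z w : 'M[C]_n.+1) : \tr (x - y - (z - w)) = \tr x - \tr y - (\tr z - \tr w).
  by rewrite !trB.
rewrite trs.
rewrite (mxtraceZ k a) ta !(mxtraceZ k (k *: _)) !(mxtraceZ k (pi i)) (mxtraceZ k (_ *m _)) tp.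
rewrite (mxtraceZ k (_ ^t*)) tc (sf_tr sf).
ring.
Qed.

Lemma sf_frob_ge1 i : 1 <= p i.
Proof.
have p0 : 0 < p i.
  rewrite lt0r frob_ge0 andbT; apply/eqP => p0.
  have := (sf_tr sf) i; rewrite -(mulmx1 (pi i)) -ct1 => E.
  have := fn_CS (pi i) 1%:M; rewrite E /fn p0 sqrtr0 mul0r -[X in nm X]/((1 : R)%:C) nm_real.
  by rewrite normr1 ler10.
have := frob_ge0 ((1%:M - pi i) *m (pi i) ^t* *m pi i); rewrite sf_defect.
have -> : p i ^+ 3 - p i ^+ 2 = p i ^+ 2 * (p i - 1) by ring.
by rewrite pmulr_rge0 ?exprn_gt0// subr_ge0.
Qed.

(** Multiply the commutator by the resolvent on the left and by pi_i on the right. Since (A - d_i)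
    pi_i = 0, one term dies and the other becomes the matrix of [sf_defect], of squared norm p^2 (p
    - 1); a factor p is then cancelled. *)
Lemma sf_commutator_lower i :
  p i * (p i - 1) <= fn (resolvent i) ^+ 2 * frob (A *m (pi i) ^t* - (pi i) ^t* *m A).
Proof.
set Y := A *m _ - _; have p1 := sf_frob_ge1 i; have p0 := lt_le_trans ltr01 p1.
have E : resolvent i *m Y *m pi i = (1%:M - pi i) *m (pi i) ^t* *m pi i.
  have -> : Y = (A - (d i)%:M) *m (pi i) ^t* - (pi i) ^t* *m (A - (d i)%:M).
    rewrite mulmxBl mulmxBr mul_scalar_mx mul_mx_scalar opprB addrA subrK.
    by [].
  have A0 : (A - (d i)%:M) *m pi i = 0 by rewrite mulmxBl sf_eigenl mul_scalar_mx subrr.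
  by rewrite -mulmxA mulmxBl -!mulmxA A0 mulmx0 subr0 !mulmxA resolventE.
have H : fn ((1%:M - pi i) *m (pi i) ^t* *m pi i) <= fn (resolvent i) * fn Y * fn (pi i).
  rewrite -E; apply: le_trans (fnM _ _) _; rewrite ler_wpM2r ?fn_ge0//; exact: fnM.
have {}H : frob ((1%:M - pi i) *m (pi i) ^t* *m pi i) <= (fn (resolvent i) * fn Y * fn (pi i)) ^+ 2.
  by rewrite -fn_sqr ler_sqr ?nnegrE ?mulr_ge0 ?fn_ge0.
move: H; rewrite sf_defect !exprMn !fn_sqr.
have -> : p i ^+ 3 - p i ^+ 2 = p i * (p i - 1) * p i by ring.
by rewrite ler_pM2r.
Qed.

Lemma sf_star i : frob ((pi i) ^t* - pi i) = 2 * (p i - 1).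
Proof.
apply: complexI; rewrite -frob_tr ctB trmxCK mulmxBl !mulmxBr !trB.
rewrite (mxtrace_mulC _ (pi i)) frob_tr -ctM ct_tr (sf_mul sf) eqxx scale1r (sf_tr sf) cj1.
by rewrite rmorphM rmorphB /= rmorph_nat rmorph1; ring.
Qed.

(** Expand A as the sum of the d_i pi_i. As A commutes with pi_i, the adjoint of pi_i may be
    replaced by its difference from pi_i, whose norm is known from [sf_star]. *)
Lemma sf_commutator_upper (M : R) : (forall i, nm (d i) <= M) ->
  fn (A *m A ^t* - A ^t* *m A) <= \sum_i M * (2 * fn A * Num.sqrt (2 * (p i - 1))).
Proof.
move=> dM.
have -> : A *m A ^t* - A ^t* *m A = \sum_i d i *: (pi i *m A ^t* - A ^t* *m pi i).
  rewrite -{1 4}(sf_eigen sf) mulmx_suml mulmx_sumr -sumrB.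
  by apply: eq_bigr => i _; rewrite scalerBr -scalemxAl -scalemxAr.
apply: le_trans (fn_sum _ _) _; apply: ler_sum => i _; rewrite fnZ.
apply: ler_pM; rewrite ?nm_ge0 ?fn_ge0//.
rewrite -fn_ct ctB !ctM trmxCK.
have -> : A *m (pi i) ^t* - (pi i) ^t* *m A = A *m ((pi i) ^t* - pi i) - ((pi i) ^t* - pi i) *m A.
  by rewrite mulmxBr mulmxBl sf_eigenl sf_eigenr opprB addrA subrK.
have -> : Num.sqrt (2 * (p i - 1)) = fn ((pi i) ^t* - pi i) by rewrite /fn sf_star.
apply: le_trans (fnB _ _) _.
set q := fn ((pi i) ^t* - pi i).
have -> : 2 * fn A * q = fn A * q + q * fn A by ring.
by apply: lerD; exact: fnM.
Qed.

End SpectralFamily.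
End SpectralProjections.

(** * Bounds on the projections in terms of the size and the gap of the eigenvalues *)

Section ProjectionBounds.
Variable R : realType.
Notation C := (Cx R).
Variable n : nat.
Implicit Types (A X Y : 'M[C]_n.+1) (d : 'I_n.+1 -> C).

(** Each of the n factors of the Lagrange formula is bounded by (a + M |1|)/delta. *)
Definition lagr_const (a M delta : R) : R :=
  fn (1%:M : 'M[C]_n.+1) * ((a + M * fn (1%:M : 'M[C]_n.+1)) / delta) ^+ n.

Lemma fn_lagr A d i (a M delta : R) : 0 < delta -> fn A <= a ->
  (forall j, nm (d j) <= M) -> (forall j, j != i -> delta <= nm (d i - d j)) ->
  fn (lagr A d i) <= lagr_const a M delta.
Proof.
move=> d0 Aa dM dd; set s := fn (1%:M : 'M[C]_n.+1); set c := a + M * s.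
have c0 : 0 <= c.
  apply: addr_ge0; first exact: le_trans (fn_ge0 _) Aa.
  by rewrite mulr_ge0 ?fn_ge0//; exact: le_trans (nm_ge0 _) (dM i).
have H1 : fn (\prod_(j | j != i) (A - (d j)%:M)) <= s * \prod_(j | j != i) c.
  elim/big_rec2: _ => [|j x X ji IH]; first by rewrite mulr1.
  apply: le_trans (fnM _ _) _; rewrite mulrCA.
  apply: ler_pM => //; rewrite ?fn_ge0//.
  apply: le_trans (fnB _ _) _; rewrite lerD// -scalemx1 fnZ ler_wpM2r ?fn_ge0//.
have H2 : nm (\prod_(j | j != i) (d i - d j))^-1 <= \prod_(j | j != i) delta^-1.
  rewrite -prodfV; elim/big_rec2: _ => [|j x X ji IH].
    by rewrite -[X in nm X]/((1 : R)%:C) nm_real normr1.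
  rewrite nmM; apply: ler_pM; rewrite ?nm_ge0// nmV.
  by rewrite lef_pV2 ?posrE ?dd// (lt_le_trans d0)// dd.
rewrite fnZ /lagr_const -/s -/c; apply: le_trans (ler_pM (nm_ge0 _) (fn_ge0 _) H2 H1) _.
rewrite mulrCA -big_split /= prodr_const cardC1 card_ord /=.
by rewrite (mulrC _ c).
Qed.

Lemma fn_resolvent (d : 'I_n.+1 -> C) (pi : 'I_n.+1 -> 'M[C]_n.+1) i (L delta : R) :
  0 < delta -> (forall j, fn (pi j) <= L) ->
  (forall j, j != i -> delta <= nm (d j - d i)) ->
  fn (resolvent d pi i) <= n.+1%:R * (delta^-1 * L).
Proof.
move=> d0 piL dd; have L0 : 0 <= L := le_trans (fn_ge0 _) (piL i).
rewrite /resolvent big_mkcond /=; apply: le_trans (fn_sum _ _) _.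
apply: le_trans (_ : \sum_(j < n.+1) (delta^-1 * L) <= _); last first.
  by rewrite sumr_const card_ord -[leLHS]mulr_natl.
apply: ler_sum => j _; case: ifPn => [ji|_]; last first.
  by rewrite fn0 mulr_ge0 ?invr_ge0 ?(ltW d0).
rewrite fnZ nmV; apply: ler_pM; rewrite ?fn_ge0 ?invr_ge0 ?nm_ge0//.
by rewrite lef_pV2 ?posrE ?dd// (lt_le_trans d0)// dd.
Qed.

End ProjectionBounds.

(** * Adjoints and norms for a Hermitian metric on the fibre *)

Section HermitianMetric.
Variable R : realType.
Notation C := (Cx R).

Definition posdef n (H : 'M[C]_n) := H ^t* = H /\
  forall v : 'cV[C]_n, v != 0 -> 0 < (v ^t* *m H *m v) 0 0.

Lemma posdef_factor n (H : 'M[C]_n) : posdef H ->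
  exists2 G : 'M[C]_n, G \in unitmx & H = G ^t* *m G.
Proof.
move=> [Hh Hp].
have /orthomx_spectralP HE : H \is normalmx by apply/normalmxP; rewrite Hh.
have Pu := spectral_unitarymx H; set P := spectralmx H in HE Pu *.
set D := spectral_diag H in HE *.
have Puu := unitarymx_unit Pu.
rewrite invmx_unitary// in HE.
have PP : P *m P ^t* = 1%:M by apply/unitarymxP.
have D0 i : 0 < D 0 i.
  pose v := P ^t* *m delta_mx i 0 : 'cV[C]_n.
  have vE : v ^t* *m H *m v = (delta_mx 0 i : 'rV_n) *m diag_mx D *m delta_mx i 0.
    rewrite /v ctM trmxCK {1}HE !mulmxA -(mulmxA _ P (P ^t*)) PP mulmx1.
    rewrite -(mulmxA _ P (P ^t*)) PP mulmx1; congr (_ *m _ *m _).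
    by apply/matrixP => a b; rewrite !mxE andbC; case: andP => _; rewrite ?cj1 ?cj0.
  have v0 : v != 0.
    apply: contraTneq isT => v0; have : P *m v = 0 by rewrite v0 mulmx0.
    rewrite /v mulmxA PP mul1mx => /matrixP/(_ i 0); rewrite !mxE !eqxx => /eqP.
    by rewrite oner_eq0.
  have := Hp v v0; rewrite vE -rowE mxE (bigD1 i) //= big1 => [|j ji].
    by rewrite !mxE !eqxx mulr1n mulr1 addr0.
  by rewrite !mxE (negbTE ji) mulr0.
pose Q : 'M[C]_n := diag_mx (\row_i sqrtC (D 0 i)).
have sq i : ((sqrtC (D 0 i))^*)%R = sqrtC (D 0 i).
  by apply/CrealP; rewrite ger0_real// sqrtC_ge0 ltW.
have QQ : Q ^t* *m Q = diag_mx D.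
  have -> : Q ^t* = Q.
    apply/matrixP => i j; rewrite !mxE eq_sym; case: eqP => [->|_]; last by rewrite cj0.
    by rewrite !mulr1n sq.
  rewrite /Q mul_diag_mx; apply/matrixP => i j; rewrite !mxE.
  by case: eqP => [->|_]; rewrite ?mulr0n ?mulr0// !mulr1n -expr2 sqrtCK.
exists (Q *m P); last by rewrite ctM mulmxA -(mulmxA _ (Q ^t*)) QQ.
rewrite unitmx_mul Puu andbT unitmxE det_diag unitfE.
by apply/prodf_neq0 => i _; rewrite mxE sqrtC_eq0 gt_eqF.
Qed.

Definition adj n (H X : 'M[C]_n) : 'M[C]_n := invmx H *m X ^t* *m H.

(** The squared norm of an endomorphism for H; the trace is real by [hnE]. *)
Definition hn n (H X : 'M[C]_n) : R := complex.Re (\tr (X *m adj H X)).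

Section Conjugate.
Variables (n : nat) (G H : 'M[C]_n).
Hypotheses (uG : G \in unitmx) (HG : H = G ^t* *m G).
Implicit Types X Y : 'M[C]_n.

(** Passage to an orthonormal frame: when G factors H, conjugation by G turns [adj H] into the
    conjugate transpose and [hn H] into [frob], so that the estimates for the Frobenius norm
    apply. *)
Definition gc X : 'M[C]_n := G *m X *m invmx G.

Lemma gcM X Y : gc (X *m Y) = gc X *m gc Y.
Proof. by rewrite /gc !mulmxA mulmxKV. Qed.

Lemma gcB X Y : gc (X - Y) = gc X - gc Y.
Proof. by rewrite /gc mulmxBr mulmxBl. Qed.

Lemma gcZ k X : gc (k *: X) = k *: gc X.
Proof. by rewrite /gc -scalemxAr -scalemxAl. Qed.

Lemma gc_scalar k : gc k%:M = k%:M.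
Proof. by rewrite /gc mul_mx_scalar -scalemxAl mulmxV// scalemx1. Qed.

Lemma gc_tr X : \tr (gc X) = \tr X.
Proof. by rewrite /gc -mulmxA mxtrace_mulC mulmxKV. Qed.

Lemma gc_adj X : gc (adj H X) = (gc X) ^t*.
Proof.
have uGc : G ^t* \in unitmx.
  have := congr1 (fun Y : 'M[C]_n => Y ^t*) (mulmxV uG); rewrite ctM ct1 => /mulmx1_unit[].
  by [].
have Gi : (invmx G) ^t* *m G ^t* = 1%:M by rewrite -ctM mulmxV// ct1.
have uH : H \in unitmx by rewrite HG unitmx_mul uGc uG.
rewrite /gc /adj !ctM; apply: (can_inj (mulKmx uGc)); rewrite !mulmxA.
rewrite -HG mulmxV// mul1mx.
have -> : G ^t* *m (invmx G) ^t* = 1%:M.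
  by rewrite -ctM mulVmx// ct1.
by rewrite mul1mx HG !mulmxA mulmxK.
Qed.

Lemma gc_bracket X Y : gc (X *m adj H Y - adj H Y *m X) =
  gc X *m (gc Y) ^t* - (gc Y) ^t* *m gc X.
Proof. by rewrite gcB (gcM X) (gcM (adj H Y) X) gc_adj. Qed.

Lemma tr_adj X Y : \tr (X *m adj H Y) = \tr (gc X *m (gc Y) ^t*).
Proof. by rewrite -gc_adj -gcM gc_tr. Qed.

Lemma hn_gc X : hn H X = frob (gc X).
Proof. by rewrite /hn tr_adj frob_tr. Qed.

Lemma eigenvalue_gc X a : eigenvalue (gc X) a = eigenvalue X a.
Proof.
rewrite !eigenvalue_det; have -> : gc X - a%:M = gc (X - a%:M) by rewrite gcB gc_scalar.
rewrite /gc !det_mulmx mulrAC -det_mulmx mulmxV// det1 mul1r.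
by [].
Qed.

End Conjugate.

Lemma lagr_gc n (G A : 'M[C]_n.+1) d i : G \in unitmx ->
  lagr (gc G A) d i = gc G (lagr A d i).
Proof.
move=> uG; rewrite /lagr gcZ; congr (_ *: _).
elim/big_rec2: _ => [|j x X ji ->]; first by rewrite -[LHS](gc_scalar uG 1).
rewrite -[RHS]/(gc G ((A - (d j)%:M) *m x)) gcM// gcB gc_scalar//.
Qed.

Section MetricEstimates.
Variables (n : nat) (H : 'M[C]_n).
Hypothesis pH : posdef H.
Implicit Types X Y : 'M[C]_n.

Lemma posdef_unit : H \in unitmx.
Proof.
have [G uG HG] := posdef_factor pH.
rewrite HG unitmx_mul uG andbT.
have := congr1 (fun Y : 'M[C]_n => Y ^t*) (mulmxV uG); rewrite ctM ct1 => /mulmx1_unit[].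
by [].
Qed.

Lemma hnE X : \tr (X *m adj H X) = (hn H X)%:C.
Proof. by have [G uG HG] := posdef_factor pH; rewrite (hn_gc uG HG) (tr_adj uG HG) frob_tr. Qed.

Lemma hn_ge0 X : 0 <= hn H X.
Proof. by have [G uG HG] := posdef_factor pH; rewrite (hn_gc uG HG) frob_ge0. Qed.

Lemma hn_CS X Y : nm (\tr (X *m adj H Y)) ^+ 2 <= hn H X * hn H Y.
Proof.
have [G uG HG] := posdef_factor pH; rewrite !(hn_gc uG HG) (tr_adj uG HG).
rewrite -!fn_sqr -exprMn ler_sqr ?nnegrE ?nm_ge0 ?mulr_ge0 ?fn_ge0//.
exact: fn_CS.
Qed.

Lemma adjK X : adj H (adj H X) = X.
Proof.
have uH := posdef_unit; have [Hh _] := pH.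
have iH : (invmx H) ^t* = invmx H.
  apply: (can_inj (mulKmx uH)); rewrite mulmxV// -{1}Hh -ctM mulVmx// ct1.
  by [].
by rewrite /adj !ctM trmxCK iH Hh !mulmxA mulVmx// mul1mx mulmxKV.
Qed.

Lemma hn_commutator_upper X : hn H (X *m adj H X - adj H X *m X) <= 4 * hn H X ^+ 2.
Proof.
have [G uG HG] := posdef_factor pH; rewrite !(hn_gc uG HG) (gc_bracket uG HG).
set Y := gc G X; rewrite -!fn_sqr.
have -> : 4 * (fn Y ^+ 2) ^+ 2 = (2 * fn Y ^+ 2) ^+ 2 by ring.
rewrite ler_sqr ?nnegrE ?fn_ge0//; last by rewrite mulr_ge0 ?sqr_ge0.
apply: le_trans (fnB _ _) _; rewrite mulr_natl mulr2n.
by apply: lerD; (apply: le_trans (fnM _ _) _; rewrite fn_ct expr2).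
Qed.

Lemma hn_eigen_bound X (M : R) : 0 <= M -> (forall a, eigenvalue X a -> nm a <= M) ->
  hn H X <= n%:R * M ^+ 2 + n%:R ^+ 2 * Num.sqrt (hn H (X *m adj H X - adj H X *m X)).
Proof.
have [G uG HG] := posdef_factor pH; move=> M0 XM.
rewrite !(hn_gc uG HG) (gc_bracket uG HG).
apply: (frob_eigen_bound M0) => b; rewrite (eigenvalue_gc uG); exact: XM.
Qed.

End MetricEstimates.

Section ProjectionEstimates.
Variables (n : nat) (H A : 'M[C]_n.+1) (d : 'I_n.+1 -> C) (a M delta : R).
Hypotheses (pH : posdef H) (delta0 : 0 < delta) (ev : forall i, eigenvalue A (d i))
  (dM : forall i, nm (d i) <= M) (sep : forall i j, i != j -> delta <= nm (d i - d j))
  (a0 : 0 <= a) (Aa : hn H A <= a ^+ 2).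
Local Notation L := (@lagr_const R n a M delta).
Local Notation pi := (lagr A d).

Lemma sep_inj : injective d.
Proof.
move=> i j dij; apply/eqP; apply: contraT => /sep; rewrite dij subrr nm0.
by rewrite leNgt delta0.
Qed.

Let factor := posdef_factor pH.

Lemma lagr_gc_family G : G \in unitmx -> H = G ^t* *m G ->
  [/\ spectral_family (gc G A) d (fun i => gc G (pi i)), fn (gc G A) <= a &
      forall i, fn (gc G (pi i)) <= L].
Proof.
move=> uG HG.
have fa : fn (gc G A) <= a.
  by rewrite -ler_sqr ?nnegrE ?fn_ge0// fn_sqr -(hn_gc uG HG).
split=> //.
  have -> : (fun i => gc G (pi i)) = lagr (gc G A) d.
    by apply/funext => i; rewrite lagr_gc.
  apply: lagr_spectral_family; first exact: sep_inj.
  by move=> i; rewrite eigenvalue_gc.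
move=> i; rewrite -lagr_gc//; apply: fn_lagr => // j ji; apply: sep.
by rewrite eq_sym.
Qed.

Lemma hn_lagr_ge1 i : 1 <= hn H (pi i).
Proof.
have [G uG HG] := factor; have [sf _ _] := lagr_gc_family uG HG.
by rewrite (hn_gc uG HG); exact: (sf_frob_ge1 sf i).
Qed.

Lemma hn_lagr_le i : hn H (pi i) <= L ^+ 2.
Proof.
have [G uG HG] := factor; have [sf _ fL] := lagr_gc_family uG HG.
rewrite (hn_gc uG HG) -fn_sqr ler_sqr ?nnegrE ?fn_ge0//.
exact: le_trans (fn_ge0 _) (fL i).
Qed.

Lemma hn_lagr_commutator i : hn H (pi i) * (hn H (pi i) - 1) <=
  (n.+1%:R * (delta^-1 * L)) ^+ 2 * hn H (A *m adj H (pi i) - adj H (pi i) *m A).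
Proof.
have [G uG HG] := factor; have [sf _ fL] := lagr_gc_family uG HG.
rewrite !(hn_gc uG HG) (gc_bracket uG HG).
apply: le_trans (sf_commutator_lower sf i) _; apply: ler_wpM2r; first exact: frob_ge0.
have R0 : fn (resolvent d (fun i => gc G (pi i)) i) <= n.+1%:R * (delta^-1 * L).
  by apply: fn_resolvent => // j; exact: sep.
by rewrite lerXn2r ?nnegrE ?fn_ge0// (le_trans _ R0) ?fn_ge0.
Qed.

Lemma hn_bracket_le : Num.sqrt (hn H (A *m adj H A - adj H A *m A)) <=
  \sum_i M * (2 * a * Num.sqrt (2 * (hn H (pi i) - 1))).
Proof.
have [G uG HG] := factor; have [sf fa fL] := lagr_gc_family uG HG.
rewrite !(hn_gc uG HG) (gc_bracket uG HG).
apply: le_trans (sf_commutator_upper sf dM) _; apply: ler_sum => i _.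
apply: ler_wpM2l; first exact: le_trans (nm_ge0 _) (dM i).
by rewrite (hn_gc uG HG) ler_wpM2r ?sqrtr_ge0// ler_pM2l.
Qed.

Lemma lagr_comm i : A *m pi i = pi i *m A.
Proof.
have sf := lagr_spectral_family sep_inj ev.
by rewrite (sf_eigenl sf) (sf_eigenr sf).
Qed.

End ProjectionEstimates.

End HermitianMetric.

(** * Second-order expansions of matrix-valued functions *)

Section MatrixJets.
Variable R : realType.
Notation C := (Cx R).
Notation ii := (ii R).

Definition has_jet (F : C -> C) z := exists a b l, jet F z a b l.

Lemma has_jet_sum (I : Type) (r : seq I) (F : I -> C -> C) z :
  (forall i, has_jet (F i) z) -> has_jet (fun w => \sum_(i <- r) F i w) z.
Proof.
move=> hF; elim: r => [|i r [a [b [l IH]]]].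
  exists 0, 0, 0; apply: jet_near (jet_cst 0 z).
  by apply: filterE => w; rewrite big_nil.
have [a' [b' [l' Fi]]] := hF i; do 3 eexists; apply: jet_near (jetD Fi IH).
by apply: filterE => w; rewrite big_cons.
Qed.

Lemma has_jet_prod (I : Type) (r : seq I) (F : I -> C -> C) z :
  (forall i, has_jet (F i) z) -> has_jet (fun w => \prod_(i <- r) F i w) z.
Proof.
move=> hF; elim: r => [|i r [a [b [l IH]]]].
  exists 0, 0, 0; apply: jet_near (jet_cst 1 z).
  by apply: filterE => w; rewrite big_nil.
have [a' [b' [l' Fi]]] := hF i; do 3 eexists; apply: jet_near (jetM Fi IH).
by apply: filterE => w; rewrite big_cons.
Qed.

Lemma has_jetM F G z : has_jet F z -> has_jet G z -> has_jet (fun w => F w * G w) z.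
Proof. by move=> [a [b [l hF]]] [a' [b' [l' hG]]]; do 3 eexists; exact: jetM hF hG. Qed.

Lemma has_jet_det n (A : C -> 'M[C]_n) z :
  (forall i j, has_jet (fun w => A w i j) z) -> has_jet (fun w => \det (A w)) z.
Proof.
move=> hA; apply: has_jet_sum => s; apply: has_jetM.
  by exists 0, 0, 0; exact: jet_cst.
by apply: has_jet_prod => k; exact: hA.
Qed.

Definition mjet m n (F : C -> 'M[C]_(m, n)) z (A B L : 'M[C]_(m, n)) :=
  forall i j, jet (fun w => F w i j) z (A i j) (B i j) (L i j).

Lemma has_mjet m n (F : C -> 'M[C]_(m, n)) z :
  (forall i j, has_jet (fun w => F w i j) z) -> exists A B L, mjet F z A B L.
Proof.
move=> hF.
have [a aP] := choice (fun ij : 'I_m * 'I_n => hF ij.1 ij.2).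
have [b bP] := choice aP.
have [l lP] := choice bP.
exists (\matrix_(i, j) a (i, j)), (\matrix_(i, j) b (i, j)), (\matrix_(i, j) l (i, j)).
by move=> i j; rewrite !mxE; exact: (lP (i, j)).
Qed.

(** Cramer's rule gives existence without explicit values; these follow in [mjet_invE] from the
    product rule for K H = 1 and the uniqueness of jets. *)
Lemma mjet_inv n (H : C -> 'M[C]_n) z : (forall i j, has_jet (fun w => H w i j) z) ->
  (\forall w \near z, H w \in unitmx) -> exists A B L, mjet (fun w => invmx (H w)) z A B L.
Proof.
move=> hH uH; apply: has_mjet => i j.
have [a [b [l dJ]]] := has_jet_det hH.
have d0 : \det (H z) != 0 by have := nbhs_singleton uH; rewrite unitmxE unitfE.
have [a1 [b1 [l1 VJ]]] := jetV dJ d0.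
have cJ : has_jet (fun w => cofactor (H w) j i) z.
  apply: has_jetM; first by exists 0, 0, 0; exact: jet_cst.
  apply: has_jet_det => k k'; have [a2 [b2 [l2 J2]]] := hH (lift j k) (lift i k').
  exists a2, b2, l2; apply: jet_near J2; apply: filterE => w; by rewrite !mxE.
have [a3 [b3 [l3 J3]]] : has_jet (fun w => (\det (H w))^-1 * cofactor (H w) j i) z.
  by apply: has_jetM => //; exists a1, b1, l1.
exists a3, b3, l3; apply: jet_near J3; apply: filterS uH => w uw.
by rewrite /invmx uw !mxE.
Qed.

Lemma mjet_uniq m n (F : C -> 'M[C]_(m, n)) z A B L A' B' L' :
  mjet F z A B L -> mjet F z A' B' L' -> [/\ A = A', B = B' & L = L'].
Proof.
by move=> J J'; split; apply/matrixP => i j; have [] := jet_uniq (J i j) (J' i j).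
Qed.

Lemma mjet_near m n (F G : C -> 'M[C]_(m, n)) z A B L :
  (\forall w \near z, F w = G w) -> mjet F z A B L -> mjet G z A B L.
Proof. by move=> FG J i j; apply: jet_near (J i j); apply: filterS FG => w ->. Qed.

Lemma mjet_cst m n (A : 'M[C]_(m, n)) z : mjet (fun=> A) z 0 0 0.
Proof. by move=> i j; rewrite !mxE; exact: jet_cst. Qed.

Lemma jet_sum (I : Type) (r : seq I) (F : I -> C -> C) z (a b l : I -> C) :
  (forall i, jet (F i) z (a i) (b i) (l i)) ->
  jet (fun w => \sum_(i <- r) F i w) z (\sum_(i <- r) a i) (\sum_(i <- r) b i)
    (\sum_(i <- r) l i).
Proof.
move=> hF; elim: r => [|i r IH].
  rewrite !big_nil; apply: jet_near (jet_cst 0 z).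
  by apply: filterE => w; rewrite big_nil.
rewrite !big_cons; apply: jet_near (jetD (hF i) IH).
by apply: filterE => w; rewrite big_cons.
Qed.

Lemma mjetM m n p (F : C -> 'M[C]_(m, n)) (G : C -> 'M[C]_(n, p)) z A B L A' B' L' :
  mjet F z A B L -> mjet G z A' B' L' ->
  mjet (fun w => F w *m G w) z (A *m G z + F z *m A') (B *m G z + F z *m B')
    (L *m G z + (A *m B' + B *m A') + F z *m L').
Proof.
move=> hF hG i j; have J k := jetM (hF i k) (hG k j).
have {J} J := jet_sum (index_enum 'I_n) J.
apply: (@jet_eq _ _ _ _ _ _ _ _ _ (jet_near _ J)).
- by apply: filterE => w; rewrite mxE.
- by rewrite !mxE big_split.
- by rewrite !mxE big_split.
- by rewrite !mxE -!big_split.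
Qed.

Lemma mjet_ct m n (F : C -> 'M[C]_(m, n)) z A B L : mjet F z A B L ->
  mjet (fun w => (F w) ^t*) z (B ^t*) (A ^t*) (L ^t*).
Proof.
move=> hF i j; apply: (@jet_eq _ _ _ _ _ _ _ _ _ (jet_near _ (jet_conj (hF j i))));
  rewrite ?mxE//; by apply: filterE => w; rewrite !mxE.
Qed.

Lemma jet_tr n (F : C -> 'M[C]_n) z A B L : mjet F z A B L ->
  jet (fun w => \tr (F w)) z (\tr A) (\tr B) (\tr L).
Proof. by move=> hF; apply: jet_sum => i; exact: hF. Qed.

Lemma mjet_invE n (H K : C -> 'M[C]_n) z H1 H2 H3 K1 K2 K3 :
  mjet H z H1 H2 H3 -> mjet K z K1 K2 K3 -> (\forall w \near z, K w *m H w = 1%:M) ->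
  [/\ K1 = - (K z *m H1 *m K z), K2 = - (K z *m H2 *m K z) &
   K3 = (K z *m H1 *m (K z *m H2) + K z *m H2 *m (K z *m H1) - K z *m H3) *m K z].
Proof.
move=> hH hK KH; have KH0 := nbhs_singleton KH.
have HK0 := mulmx1C KH0.
have [] := mjet_uniq (mjet_near KH (mjetM hK hH)) (mjet_cst 1%:M z).
have inj (X Y : 'M[C]_n) : X *m H z + Y = 0 -> X = - (Y *m K z).
  move=> /eqP; rewrite addr_eq0 => /eqP XH; rewrite -[LHS]mulmx1 -HK0 mulmxA XH mulNmx.
  by [].
move=> /inj E1 /inj E2; rewrite -addrA => /inj E3; split=> //; rewrite E3 E1 E2.
rewrite -mulNmx; congr (_ *m _); rewrite !mulNmx !opprD !opprK.
by rewrite !mulmxA.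
Qed.

End MatrixJets.

(** * The curvature of the Chern connection in terms of the jet of the metric *)

Section Bochner.
Variable R : realType.
Notation C := (Cx R).
Notation ii := (ii R).

(** First-order counterpart of [jet], for the functions [d_z F] with F of class C^2, which have only
    first derivatives at hand. *)
Definition fjet (F : C -> C) z (a b : C) := exists bx b_y : C,
  [/\ pder 1 F z bx, pder ii F z b_y, a = (bx - ii * b_y) / 2 & b = (bx + ii * b_y) / 2].

Lemma jet_fjet F z a b l : jet F z a b l -> fjet F z a b.
Proof. by move=> [bx [b_y [cx [cy [/jet1_cder jx /jet1_cder jy -> -> _]]]]]; exists bx, b_y. Qed.

Lemma fjetM F G z a b a' b' : fjet F z a b -> fjet G z a' b' ->
  fjet (fun w => F w * G w) z (a * G z + F z * a') (b * G z + F z * b').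
Proof.
move=> [bx [b_y [jx jy -> ->]]] [bx' [b_y' [jx' jy' -> ->]]].
have := cderM jx jx'; have := cderM jy jy'; rewrite !real_line0 => Jy Jx.
by do 2 eexists; split; [exact: Jx|exact: Jy|field|field].
Qed.

Lemma fjet_sum (I : Type) (r : seq I) (F : I -> C -> C) z (a b : I -> C) :
  (forall i, fjet (F i) z (a i) (b i)) ->
  fjet (fun w => \sum_(i <- r) F i w) z (\sum_(i <- r) a i) (\sum_(i <- r) b i).
Proof.
move=> hF; elim: r => [|i r [bx [b_y [jx jy ax bx']]]].
  have -> : (fun w : C => \sum_(i <- [::]) F i w) = fun=> 0.
    by apply/funext => w; rewrite big_nil.
  rewrite !big_nil; exists 0, 0; split; try exact: cder_cst.
    by rewrite mulr0 subr0 mul0r.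
  by rewrite mulr0 addr0 mul0r.
have -> : (fun w : C => \sum_(j <- i :: r) F j w) = fun w => F i w + \sum_(j <- r) F j w.
  by apply/funext => w; rewrite big_cons.
have [cx [cy [jx' jy' ax' bx'']]] := hF i.
rewrite !big_cons ax bx' ax' bx''; exists (cx + bx), (cy + b_y).
by split; [exact: (cderD jx' jx)|exact: (cderD jy' jy)|ring|ring].
Qed.

Lemma fjet_d_zbar F z a b : fjet F z a b -> d_zbar F z = b.
Proof. by move=> [bx [b_y [/pder_pderive jx /pder_pderive jy _ ->]]]; rewrite /d_zbar jx jy. Qed.

Lemma pderive_conj (V : set C) F G v : open V -> (forall w, V w -> pderivable v F w) ->
  (forall w, V w -> G w = (F w)^*%R) ->
  forall w, V w -> pderive v G w = (pderive v F w)^*%R.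
Proof.
move=> oV dF FG w Vw; apply: pder_pderive.
have := cder_conj (pderivable_pder (dF w Vw)); apply: cder_near.
have := @real_line_near _ v w V (open_nbhs_nbhs (conj oV Vw)).
by apply: filterS => t Vt; rewrite /real_line FG.
Qed.

(** The difference of the two mixed partial derivatives is kept as a term; [mixed_hermitian] and
    [curvature_mjet] dispose of it. *)
Lemma fjet_smooth2 (V : set C) F z : open V -> V z -> Ck_on 2 V F ->
  fjet (d_z F) z (d_z (d_z F) z) (d_zbar (d_z F) z) /\
  d_zbar (d_z F) z = (pderive 1 (pderive 1 F) z + pderive ii (pderive ii F) z +
     ii * (pderive ii (pderive 1 F) z - pderive 1 (pderive ii F) z)) / 4.
Proof.
move=> oV Vz [_ H]; have [d1 [_ D1]] := H 1 (or_introl erefl).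
have [d2 [_ D2]] := H ii (or_intror erefl).
have pd v v' : v = 1 \/ v = ii -> v' = 1 \/ v' = ii ->
    pder v' (pderive v F) z (pderive v' (pderive v F) z).
  move=> hv hv'; apply: pderivable_pder.
  by case: hv => ->; [case: (D1 v' hv')|case: (D2 v' hv')] => + _; apply.
have l v' : v' = 1 \/ v' = ii -> pder v' (d_z F) z
    ((pderive v' (pderive 1 F) z - ii * pderive v' (pderive ii F) z) / 2).
  move=> hv'; have h1 := pd _ _ (or_introl erefl) hv'; have h2 := pd _ _ (or_intror erefl) hv'.
  have := cderM (cderD h1 (cderN (cderM (cder_cst ii 0) h2))) (cder_cst (2^-1) 0).
  move: (pderive _ _ _) (pderive _ _ _) => p q h.
  by apply: (cder_eq h); rewrite mul0r add0r mulr0 addr0.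
have e1 := pder_pderive (l 1 (or_introl erefl)).
have e2 := pder_pderive (l ii (or_intror erefl)).
have E : d_zbar (d_z F) z = (pderive 1 (pderive 1 F) z + pderive ii (pderive ii F) z +
     ii * (pderive ii (pderive 1 F) z - pderive 1 (pderive ii F) z)) / 4.
  rewrite /d_zbar e1 e2.
  move: (pderive 1 (pderive 1 F) z) (pderive ii (pderive ii F) z)
    (pderive ii (pderive 1 F) z) (pderive 1 (pderive ii F) z) => p q r s.
  apply/eqP; rewrite -subr_eq0; set L := (X in X == 0).
  have -> : L = (1 + ii * ii) * (- q / 4) by rewrite /L; field.
  by rewrite ii2 subrr mul0r.
split; last exact: E.
exists (pderive 1 (d_z F) z), (pderive ii (d_z F) z); split; [| |exact: erefl|exact: erefl].
  by rewrite e1; exact: (l 1 (or_introl erefl)).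
by rewrite e2; exact: (l ii (or_intror erefl)).
Qed.

(** For conjugate functions the mixed terms carry opposite signs after conjugation and cancel. The
    pair in view is formed by opposite entries of a Hermitian matrix. *)
Lemma mixed_hermitian (V : set C) F G z : open V -> V z -> Ck_on 2 V F -> Ck_on 2 V G ->
  (forall w, V w -> G w = (F w)^*%R) ->
  d_zbar (d_z F) z + (d_zbar (d_z G) z)^*%R =
  2 * ((pderive 1 (pderive 1 F) z + pderive ii (pderive ii F) z) / 4).
Proof.
move=> oV Vz kF kG FG.
have [_ ->] := fjet_smooth2 oV Vz kF; have [_ ->] := fjet_smooth2 oV Vz kG.
move: kF => [_ H]; have [d1 [_ D1]] := H 1 (or_introl erefl).
have [d2 [_ D2]] := H ii (or_intror erefl).
have E v : v = 1 \/ v = ii -> forall w, V w -> pderive v G w = (pderive v F w)^*%R.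
  by case=> -> w Vw; apply: (pderive_conj oV) Vw.
have EE v v' : v = 1 \/ v = ii -> v' = 1 \/ v' = ii ->
    pderive v' (pderive v G) z = (pderive v' (pderive v F) z)^*%R.
  move=> hv hv'; apply: (pderive_conj oV) Vz; last exact: E.
  by case: hv => ->; [case: (D1 v' hv')|case: (D2 v' hv')].
have l1 : (1 : C) = 1 \/ (1 : C) = ii by left.
have l2 : ii = 1 \/ ii = ii by right.
rewrite (EE _ _ l1 l1) (EE _ _ l2 l2) (EE _ _ l1 l2) (EE _ _ l2 l1).
clear.
move: (pderive 1 (pderive 1 F) z) (pderive ii (pderive ii F) z)
  (pderive ii (pderive 1 F) z) (pderive 1 (pderive ii F) z) => p q r s.
have cc (x : C) : ((x^*)^*)%R = x by exact: conjCK.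
by rewrite cjM cjD cjM cjB cjD cjV cjn conj_ii !cc; field.
Qed.

Section Curvature.
Variables (n : nat) (V : set C) (H : C -> 'M[C]_n) (z : C).
Hypotheses (oV : open V) (Vz : V z) (kH : forall a b, Ck_on 2 V (fun w => H w a b))
  (pH : forall w, V w -> posdef (H w)).

Lemma posdef_near_unit : \forall w \near z, H w \in unitmx.
Proof. by near=> w; apply: posdef_unit; apply: pH; near: w; exact: open_nbhs_nbhs.
Unshelve. all: by end_near. Qed.

Lemma metric_jet : exists H1 H2 H3 K1 K2 K3,
  [/\ mjet H z H1 H2 H3, mjet (fun w => invmx (H w)) z K1 K2 K3,
      H2 = H1 ^t*, H1 = Defs.derive_mx (@d_z R) H z &
      Defs.derive_mx (@d_zbar R) (Defs.derive_mx (@d_z R) H) z +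
        (Defs.derive_mx (@d_zbar R) (Defs.derive_mx (@d_z R) H) z) ^t* = H3 + H3].
Proof.
have J a b := jet_smooth oV Vz (kH a b).
have [K1 [K2 [K3 JK]]] : exists A B L, mjet (fun w => invmx (H w)) z A B L.
  apply: mjet_inv; last exact: posdef_near_unit.
  by move=> i j; do 3 eexists; exact: J.
pose H1 := Defs.derive_mx (@d_z R) H z.
pose H2 := Defs.derive_mx (@d_zbar R) H z.
pose H3 := \matrix_(a, b) ((pderive 1 (pderive 1 (fun w => H w a b)) z +
  pderive ii (pderive ii (fun w => H w a b)) z) / 4).
have JH : mjet H z H1 H2 H3 by move=> a b; rewrite !mxE; exact: J.
have herm w a b : V w -> H w b a = (H w a b)^*%R.
  by move=> Vw; rewrite -{1}(pH Vw).1 !mxE.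
exists H1, H2, H3, K1, K2, K3; split=> //.
  have nV := open_nbhs_nbhs (conj oV Vz).
  have [] // := mjet_uniq JH (mjet_near (G := H) _ (mjet_ct JH)).
  by apply: filterS nV => w /pH[].
apply/matrixP => a b; rewrite !mxE.
have -> : (fun w => Defs.derive_mx (@d_z R) H w a b) = d_z (fun w => H w a b).
  by apply/funext => w; rewrite mxE.
have -> : (fun w => Defs.derive_mx (@d_z R) H w b a) = d_z (fun w => H w b a).
  by apply/funext => w; rewrite mxE.
rewrite (mixed_hermitian oV Vz (kH a b) (kH b a)) ?mulr_natl ?mulr2n//.
by move=> w; exact: herm.
Qed.

(** Let Q be the iterated derivative of H, first in z and then in its conjugate. The equation gives
    H X = Q - H2 H^-1 H1. As H X is Hermitian, so is Q, and then the identity for Q plus its adjoint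
    forces Q = H3, the quarter Laplacian: this replaces the symmetry of mixed partial
    derivatives. *)
Lemma curvature_mjet H1 H2 H3 K1 K2 K3 X :
  mjet H z H1 H2 H3 -> mjet (fun w => invmx (H w)) z K1 K2 K3 ->
  H2 = H1 ^t* -> H1 = Defs.derive_mx (@d_z R) H z ->
  Defs.derive_mx (@d_zbar R) (Defs.derive_mx (@d_z R) H) z +
        (Defs.derive_mx (@d_zbar R) (Defs.derive_mx (@d_z R) H) z) ^t* = H3 + H3 ->
  - Defs.derive_mx (@d_zbar R) (fun w => invmx (H w) *m Defs.derive_mx (@d_z R) H w) z + X = 0 ->
  (H z *m X) ^t* = H z *m X ->
  invmx (H z) *m H3 - invmx (H z) *m H2 *m (invmx (H z) *m H1) = X.
Proof.
set Q := Defs.derive_mx (@d_zbar R) (Defs.derive_mx (@d_z R) H) z.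
move=> JH JK H21 H1E QE curv HX.
have uH : H z \in unitmx := posdef_unit (pH Vz).
have KH : \forall w \near z, invmx (H w) *m H w = 1%:M.
  by apply: filterS posdef_near_unit => w; exact: mulVmx.
have [_ K2E _] := mjet_invE JH JK KH.
have DE : Defs.derive_mx (@d_zbar R) (fun w => invmx (H w) *m Defs.derive_mx (@d_z R) H w) z =
    K2 *m H1 + invmx (H z) *m Q.
  apply/matrixP => i j.
  have E : (fun w => (invmx (H w) *m Defs.derive_mx (@d_z R) H w) i j) =
     fun w => \sum_k (invmx (H w)) i k * d_z (fun w => H w k j) w.
    by apply/funext => w; rewrite mxE; apply: eq_bigr => k _; rewrite [X in _ * X]mxE.
  have F k := fjetM (jet_fjet (JK i k)) (fjet_smooth2 oV Vz (kH k j)).1.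
  have {}F := fjet_sum (index_enum 'I_n) F.
  rewrite [LHS]mxE E (fjet_d_zbar F) [RHS]mxE (mxE _ _ i j) [X in _ + X]mxE -big_split.
  apply: eq_bigr => k _; rewrite H1E (mxE _ _ k j) [Q k j]mxE.
  have -> : (fun w => Defs.derive_mx (@d_z R) H w k j) = d_z (fun w => H w k j).
    by apply/funext => w; rewrite mxE.
  by [].
have XE : X = K2 *m H1 + invmx (H z) *m Q.
  by apply/eqP; rewrite -DE eq_sym -subr_eq0 -opprB oppr_eq0 addrC; apply/eqP.
clear DE curv; clearbody Q.
have HXE : H z *m X = Q - H2 *m invmx (H z) *m H1.
  rewrite XE mulmxDr K2E !mulmxA mulmxV// mul1mx mulmxN mulNmx !mulmxA mulmxV// mul1mx.
  by rewrite addrC.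
have Ki : (invmx (H z)) ^t* = invmx (H z).
  by apply: (can_inj (mulKmx uH)); rewrite mulmxV// -{1}(pH Vz).1 -ctM mulVmx// ct1.
have QQ : Q ^t* = Q.
  have : Q = H z *m X + H2 *m invmx (H z) *m H1 by rewrite HXE subrK.
  move=> ->; rewrite ctD HX !ctM Ki H21 trmxCK mulmxA.
  by [].
have Q3 : Q = H3.
  have two0 : (2 : C) != 0 by rewrite pnatr_eq0.
  by apply: (scalerI two0); rewrite !scaler_nat !mulr2n -QE QQ.
rewrite -mulmxA -mulmxBr -Q3 mulmxA -HXE mulKmx//.
Qed.

End Curvature.

End Bochner.

(** * Trace identities behind the Bochner formula *)

Section TraceIdentities.
Variable C : comNzRingType.

Lemma tr3 n (x y z : 'M[C]_n) : \tr (x + y - z) = \tr x + \tr y - \tr z.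
Proof. by rewrite trB trD. Qed.

Lemma tr4 n (x y z w : 'M[C]_n) : \tr (x - y - (z - w)) = \tr x - \tr y - (\tr z - \tr w).
Proof. by rewrite !trB. Qed.

Lemma trace_identity_scalar (A B D F G H p1 p2 p3 p4 p5 p6 q1 q2 q3 q4 q5 q6 : C) :
  p1 = q1 -> p2 = q2 -> p3 = q3 -> p4 = q4 -> p5 = q5 -> p6 = q6 ->
  A + B - D + (F + p1 - p2) - G - H - p3 + p4 + p5 =
  A + B - D + (q4 + p6 - q3) - (G + H - F) + (q5 - q2 - (q6 - q1)).
Proof. by move=> -> -> -> -> -> ->; ring. Qed.

(** The algebra of the Bochner formula, by cyclicity of the trace. Here t is the adjoint of s, while
    a, b, l are H^-1 times the two first derivatives and the quarter Laplacian of H. The right side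
    shows the covariant derivative s1 + [a, s] paired with its adjoint, and l - b a, which is minus
    the curvature coefficient. *)
Lemma trace_identity n (s s1 t t1 a b l : 'M[C]_n) :
  \tr (s1 *m t1) + \tr (s1 *m t *m b) - \tr (s1 *m b *m t)
   + (\tr (s *m a *m b *m t) + \tr (s *m b *m a *m t) - \tr (s *m l *m t))
   - \tr (s *m a *m t1) - \tr (s *m a *m t *m b) - \tr (s *m b *m t *m a)
   + \tr (s *m t1 *m a) + \tr (s *m t *m l) =
  \tr ((s1 + a *m s - s *m a) *m (t1 + t *m b - b *m t)) +
  \tr ((l - b *m a) *m (s *m t - t *m s)).
Proof.
have -> : \tr ((s1 + a *m s - s *m a) *m (t1 + t *m b - b *m t)) =
   \tr (s1 *m t1) + \tr (s1 *m t *m b) - \tr (s1 *m b *m t)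
   + (\tr (a *m s *m t1) + \tr (a *m s *m t *m b) - \tr (a *m s *m b *m t))
   - (\tr (s *m a *m t1) + \tr (s *m a *m t *m b) - \tr (s *m a *m b *m t)).
  by rewrite mulmxBl mulmxDl !mulmxBr !mulmxDr !mulmxA tr3; congr (_ + _ - _); exact: tr3.
have -> : \tr ((l - b *m a) *m (s *m t - t *m s)) =
   \tr (l *m s *m t) - \tr (l *m t *m s) - (\tr (b *m a *m s *m t) - \tr (b *m a *m t *m s)).
  by rewrite mulmxBl !mulmxBr !mulmxA; exact: tr4.
have cyc (x y : 'M[C]_n) : \tr (x *m y) = \tr (y *m x) by exact: mxtrace_mulC.
have e1 : \tr (s *m b *m a *m t) = \tr (b *m a *m t *m s) by rewrite -!mulmxA cyc !mulmxA.
have e2 : \tr (s *m l *m t) = \tr (l *m t *m s) by rewrite -!mulmxA cyc !mulmxA.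
have e3 : \tr (s *m b *m t *m a) = \tr (a *m s *m b *m t) by rewrite cyc !mulmxA.
have e4 : \tr (s *m t1 *m a) = \tr (a *m s *m t1) by rewrite cyc !mulmxA.
have e5 : \tr (s *m t *m l) = \tr (l *m s *m t) by rewrite cyc !mulmxA.
have e6 : \tr (a *m s *m t *m b) = \tr (b *m a *m s *m t) by rewrite cyc !mulmxA.
exact: (trace_identity_scalar _ _ _ _ _ _ e1 e2 e3 e4 e5 e6).
Qed.

Lemma tr_expand n (x1 x2 x3 x4 x5 x6 x7 x8 x9 y1 y2 : 'M[C]_n) :
  \tr (- x3 + (x4 + x5 - x6) + (x1 + x2 - (x7 + x8) - x9) + (y1 + y2)) =
  \tr x1 + \tr x2 - \tr x3 + (\tr x4 + \tr x5 - \tr x6) - \tr x7 - \tr x8 - \tr x9 +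
  \tr y1 + \tr y2.
Proof.
have trN (x : 'M[C]_n) : \tr (- x) = - \tr x by exact: raddfN.
rewrite !(trB, trD, trN).
by move: (\tr x1) (\tr x2) (\tr x3) (\tr x4) (\tr x5) (\tr x6) (\tr x7) (\tr x8) (\tr x9)
  (\tr y1) (\tr y2) => *; ring.
Qed.

(** The left-hand sides have literally the shape that [mjetM] produces for the product of s, H^-1,
    the conjugate transpose of s, and H; the zeros are the derivatives that vanish because s is
    holomorphic. *)
Lemma jet_norm_algebra n (H0 K S S1 s0 s1 a b l : 'M[C]_n) :
  let K1 := - (a *m K) in let K2 := - (b *m K) in let K3 := (a *m b + b *m a - l) *m K in
  let t := K *m S *m H0 in let t1 := K *m S1 *m H0 in
  \tr ((s1 *m K + s0 *m K1) *m (S *m H0) + s0 *m K *m (0 *m H0 + S *m (H0 *m a))) =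
    \tr ((s1 + a *m s0 - s0 *m a) *m t) /\
  \tr ((0 *m K + (s1 *m K2 + 0 *m K1) + s0 *m K3) *m (S *m H0) +
    ((s1 *m K + s0 *m K1) *m (S1 *m H0 + S *m (H0 *m b)) +
     (0 *m K + s0 *m K2) *m (0 *m H0 + S *m (H0 *m a))) +
     s0 *m K *m (0 *m H0 + (0 *m (H0 *m b) + S1 *m (H0 *m a)) + S *m (H0 *m l))) =
  \tr ((s1 + a *m s0 - s0 *m a) *m (t1 + t *m b - b *m t)) +
  \tr ((l - b *m a) *m (s0 *m t - t *m s0)).
Proof.
move=> K1 K2 K3 t t1; rewrite !mul0mx !add0r addr0; split.
  have -> : (s1 *m K + s0 *m K1) *m (S *m H0) + s0 *m K *m (S *m (H0 *m a)) =
     s1 *m t - s0 *m a *m t + s0 *m t *m a.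
    by rewrite /K1 mulmxN mulmxBl /t !mulmxA.
  have -> : (s1 + a *m s0 - s0 *m a) *m t = s1 *m t + a *m s0 *m t - s0 *m a *m t.
    by rewrite mulmxBl mulmxDl.
  have cy : \tr (s0 *m t *m a) = \tr (a *m s0 *m t) by rewrite mxtrace_mulC mulmxA.
  by rewrite tr3 trD trB cy addrAC.
rewrite -trace_identity -tr_expand; congr (\tr (_ + (_ + _) + _)).
- rewrite /K2 /K3 mulmxN mulmxDl mulNmx /t; congr (- _ + _); first by rewrite !mulmxA.
  have -> : s0 *m ((a *m b + b *m a - l) *m K) *m (S *m H0) =
    s0 *m (a *m b + b *m a - l) *m (K *m S *m H0) by rewrite !mulmxA.
  by rewrite mulmxBr mulmxDr mulmxBl mulmxDl !mulmxA.
- rewrite /K1 mulmxN mulmxBl !mulmxDr /t /t1 !mulmxA.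
  by [].
- by rewrite /K2 mulmxN mulNmx /t !mulmxA.
- by rewrite mulmxDr /t /t1 !mulmxA.
Qed.

Lemma commutators_scalar (p q u v : C) : p - q - (u - v) = v - q - (u - p).
Proof. by ring. Qed.

(** For b and t the adjoints of B and s, this turns the curvature term tr([B, b] [s, t]) into the
    squared norm of [B, t] ([tr_bracket_comm]): this is where it matters that s commutes with the
    Higgs field. *)
Lemma tr_commutators n (B b s t : 'M[C]_n) : B *m s = s *m B -> t *m b = b *m t ->
  \tr ((B *m b - b *m B) *m (s *m t - t *m s)) =
  \tr ((B *m t - t *m B) *m (s *m b - b *m s)).
Proof.
move=> Bs tb.
have ex (x y u v : 'M[C]_n) : \tr ((x - y) *m (u - v)) =
    \tr (x *m u) - \tr (x *m v) - (\tr (y *m u) - \tr (y *m v)).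
  by rewrite mulmxBl (mulmxBr x) (mulmxBr y) trB (trB (x *m u)) (trB (y *m u)).
rewrite !ex !mulmxA.
have cyc (x y : 'M[C]_n) : \tr (x *m y) = \tr (y *m x) by exact: mxtrace_mulC.
have e1 : \tr (B *m t *m s *m b) = \tr (b *m B *m t *m s).
  by rewrite (cyc (B *m t *m s)) !mulmxA.
have e2 : \tr (t *m B *m b *m s) = \tr (B *m b *m s *m t).
  by rewrite -(mulmxA t) -(mulmxA t) (cyc t).
have e3 : B *m t *m b *m s = B *m b *m t *m s by rewrite -(mulmxA B t) tb mulmxA.
have e4 : \tr (t *m B *m s *m b) = \tr (b *m B *m s *m t).
  have -> : \tr (t *m B *m s *m b) = \tr (s *m B *m b *m t).
    by rewrite -(mulmxA t B) Bs -(mulmxA t) (cyc t).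
  by rewrite -(mulmxA _ b t) -tb mulmxA (cyc _ b) -(mulmxA b B) Bs !mulmxA.
by rewrite e1 e2 e3 e4; exact: commutators_scalar.
Qed.

End TraceIdentities.

(** * The second-order expansion of the squared norm of a section of End E *)

Section NormJets.
Variable R : realType.
Notation C := (Cx R).

Section BochnerInequality.
Variables (n : nat) (V : set C) (H : C -> 'M[C]_n) (z : C).
Hypotheses (oV : open V) (Vz : V z) (kH : forall a b, Ck_on 2 V (fun w => H w a b))
  (pH : forall w, V w -> posdef (H w)).

(** D is the (1,0)-part of the Chern covariant derivative of s and m is minus the curvature
    coefficient: the quarter Laplacian of |s|^2 is |D|^2 plus a curvature term. *)
Lemma jet_norm (s : C -> 'M[C]_n) s1 H1 H2 H3 K1 K2 K3 :
  mjet s z s1 0 0 ->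
  mjet H z H1 H2 H3 -> mjet (fun w => invmx (H w)) z K1 K2 K3 -> H2 = H1 ^t* ->
  let K := invmx (H z) in let a := K *m H1 in let m := K *m H3 - K *m H2 *m a in
  let t := adj (H z) (s z) in let D := s1 + a *m s z - s z *m a in
  exists b, jet (fun w => \tr (s w *m adj (H w) (s w))) z (\tr (D *m t)) b
    ((hn (H z) D)%:C + \tr (m *m (s z *m t - t *m s z))).
Proof.
move=> Js JH JK H21 K a m t D.
have uH : H z \in unitmx := posdef_unit (pH Vz).
have KH : \forall w \near z, invmx (H w) *m H w = 1%:M.
  by apply: filterS (posdef_near_unit oV Vz pH) => w; exact: mulVmx.
have [K1E K2E K3E] := mjet_invE JH JK KH.
have Ki : K ^t* = K.
  by apply: (can_inj (mulKmx uH)); rewrite mulmxV// -{1}(pH Vz).1 -ctM mulVmx// ct1.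
have HK : H z *m K = 1%:M by rewrite mulmxV.
have Jct := mjet_ct Js; rewrite trmx0 map_mx0 in Jct.
have J := jet_tr (mjetM (mjetM Js JK) (mjetM Jct JH)).
pose b := K *m H2; pose l := K *m H3; pose t1 := K *m s1 ^t* *m H z.
have [A1 A3] := jet_norm_algebra (H z) K ((s z) ^t*) (s1 ^t*) (s z) s1 a b l.
have h1 : H z *m a = H1 by rewrite /a mulmxA HK mul1mx.
have h2 : H z *m b = H2 by rewrite /b mulmxA HK mul1mx.
have h3 : H z *m l = H3 by rewrite /l mulmxA HK mul1mx.
have adjD : adj (H z) D = t1 + t *m b - b *m t.
  rewrite /adj /D ctB ctD !ctM Ki -H21 -/K mulmxBr mulmxDr mulmxBl mulmxDl /t1.
  congr (_ + _ - _).
    by rewrite /t /b /adj -/K !mulmxA -(mulmxA _ (H z) K) HK mulmx1 -(mulmxA _ K (H z))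
     (mulmx1C HK) mulmx1.
  by rewrite /t /b /adj -/K !mulmxA.
have k1 : - (a *m K) = K1 by exact: esym K1E.
have k2 : - (b *m K) = K2 by exact: esym K2E.
have k3 : (a *m b + b *m a - l) *m K = K3 by rewrite K3E.
rewrite k1 h1 in A1; rewrite k1 k2 k3 h1 h2 h3 in A3.
have B1 : \tr (D *m t) = \tr ((s1 + a *m s z - s z *m a) *m (K *m (s z) ^t* *m H z)) by [].
have B3 : (hn (H z) D)%:C + \tr (m *m (s z *m t - t *m s z)) =
  \tr ((s1 + a *m s z - s z *m a) *m
      (K *m s1 ^t* *m H z + K *m (s z) ^t* *m H z *m b - b *m (K *m (s z) ^t* *m H z))) +
  \tr ((l - b *m a) *m (s z *m (K *m (s z) ^t* *m H z) - K *m (s z) ^t* *m H z *m s z)).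
  by rewrite -(hnE (pH Vz)) adjD.
have FE : \forall w \near z, \tr (s w *m invmx (H w) *m ((s w) ^t* *m H w)) =
    \tr (s w *m adj (H w) (s w)) by apply: filterE => w; rewrite /adj !mulmxA.
by eexists; exact: (jet_eq (jet_near FE J) (etrans A1 (esym B1)) erefl
  (etrans A3 (esym B3))).
Qed.

End BochnerInequality.

End NormJets.

(** * The Bochner inequality under Hitchin's equation *)

Section BochnerFormula.
Variable R : realType.
Notation C := (Cx R).

Lemma adjM n (H X Y : 'M[C]_n) : posdef H -> adj H (X *m Y) = adj H Y *m adj H X.
Proof.
move=> pH; have uH := posdef_unit pH.
by rewrite /adj ctM !mulmxA mulmxK.
Qed.

Lemma adjB n (H X Y : 'M[C]_n) : adj H (X - Y) = adj H X - adj H Y.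
Proof. by rewrite /adj ctB mulmxBr mulmxBl. Qed.

Lemma adj_bracket n (H B : 'M[C]_n) : posdef H ->
  adj H (B *m adj H B - adj H B *m B) = B *m adj H B - adj H B *m B.
Proof. by move=> pH; rewrite adjB (adjM B) // (adjM (adj H B) B)// adjK. Qed.

Lemma selfadj_herm n (H X : 'M[C]_n) : posdef H -> adj H X = X -> (H *m X) ^t* = H *m X.
Proof.
move=> pH XX; have uH := posdef_unit pH.
by rewrite ctM pH.1 -{2}XX /adj !mulmxA mulmxV// mul1mx.
Qed.

Lemma tr_bracket_self n (H B : 'M[C]_n) : posdef H ->
  let X := B *m adj H B - adj H B *m B in complex.Re (\tr (X *m X)) = hn H X.
Proof. by move=> pH X; congr (complex.Re (\tr (X *m _))); rewrite /X adj_bracket. Qed.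

Lemma tr_bracket_comm n (H B s : 'M[C]_n) : posdef H -> B *m s = s *m B ->
  complex.Re (\tr ((B *m adj H B - adj H B *m B) *m (s *m adj H s - adj H s *m s))) =
  hn H (B *m adj H s - adj H s *m B).
Proof.
move=> pH Bs; rewrite /hn.
have aY : adj H (B *m adj H s - adj H s *m B) = s *m adj H B - adj H B *m s.
  by rewrite adjB (adjM B (adj H s) pH) (adjM (adj H s) B pH) (adjK pH s).
rewrite aY {aY}; have := congr1 (adj H) Bs; rewrite (adjM B s pH) (adjM s B pH) => tb.
exact: (congr1 (@complex.Re R) (tr_commutators Bs tb)).
Qed.

Section Inequality.
Variables (n : nat) (V : set C) (H : C -> 'M[C]_n) (z : C).
Hypotheses (oV : open V) (Vz : V z) (kH : forall a b, Ck_on 2 V (fun w => H w a b))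
  (pH : forall w, V w -> posdef (H w)).

Lemma jet_norm_curvature (s : C -> 'M[C]_n) s1 H1 H2 H3 K1 K2 K3 m :
  mjet s z s1 0 0 ->
  mjet H z H1 H2 H3 -> mjet (fun w => invmx (H w)) z K1 K2 K3 -> H2 = H1 ^t* ->
  invmx (H z) *m H3 - invmx (H z) *m H2 *m (invmx (H z) *m H1) = m ->
  exists D b, jet (fun w => \tr (s w *m adj (H w) (s w))) z (\tr (D *m adj (H z) (s z))) b
    ((hn (H z) D)%:C + \tr (m *m (s z *m adj (H z) (s z) - adj (H z) (s z) *m s z))).
Proof. by move=> Js JH JK H21 <-; eexists; exact: (jet_norm oV Vz pH Js JH JK H21). Qed.

Lemma bochner_scalar (P h k : R) (w : C) : P <= h * k ->
  P + k * complex.Re w <= k * complex.Re (h%:C + w).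
Proof. by rewrite Re_add /= mulrDr lerD2r mulrC. Qed.

(** The derivative p is the pairing of D with s, so Cauchy-Schwarz absorbs its square into |D|^2
    |s|^2. Multiplied through by |s|^2, the estimate is one for the Laplacian of log |s|^2 that
    avoids logarithms and zeros of s. *)
Lemma bochner (s : C -> 'M[C]_n) (B : 'M[C]_n) :
  (forall a b w, V w -> derivable (fun v => s v a b) w 1) ->
  - Defs.derive_mx (@d_zbar R) (fun w => invmx (H w) *m Defs.derive_mx (@d_z R) H w) z +
    (B *m adj (H z) B - adj (H z) B *m B) = 0 ->
  exists p b q : C, jet (fun w => (hn (H w) (s w))%:C) z p b q /\
    nm p ^+ 2 + hn (H z) (s z) * complex.Re (\tr ((B *m adj (H z) B - adj (H z) B *m B) *m
      (s z *m adj (H z) (s z) - adj (H z) (s z) *m s z))) <= hn (H z) (s z) * complex.Re q.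
Proof.
move=> ds harm; have pHz := pH Vz.
have [H1 [H2 [H3 [K1 [K2 [K3 [JH JK H21 H1E QE]]]]]]] := metric_jet oV Vz kH pH.
have HX := selfadj_herm pHz (adj_bracket B pHz).
have mE := curvature_mjet oV Vz kH pH JH JK H21 H1E QE harm HX.
pose s1 := \matrix_(a, b) ('D_1 (fun v => s v a b) z).
have Js : mjet s z s1 0 0.
  by move=> a b; rewrite !mxE; apply: (jet_holo oV Vz) => w; exact: ds.
have [D [b J]] := jet_norm_curvature Js JH JK H21 mE.
exists (\tr (D *m adj (H z) (s z))), b,
  ((hn (H z) D)%:C + \tr ((B *m adj (H z) B - adj (H z) B *m B) *m
    (s z *m adj (H z) (s z) - adj (H z) (s z) *m s z))).
split.
  apply: jet_near J; have := open_nbhs_nbhs (conj oV Vz).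
  by apply: filterS => w Vw; rewrite (hnE (pH Vw)).
exact: (bochner_scalar _ (hn_CS pHz D (s z))).
Qed.

End Inequality.

End BochnerFormula.

(** * The second derivative test at a local maximum *)

Section MaximumPrinciple.
Variable R : realType.
Notation C := (Cx R).
Notation ii := (ii R).

(** If c were positive, the derivative would be positive just to the right of 0 and the mean value
    theorem would give a value above f 0. *)
Lemma second_derivative_max (f f1 : R -> R) (c : R) :
  (\forall t \near (0 : R), is_derive (t : R) 1 f (f1 t)) -> is_derive (0 : R) 1 f1 c ->
  (\forall t \near (0 : R), f t <= f 0) -> f1 0 = 0 /\ c <= 0.
Proof.
move=> df df1 fmax.
have [d d0 dP] : exists2 d : R, 0 < d & forall t, `|t| < d ->
    is_derive (t : R) 1 f (f1 t) /\ f t <= f 0.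
  have /nbhs_ballP[d /= d0 dP] : \forall t \near (0 : R),
      is_derive (t : R) 1 f (f1 t) /\ f t <= f 0.
    exact: filterI df fmax.
  exists d => // t td.
  by apply: dP; rewrite /ball /= sub0r normrN.
have in_ball (t : R) : t \in `]- d, d[%R -> `|t| < d by rewrite in_itv /= ltr_norml.
have f10 : f1 0 = 0.
  have D0 : is_derive (0 : R) 1 f 0.
    apply: (@derive1_at_max _ f (- d) d).
    - by rewrite ge0_cp// ltW.
    - by move=> t /in_ball/dP[[]].
    - by rewrite in_itv /= oppr_lt0 d0.
    - by move=> t /in_ball/dP[].
  have D1 : is_derive (0 : R) 1 f (f1 0) by case: (dP 0); rewrite ?normr0.
  by have := @derive_val _ _ _ _ _ _ _ D1; rewrite (@derive_val _ _ _ _ _ _ _ D0).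
split=> //; rewrite leNgt; apply/negP => c0.
have [D Dc] := df1.
have {D} : (fun h : R => h^-1 *: ((f1 \o shift 0) (h *: 1) - f1 0)) @ 0^' --> c.
  by rewrite -Dc; exact: D.
move=> /(cvgr_gt c)/(_ 0 c0)/nbhs_ballP[e e0 eP].
pose h := Num.min d e / 2.
have h0 : 0 < h by rewrite divr_gt0// lt_min d0.
have hm : h < Num.min d e by rewrite /h gtr_pMr ?lt_min ?d0//; lra.
have hd : h < d by apply: lt_le_trans hm _; rewrite ge_min lexx.
have he : h < e by apply: lt_le_trans hm _; rewrite ge_min lexx orbT.
have dh (x : R) : 0 <= x <= h -> is_derive (x : R) 1 f (f1 x) /\ f x <= f 0.
  by move=> /andP[x0 xh]; apply: dP; rewrite ger0_norm// (le_lt_trans xh).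
have [||x] := @MVT _ f f1 0 h h0.
- move=> x; rewrite in_itv /= => /andP[x0 xh].
  by case: (dh x); rewrite // !ltW.
- apply: derivable_within_continuous => x; rewrite in_itv /= => xh.
  by have [[]] := dh x xh.
rewrite in_itv /= subr0 => /andP[x0 xh] fE.
have /= := eP x; rewrite /ball /= sub0r normrN gtr0_norm// => /(_ (lt_trans xh he)).
rewrite f10 subr0 [_ *: 1]mulr1 addr0 gt_eqF// => /(_ isT).
rewrite pmulr_rgt0 ?invr_gt0// => f1x.
have := dh h; rewrite ltW// lexx => /(_ isT)[_]; rewrite -subr_le0 fE.
by rewrite leNgt mulr_gt0.
Qed.

Lemma jet1_max (g : R -> R) b c : jet1 (fun t => (g t)%:C) b c ->
  (\forall t \near (0 : R), g t <= g 0) -> b = 0 /\ complex.Re c <= 0.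
Proof.
move=> [g1 [dg <- dg1]] gmax.
have [] := @second_derivative_max g (fun t => complex.Re (g1 t)) (complex.Re c).
- by apply: filterS dg => t [].
- by case: dg1.
- by [].
move=> b0 c0; split=> //; apply: eq_ReIm => //.
have [_ D] := nbhs_singleton dg.
by rewrite -(@derive_val _ _ _ _ _ _ _ D) derive_cst.
Qed.

Lemma jet_max (f : C -> R) z a b l : jet (fun w => (f w)%:C) z a b l ->
  (\forall w \near z, f w <= f z) -> [/\ a = 0, b = 0 & complex.Re l <= 0].
Proof.
move=> [bx [b_y [cx [cy [jx jy -> -> ->]]]]] fmax.
have M v : \forall t \near (0 : R), f (z + t%:C * v) <= f (z + 0%:C * v).
  by have := real_line_near v fmax; apply: filterS => t; rewrite rmorph0 mul0r addr0.
have [-> cx0] := jet1_max (g := fun t => f (z + t%:C * 1)) jx (M 1).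
have [-> cy0] := jet1_max (g := fun t => f (z + t%:C * ii)) jy (M ii).
split; [by rewrite mulr0 subr0 mul0r|by rewrite mulr0 addr0 mul0r|].
have -> : (4 : C)^-1 = (4^-1)%:C by rewrite fmorphV rmorph_nat.
rewrite Re_mul /= mulr0 subr0 pmulr_lle0 ?invr_gt0// Re_add.
by rewrite -[leRHS]addr0 lerD.
Qed.

Lemma cder_exp (h : R -> R) t l : cder (fun t => (h t)%:C) t l ->
  cder (fun t => (expR (h t))%:C) t (l * (expR (h t))%:C).
Proof.
move=> [a b]; split.
  rewrite Re_mul /= mulr0 subr0 mulrC.
  exact: (is_derive1_comp (is_derive_expR (h t)) a).
have Il : complex.Im l = 0 by rewrite -(@derive_val _ _ _ _ _ _ _ b) derive_cst.
by rewrite Im_mul /= mulr0 Il mul0r addr0; exact: is_derive_cst.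
Qed.

Lemma jet1_exp (h : R -> R) b c : jet1 (fun t => (h t)%:C) b c ->
  jet1 (fun t => (expR (h t))%:C) (b * (expR (h 0))%:C) ((c + b * b) * (expR (h 0))%:C).
Proof.
move=> [h1 [dh h10 dh1]]; exists (fun t => h1 t * (expR (h t))%:C); split.
- by apply: filterS dh => t; exact: cder_exp.
- by rewrite h10.
- apply: (cder_eq (cderM dh1 (cder_exp (nbhs_singleton dh)))).
  by rewrite h10; ring.
Qed.

Lemma jet_exp (h : C -> R) z a b l : jet (fun w => (h w)%:C) z a b l ->
  let e := (expR (h z))%:C in
  jet (fun w => (expR (h w))%:C) z (a * e) (b * e) ((l + a * b) * e).
Proof.
move=> [bx [b_y [cx [cy [jx jy -> -> ->]]]]] e.
have := jet1_exp (h := fun t => h (z + t%:C * 1)) jx.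
have := jet1_exp (h := fun t => h (z + t%:C * ii)) jy.
rewrite rmorph0 !mul0r !addr0 -/e => Jy Jx.
do 4 eexists; split; [exact: Jx|exact: Jy|by field|by field|].
apply/eqP; rewrite -subr_eq0; set L := (X in X == 0).
have -> : L = (1 + ii * ii) * (- b_y * b_y * e / 4) by rewrite /L; field.
by rewrite ii2 subrr mul0r.
Qed.

Lemma jet_sqdist (z0 z : C) : jet (fun w => (nm (w - z0) ^+ 2)%:C) z
  ((z - z0)^*)%R (z - z0) 1.
Proof.
have J1 := jetD (jet_id z) (jet_cst (- z0) z).
apply: (@jet_eq _ _ _ _ _ _ _ _ _ (jet_near _ (jetM J1 (jet_conj J1)))).
- by apply: filterE => w; rewrite nm_mulconj.
- by rewrite !addr0 mul1r cj0 mulr0 addr0.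
- by rewrite !addr0 cj1 mul0r add0r mulr1.
- by rewrite !addr0 cj0 cj1 !(mul0r, mulr0, add0r, addr0) mulr1.
Qed.

End MaximumPrinciple.

(** * Two maximum principle estimates at the centre of a disc *)

Section DiscEstimates.
Variable R : realType.
Notation C := (Cx R).
Variables (z0 : C) (rho : R).
Hypothesis rho0 : 0 < rho.

Lemma disc_max (g : C -> R) : (forall z, nm (z - z0) <= rho -> {for z, continuous g}) ->
  exists2 m, nm (m - z0) <= rho & forall z, nm (z - z0) <= rho -> g z <= g m.
Proof.
move=> cg; have [] := @compact_EVT_max _ R g [set w | nm (w - z0) <= rho].
- by exists z0; rewrite /= subrr nm0 ltW.
- exact: closed_disc_compact.
- by apply: continuous_in_subspaceT => z; rewrite inE => /cg.
move=> m; rewrite inE => md H; exists m => // z zd.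
by apply: H; rewrite inE.
Qed.

Lemma near_disc z : nm (z - z0) < rho -> \forall w \near z, nm (w - z0) < rho.
Proof. by move=> zd; have := open_nbhs_nbhs (conj (@open_discC R z0 rho) zd). Qed.

Lemma sqdist_continuous : continuous (fun w : C => nm (w - z0) ^+ 2).
Proof.
move=> z; have c1 : {for z, continuous (fun w : C => nm (w - z0))}.
  have c2 : {for z, continuous (fun w : C => w - z0)}.
    have -> : (fun w : C => w - z0) = id + cst (- z0) by [].
    by apply: derivable_continuous; apply: derivableD; [exact: derivable_id|exact: derivable_cst].
  exact: (continuous_comp c2 (@nm_continuous R _)).
have -> : (fun w : C => nm (w - z0) ^+ 2) = (fun w : C => nm (w - z0) * nm (w - z0)).
  by apply/funext => w; rewrite expr2.
exact: (cvgM c1 c1).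
Qed.

(** The data at a maximum of f u^2: F and U are the values of f and u, W is the position relative to
    the centre, p, b, q belong to the jet of f. The vanishing gradient gives p = 2 F conj(W) / U;
    inserting this in the second-order condition and in the differential inequality leaves an
    inequality between polynomials. *)
Lemma critical_point_algebra (F U kap : R) (p b q W : C) : 0 < F -> 0 < U ->
  p * (U%:C * U%:C) + F%:C * (- W^*%R * U%:C + U%:C * - W^*%R) = 0 ->
  b * (U%:C * U%:C) + F%:C * (- W * U%:C + U%:C * - W) = 0 ->
  complex.Re (q * (U%:C * U%:C) + (p * (- W * U%:C + U%:C * - W) +
    b * (- W^*%R * U%:C + U%:C * - W^*%R)) +
    F%:C * (- 1 * U%:C + (- W^*%R * - W + - W * - W^*%R) + U%:C * - 1)) <= 0 ->
  nm p ^+ 2 + kap * F ^+ 3 <= F * complex.Re q ->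
  kap * (F * U ^+ 2) <= 2 * (nm W ^+ 2 + U).
Proof.
move=> F0 U0 e1 e2 e3 e4.
have UC0 : (U%:C : C) != 0 by rewrite fmorph_eq0 gt_eqF.
have pE : p = (2 * F / U)%:C * W^*%R.
  apply: (mulIf (mulf_neq0 UC0 UC0)); apply/eqP; rewrite -subr_eq0 -[X in _ == X]e1.
  rewrite !rmorphM fmorphV rmorph_nat /=; apply/eqP; by field.
have bE : b = (2 * F / U)%:C * W.
  apply: (mulIf (mulf_neq0 UC0 UC0)); apply/eqP; rewrite -subr_eq0 -[X in _ == X]e2.
  rewrite !rmorphM fmorphV rmorph_nat /=; apply/eqP; by field.
have L : q * (U%:C * U%:C) + (p * (- W * U%:C + U%:C * - W) +
    b * (- W^*%R * U%:C + U%:C * - W^*%R)) +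
    F%:C * (- 1 * U%:C + (- W^*%R * - W + - W * - W^*%R) + U%:C * - 1) =
    (U ^+ 2)%:C * q - (6 * F * nm W ^+ 2 + 2 * F * U)%:C.
  rewrite pE bE; have := nm_mulconj W; move: (nm W ^+ 2) => w nw.
  rewrite expr2 !(rmorphD, rmorphM) /= -nw fmorphV !rmorph1 /=.
  by field.
have np : nm p ^+ 2 = 4 * F ^+ 2 / U ^+ 2 * nm W ^+ 2.
  rewrite pE nmM nm_real nm_conj exprMn -normrX ger0_norm ?sqr_ge0//.
  by congr (_ * _); field; exact: lt0r_neq0.
move: e3; rewrite L Re_add Re_opp Re_mul /= mul0r subr0 subr_le0 => e3.
rewrite np in e4; move: e3 e4; move: (complex.Re q) (nm W ^+ 2) => Q w e3 e4.
have H : 4 * F ^+ 2 * w + kap * F ^+ 3 * U ^+ 2 <= F * (6 * F * w + 2 * F * U).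
  apply: le_trans (_ : F * (U ^+ 2 * Q) <= _); last by rewrite ler_pM2l.
  have := ler_wpM2r (ltW (exprn_gt0 2 U0)) e4.
  have -> : F * (U ^+ 2 * Q) = F * Q * U ^+ 2 by ring.
  have -> : (4 * F ^+ 2 / U ^+ 2 * w + kap * F ^+ 3) * U ^+ 2 =
    4 * F ^+ 2 * w + kap * F ^+ 3 * U ^+ 2 by field; exact: lt0r_neq0.
  by [].
have F2 : 0 < F ^+ 2 by rewrite exprn_gt0.
rewrite -(ler_pM2l F2) -subr_ge0.
have -> : F ^+ 2 * (2 * (w + U)) - F ^+ 2 * (kap * (F * U ^+ 2)) =
  F * (6 * F * w + 2 * F * U) - (4 * F ^+ 2 * w + kap * F ^+ 3 * U ^+ 2) by ring.
by rewrite subr_ge0.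
Qed.

(* The function f (rho^2 - |z - z0|^2)^2 vanishes on the boundary; at an interior
   maximum the second derivative test bounds it. *)
Lemma superlinear_estimate (f : C -> R) (kap K0 : R) : 0 < kap -> 0 <= K0 ->
  (forall z, nm (z - z0) <= rho -> {for z, continuous f}) ->
  (forall z, nm (z - z0) < rho -> exists p b q, jet (fun w => (f w)%:C) z p b q /\
     (K0 <= f z -> nm p ^+ 2 + kap * f z ^+ 3 <= f z * complex.Re q)) ->
  f z0 <= K0 + 2 / (kap * rho ^+ 2).
Proof.
move=> kap0 K00 cf Jf; have r2 : 0 < rho ^+ 2 by rewrite exprn_gt0.
have B0 : 0 < 2 / (kap * rho ^+ 2) by rewrite divr_gt0// mulr_gt0.
pose u w := rho ^+ 2 - nm (w - z0) ^+ 2.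
have uz0 : u z0 = rho ^+ 2 by rewrite /u subrr nm0 expr0n subr0.
pose g w := f w * (u w * u w).
have [z zd gmax] : exists2 m, nm (m - z0) <= rho & forall z, nm (z - z0) <= rho -> g z <= g m.
  apply: disc_max => w wd.
  have cu : {for w, continuous u}.
    exact: (cvgB (@cvg_cst _ _ _ _ _) (@sqdist_continuous w)).
  exact: (cvgM (cf w wd) (cvgM cu cu)).
have u0 : 0 <= u z by rewrite subr_ge0 lerXn2r ?nnegrE ?nm_ge0// ltW.
have ur : u z <= rho ^+ 2 by rewrite gerBl sqr_ge0.
have := gmax z0; rewrite subrr nm0 => /(_ (ltW rho0)); rewrite /g uz0 => gz0.
have [fz0|fz0] := leP (f z0) 0.
  by apply: le_trans fz0 _; rewrite addr_ge0// ltW.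
have gz : 0 < g z by apply: lt_le_trans gz0; rewrite !mulr_gt0//.
have uz : 0 < u z.
  rewrite lt_neqAle u0 andbT eq_sym; apply: contraTneq gz => E.
  by rewrite /g E !mulr0 ltxx.
have fz : 0 < f z by move: gz; rewrite /g pmulr_lgt0// mulr_gt0.
have zd' : nm (z - z0) < rho.
  by move: uz; rewrite subr_gt0 ltr_pXn2r ?nnegrE ?nm_ge0// ltW.
(* The differential inequality is available only above K0; below it, u(z) <= u(z0) = rho^2 already
   gives f z0 <= f z <= K0. *)
have [K1|/ltW K1] := leP (f z) K0.
  apply: le_trans (_ : K0 <= _); last by rewrite lerDl ltW.
  apply: le_trans K1; rewrite -(ler_pM2r (mulr_gt0 r2 r2)).
  by apply: le_trans gz0 _; rewrite ler_pM2l// ler_pM.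
have [p [b [q [Jz /(_ K1) ineq]]]] := Jf z zd'.
have Ju : jet (fun w => (u w)%:C) z (- ((z - z0)^*)%R) (- (z - z0)) (- 1).
  have J1 := jetM (jet_cst (-1) z) (jet_sqdist z0 z).
  apply: (@jet_eq _ _ _ _ _ _ _ _ _ (jet_near _ (jetD (jet_cst (rho ^+ 2)%:C z) J1))).
  - by apply: filterE => w; rewrite /u rmorphB /= mulN1r.
  - by rewrite add0r mul0r add0r mulN1r.
  - by rewrite add0r mul0r add0r mulN1r.
  - by rewrite add0r !mul0r !add0r mulN1r.
have Jg := jetM Jz (jetM Ju Ju).
have gE : \forall w \near z, (f w)%:C * ((u w)%:C * (u w)%:C) = (g w)%:C.
  by apply: filterE => w; rewrite /g !rmorphM.
have {}Jg := jet_near gE Jg.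
have [|E1 E2 E3] := jet_max Jg.
  by apply: filterS (near_disc zd') => w /ltW /gmax.
have := critical_point_algebra fz uz E1 E2 E3 ineq.
(* Thus kap f u^2 <= 2 rho^2 at the maximum, while f u^2 equals f z0 rho^4 at the centre. *)
have -> : nm (z - z0) ^+ 2 + u z = rho ^+ 2 by rewrite /u addrC subrK.
move=> H; apply: le_trans (_ : 2 / (kap * rho ^+ 2) <= _); last by rewrite lerDr.
rewrite ler_pdivlMr ?mulr_gt0// -(ler_pM2r r2); apply: le_trans H.
have -> : f z0 * (kap * rho ^+ 2) * rho ^+ 2 = kap * (f z0 * (rho ^+ 2 * rho ^+ 2)) by ring.
by rewrite ler_pM2l// (expr2 (u z)).
Qed.

(** The comparison function v has quarter Laplacian (kap + kap^2 |z - z0|^2) v <= lam v and equals U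
    on the boundary circle. A positive maximum of psi - v would therefore be interior, and the
    second derivative test would give lam psi <= lam v there. *)
Lemma exponential_decay (psi : C -> R) (lam kap U : R) : 0 < kap -> 0 <= U ->
  kap + kap ^+ 2 * rho ^+ 2 <= lam ->
  (forall z, nm (z - z0) <= rho -> {for z, continuous psi}) ->
  (forall z, nm (z - z0) <= rho -> psi z <= U) ->
  (forall z, nm (z - z0) < rho -> exists p b q, jet (fun w => (psi w)%:C) z p b q /\
     lam * psi z <= complex.Re q) ->
  psi z0 <= U * expR (- (kap * rho ^+ 2)).
Proof.
move=> kap0 U0 klam cpsi psiU Jpsi.
pose h w := kap * (nm (w - z0) ^+ 2 - rho ^+ 2).
pose v w := U * expR (h w).
have ch : continuous h.
  move=> w.
  exact: (cvgM (@cvg_cst _ _ _ _ _) (cvgB (@sqdist_continuous w) (@cvg_cst _ _ _ _ _))).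
have cv : continuous v.
  move=> w; have ce : {for w, continuous (fun w => expR (h w))}.
    exact: (@continuous_comp _ _ _ h (@expR R) w (ch w) (@continuous_expR R (h w))).
  exact: (cvgM (@cvg_cst _ _ _ _ _) ce).
have [z zd gmax] : exists2 m, nm (m - z0) <= rho &
    forall z, nm (z - z0) <= rho -> psi z - v z <= psi m - v m.
  by apply: (@disc_max (fun w => psi w - v w)) => w wd; exact: (cvgB (cpsi w wd) (cv w)).
have vz0 : v z0 = U * expR (- (kap * rho ^+ 2)).
  by rewrite /v /h subrr nm0 expr0n sub0r mulrN.
rewrite -vz0 -subr_le0; apply: le_trans (gmax z0 _) _.
  by rewrite subrr nm0 ltW.
have [//|zr] := leP (psi z - v z) 0; exfalso.
have v0 : 0 <= v z by rewrite mulr_ge0// expR_ge0.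
have zd' : nm (z - z0) < rho.
  rewrite lt_neqAle zd andbT; apply: contraTneq zr => E; rewrite -leNgt subr_le0.
  by rewrite /v /h E subrr mulr0 expR0 mulr1 psiU// E.
have [p [b [q [Jz Hq]]]] := Jpsi z zd'.
have Jh : jet (fun w => (h w)%:C) z (kap%:C * ((z - z0)^*)%R) (kap%:C * (z - z0)) kap%:C.
  have J1 := jetD (jet_sqdist z0 z) (jet_cst (- (rho ^+ 2)%:C) z).
  apply: (@jet_eq _ _ _ _ _ _ _ _ _ (jet_near _ (jetM (jet_cst kap%:C z) J1))).
  - by apply: filterE => w; rewrite /h [RHS]rmorphM [X in _ = _ * X]rmorphB.
  - by rewrite mul0r add0r addr0.
  - by rewrite mul0r add0r addr0.
  - by rewrite !mul0r !add0r !addr0 mulr1.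
have Jv := jetM (jet_cst (- U%:C) z) (jet_exp Jh).
have vE : \forall w \near z, (psi w)%:C + - U%:C * (expR (h w))%:C = (psi w - v w)%:C.
  by apply: filterE => w; rewrite /v rmorphB rmorphM mulNr.
have {}Jv := jet_near vE (jetD Jz Jv).
have [|_ _] := jet_max Jv.
  by apply: filterS (near_disc zd') => w /ltW /gmax.
rewrite !mul0r !add0r; set W := z - z0 in zd zd' *.
have E (V : C) (e : R) : (kap%:C + kap%:C * (V^*)%R * (kap%:C * V)) * e%:C =
    ((kap + kap ^+ 2 * nm V ^+ 2) * e)%:C.
  have := nm_mulconj V; move: (nm V ^+ 2) (V^*)%R => w V' nw.
  by rewrite (expr2 kap) !(rmorphM, rmorphD) /= -nw; ring.
rewrite E {E}.
rewrite mulNr -rmorphM /= Re_add Re_opp /= subr_le0 leNgt => /negP; apply.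
apply: lt_le_trans Hq.
have lam0 : 0 < lam.
  by apply: lt_le_trans klam; rewrite ltr_pwDl// mulr_ge0// sqr_ge0.
apply: le_lt_trans (_ : lam * v z < _); last by rewrite ltr_pM2l// -subr_gt0.
rewrite mulrCA -/(v z) ler_wpM2r//; apply: le_trans klam.
by rewrite lerD2l ler_wpM2l ?sqr_ge0// lerXn2r ?nnegrE ?nm_ge0// ltW.
Qed.

End DiscEstimates.

(** * Matrix operations within a class of functions closed under sums and products *)

Section FunctionAlgebra.
Variables (K : comNzRingType) (T : Type) (P : (T -> K) -> Prop).
Hypotheses (Pc : forall k, P (fun=> k)) (PD : forall f g, P f -> P g -> P (fun w => f w + g w))
  (PM : forall f g, P f -> P g -> P (fun w => f w * g w)).

Lemma alg_sum (I : Type) (r : seq I) (Q : pred I) (F : I -> T -> K) : (forall i, P (F i)) ->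
  P (fun w => \sum_(i <- r | Q i) F i w).
Proof.
move=> PF; elim: r => [|i r IH].
  by rewrite (_ : (fun w => _) = fun=> 0)//; apply/funext => w; rewrite big_nil.
case Qi : (Q i); last first.
  by have := IH; congr P; apply/funext => w; rewrite big_cons Qi.
by have := PD (PF i) IH; congr P; apply/funext => w; rewrite big_cons Qi.
Qed.

Lemma alg_prod (I : Type) (r : seq I) (Q : pred I) (F : I -> T -> K) : (forall i, P (F i)) ->
  P (fun w => \prod_(i <- r | Q i) F i w).
Proof.
move=> PF; elim: r => [|i r IH].
  by rewrite (_ : (fun w => _) = fun=> 1)//; apply/funext => w; rewrite big_nil.
case Qi : (Q i); last first.
  by have := IH; congr P; apply/funext => w; rewrite big_cons Qi.
by have := PM (PF i) IH; congr P; apply/funext => w; rewrite big_cons Qi.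
Qed.

Definition alg_mx m n (A : T -> 'M[K]_(m, n)) := forall i j, P (fun w => A w i j).

Lemma alg_det n (A : T -> 'M[K]_n) : alg_mx A -> P (fun w => \det (A w)).
Proof.
move=> PA; apply: alg_sum => s; apply: PM => //; apply: alg_prod => k; exact: PA.
Qed.

Lemma alg_mulmx m n p (A : T -> 'M[K]_(m, n)) (B : T -> 'M[K]_(n, p)) :
  alg_mx A -> alg_mx B -> alg_mx (fun w => A w *m B w).
Proof.
move=> PA PB i j; have : P (fun w => \sum_k A w i k * B w k j).
  by apply: alg_sum => k; apply: PM.
by congr P; apply/funext => w; rewrite mxE.
Qed.

Lemma alg_tr n (A : T -> 'M[K]_n) : alg_mx A -> P (fun w => \tr (A w)).
Proof. by move=> PA; apply: alg_sum => i; exact: PA. Qed.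

Lemma alg_sub_scalar n (A : T -> 'M[K]_n) d : alg_mx A -> P d ->
  alg_mx (fun w => A w - (d w)%:M).
Proof.
move=> PA Pd i j; have : P (fun w => A w i j + (- 1) * (d w *+ (i == j))).
  apply: PD => //; apply: PM => //.
  case: (i == j); [exact: Pd|exact: (Pc 0)].
by congr P; apply/funext => w; rewrite !mxE mulN1r.
Qed.

End FunctionAlgebra.

(** * Continuity and holomorphy of matrix expressions *)

Section MatrixFunctions.
Variable R : realType.
Notation C := (Cx R).

Definition cont_at (z : C) (F : C -> C) := {for z, continuous F}.
Definition holo_on (V : set C) (F : C -> C) := forall w, V w -> derivable F w 1.

Lemma cont_at_cst z k : cont_at z (fun=> k). Proof. exact: (@cst_continuous _ _ k z). Qed.
Lemma cont_atD z f g : cont_at z f -> cont_at z g -> cont_at z (fun w => f w + g w).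
Proof. by move=> cf cg; exact: (cvgD cf cg). Qed.
Lemma cont_atM z f g : cont_at z f -> cont_at z g -> cont_at z (fun w => f w * g w).
Proof. by move=> cf cg; exact: (cvgM cf cg). Qed.

Lemma holo_on_cst V k : holo_on V (fun=> k).
Proof. by move=> w _; exact: derivable_cst. Qed.
Lemma holo_onD V f g : holo_on V f -> holo_on V g -> holo_on V (fun w => f w + g w).
Proof. by move=> hf hg w Vw; exact: (derivableD (hf w Vw) (hg w Vw)). Qed.
Lemma holo_onM V f g : holo_on V f -> holo_on V g -> holo_on V (fun w => f w * g w).
Proof. by move=> hf hg w Vw; exact: (derivableM (hf w Vw) (hg w Vw)). Qed.
Lemma holo_onV V f : holo_on V f -> (forall w, V w -> f w != 0) -> holo_on V (fun w => (f w)^-1).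
Proof. by move=> hf f0 w Vw; exact: (derivableV (f0 w Vw) (hf w Vw)). Qed.

Lemma cont_at_near z f g : (\forall w \near z, f w = g w) -> cont_at z f -> cont_at z g.
Proof.
move=> fg; have fgz := nbhs_singleton fg; rewrite /cont_at /prop_for /continuous_at -fgz => cf.
exact: cvg_trans (near_eq_cvg fg) cf.
Qed.

Lemma cont_invmx n (H : C -> 'M[C]_n) z : alg_mx (cont_at z) H ->
  (\forall w \near z, H w \in unitmx) -> alg_mx (cont_at z) (fun w => invmx (H w)).
Proof.
move=> cH uH i j.
have cdet m (B : C -> 'M[C]_m) : alg_mx (cont_at z) B -> cont_at z (fun w => \det (B w)).
  exact: (alg_det (@cont_at_cst z) (@cont_atD z) (@cont_atM z)).
have d0 : \det (H z) != 0 by have := nbhs_singleton uH; rewrite unitmxE unitfE.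
have dV : cont_at z (fun w => (\det (H w))^-1) by exact: (cvgV d0 (cdet _ _ cH)).
have cJ : cont_at z (fun w => cofactor (H w) j i).
  apply: cont_atM; first exact: cont_at_cst.
  apply: cdet => k k'; have := cH (lift j k) (lift i k').
  by congr cont_at; apply/funext => w; rewrite !mxE.
apply: cont_at_near (cont_atM dV cJ); apply: filterS uH => w uw.
by rewrite /invmx uw !mxE.
Qed.

Lemma hn_continuous n (H s : C -> 'M[C]_n) z : alg_mx (cont_at z) H ->
  (\forall w \near z, H w \in unitmx) -> alg_mx (cont_at z) s ->
  {for z, continuous (fun w => hn (H w) (s w))}.
Proof.
move=> cH uH cs; have cM := alg_mulmx (@cont_at_cst z) (@cont_atD z) (@cont_atM z).
have cct : alg_mx (cont_at z) (fun w => (s w) ^t*).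
  move=> i j; have c1 : cont_at z (fun w => ((s w j i)^*)%R).
    exact: (continuous_comp (cs j i) (@conjC_continuous R (s z j i))).
  by move: c1; congr cont_at; apply/funext => w; rewrite [RHS]mxE [X in _ = Num.conj X]mxE.
have c1 := cM _ _ _ _ _ (cM _ _ _ _ _ (cont_invmx cH uH) cct) cH.
have c2 := cM _ _ _ _ _ cs c1.
have c : cont_at z (fun w => \tr (s w *m adj (H w) (s w))).
  exact: (alg_tr (@cont_at_cst z) (@cont_atD z) c2).
exact: (continuous_comp c (@Re_continuous R _)).
Qed.

Lemma lagr_holo n (V : set C) (A : C -> 'M[C]_n.+1) (d : 'I_n.+1 -> C -> C) i :
  alg_mx (holo_on V) A -> (forall j, holo_on V (d j)) ->
  (forall w, V w -> injective (d^~ w)) ->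
  alg_mx (holo_on V) (fun w => lagr (A w) (d^~ w) i).
Proof.
move=> hA hd dinj.
have PP : forall r : seq 'I_n.+1,
    alg_mx (holo_on V) (fun w => \prod_(j <- r | j != i) (A w - (d j w)%:M)).
  elim=> [|j r IH] a b.
    have := @holo_on_cst V ((1 : 'M[C]_n.+1) a b).
    by congr holo_on; apply/funext => w; rewrite big_nil.
  case ji : (j != i); last first.
    by have := IH a b; congr holo_on; apply/funext => w; rewrite big_cons ji.
  have := alg_mulmx (@holo_on_cst V) (@holo_onD V) (@holo_onM V)
    (alg_sub_scalar (@holo_on_cst V) (@holo_onD V) (@holo_onM V) hA (hd j)) IH a b.
  by congr holo_on; apply/funext => w; rewrite big_cons ji.
have h1 : holo_on V (fun w => (\prod_(j | j != i) (d i w - d j w))^-1).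
  apply: holo_onV => [|w Vw].
    apply: (alg_prod (@holo_on_cst V) (@holo_onM V)) => j.
    by move=> w Vw; exact: (derivableB (hd i w Vw) (hd j w Vw)).
  apply/prodf_neq0 => j ji; rewrite subr_eq0; apply: contra ji => /eqP/(dinj w Vw) ->.
  by [].
move=> a b; have := holo_onM h1 (PP (index_enum _) a b).
by congr holo_on; apply/funext => w; rewrite /lagr mxE.
Qed.

End MatrixFunctions.

(** * Estimates on a disc over which the eigenvalues have holomorphic branches *)

Section LocalEstimates.
Variable R : realType.
Notation C := (Cx R).

Lemma adj_scale n (H X : 'M[C]_n) (k : R) : adj H (k%:C *: X) = k%:C *: adj H X.
Proof. by rewrite /adj ctZ conj_real -scalemxAr -scalemxAl. Qed.

Lemma hn_scale n (H X : 'M[C]_n) (k : R) : hn H (k%:C *: X) = k ^+ 2 * hn H X.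
Proof.
rewrite /hn adj_scale -scalemxAl -scalemxAr scalerA mxtraceZ -rmorphM Re_mul /=.
by rewrite mul0r subr0 expr2.
Qed.

Lemma eigenvalue_scale n (A : 'M[C]_n) (t : R) a : 0 < t ->
  eigenvalue (t%:C *: A) a -> eigenvalue A (t^-1%:C * a).
Proof.
move=> t0 /eigenvalueP[v vA v0]; apply/eigenvalueP; exists v => //.
rewrite -scalerA -vA -scalemxAr scalerA -rmorphM /= mulVf ?gt_eqF//.
by rewrite scale1r.
Qed.

Definition hitchin_at n (H B : C -> 'M[C]_n) (z : C) :=
  - Defs.derive_mx (@d_zbar R) (fun w => invmx (H w) *m Defs.derive_mx (@d_z R) H w) z +
    (B z *m adj (H z) (B z) - adj (H z) (B z) *m B z) = 0.

Definition bracket n (H A : 'M[C]_n) := A *m adj H A - adj H A *m A.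

Lemma hn_holo_continuous n (U : set C) (H s : C -> 'M[C]_n) z : open U ->
  (forall a b, Ck_on 2 U (fun w => H w a b)) -> (forall w, U w -> posdef (H w)) ->
  alg_mx (holo_on U) s -> U z -> {for z, continuous (fun w => hn (H w) (s w))}.
Proof.
move=> oU kH pH hs Uz; apply: hn_continuous.
- by move=> i j; have [c _] := kH i j; exact: c.
- exact: (posdef_near_unit oU Uz pH).
- by move=> i j; exact: (derivable_continuous (hs i j z Uz)).
Qed.

Lemma continuous_near (f g : C -> R) z : (\forall w \near z, f w = g w) ->
  {for z, continuous f} -> {for z, continuous g}.
Proof.
move=> fg; have fgz := nbhs_singleton fg; rewrite /prop_for /continuous_at -fgz => cf.
exact: cvg_trans (near_eq_cvg fg) cf.
Qed.

Section Presented.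
Variables (n : nat) (V : set C) (d : 'I_n.+1 -> C -> C) (t M delta : R).
Variables (f b : C -> R) (phi : 'I_n.+1 -> C -> R).

(* The functions f, b, phi are globally defined on V, but the frames in which
   they are computed may only exist near each point. *)
Definition presented z := exists (U : set C) (H A : C -> 'M[C]_n.+1),
  [/\ open U, U z & U `<=` V] /\
  [/\ forall a b, Ck_on 2 U (fun w => H w a b), forall w, U w -> posdef (H w),
      alg_mx (holo_on U) A & forall w, U w -> hitchin_at H (fun w => t%:C *: A w) w] /\
  forall w, U w -> [/\ f w = hn (H w) (A w), b w = hn (H w) (bracket (H w) (A w)),
    forall i, phi i w = hn (H w) (lagr (A w) (d^~ w) i) &
    forall a, eigenvalue (A w) a <-> exists i, a = d i w].

Hypotheses (hd : forall i, holo_on V (d i)) (delta0 : 0 < delta)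
  (dM : forall w i, V w -> nm (d i w) <= M)
  (sep : forall w i j, V w -> i != j -> delta <= nm (d i w - d j w))
  (t0 : 0 < t) (pres : forall z, V z -> presented z).

(** Let g = t^2 f and let P be the squared norm of the self-commutator of t A. Where g is at least 2
    r (t M)^2, the eigenvalue term of [hn_eigen_bound] is at most g/2, so r^2 sqrt(P) >= g/2 and P
    >= g^2 / (4 r^4): this is the origin of [kap]. *)
Lemma energy_bound z0 (rho : R) : 0 < rho -> 0 <= M ->
  (forall z, nm (z - z0) <= rho -> V z) ->
  t ^+ 2 * f z0 <= 2 * n.+1%:R * (t * M) ^+ 2 + 8 * n.+1%:R ^+ 4 / rho ^+ 2.
Proof.
move=> rho0 M0 dV.
have tM : 0 <= t * M by rewrite mulr_ge0// ltW.
have r0 : 0 < n.+1%:R ^+ 4 :> R by rewrite exprn_gt0// ltr0n.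
set r : R := n.+1%:R in r0 *; pose kap := (4 * r ^+ 4)^-1.
have kap0 : 0 < kap by rewrite invr_gt0 mulr_gt0.
have rp : 0 < r by rewrite /r ltr0n.
have K00 : 0 <= 2 * r * (t * M) ^+ 2 by rewrite !mulr_ge0 ?sqr_ge0 // ltW.
have -> : 8 * r ^+ 4 / rho ^+ 2 = 2 / (kap * rho ^+ 2).
  by rewrite /kap; field; rewrite !gt_eqF.
apply: (superlinear_estimate rho0 (f := fun w => t ^+ 2 * f w) kap0 K00).
  move=> z /dV/pres[U [H [A [[oU Uz _] [[kH pH hA _] F]]]]].
  apply: (@continuous_near (fun w => t ^+ 2 * hn (H w) (A w))).
    by have := open_nbhs_nbhs (conj oU Uz); apply: filterS => w /F[->].
  exact: (cvgM (@cvg_cst _ _ _ _ _) (hn_holo_continuous oU kH pH hA Uz)).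
move=> z /ltW/dV Vz; have [U [H [A [[oU Uz UV] [[kH pH hA harm] F]]]]] := pres Vz.
have hB : alg_mx (holo_on U) (fun w => t%:C *: A w).
  move=> i j; have := holo_onM (@holo_on_cst R U t%:C) (hA i j).
  by congr holo_on; apply/funext => w; rewrite mxE.
have evB a : eigenvalue (t%:C *: A z) a -> nm a <= t * M.
  move=> /(eigenvalue_scale t0); have [_ _ _ ev] := F z Uz; move=> /ev[i E].
  have := @dM z i Vz; rewrite -E nmM nm_real ger0_norm ?invr_ge0 ?(ltW t0)//.
  by rewrite mulrC ler_pdivrMr// mulrC.
have [|p [c [q [J ineq]]]] := bochner oU Uz kH pH (s := fun w => t%:C *: A w)
   (B := t%:C *: A z) _ (harm z Uz).
  by move=> k l w Uw; exact: hB.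
have fE w : U w -> hn (H w) (t%:C *: A w) = t ^+ 2 * f w.
  by move=> /F[-> _ _ _]; rewrite hn_scale.
exists p, c, q; split.
  apply: jet_near J; have := open_nbhs_nbhs (conj oU Uz).
  by apply: filterS => w /fE ->.
move=> K1; rewrite (tr_bracket_self (t%:C *: A z) (pH z Uz)) (fE z Uz) in ineq.
apply: le_trans ineq; rewrite lerD2l.
have := hn_eigen_bound (pH z Uz) tM evB.
have f0 := hn_ge0 (pH z Uz) (t%:C *: A z); rewrite (fE z Uz) in f0 *.
have P0 := hn_ge0 (pH z Uz) (t%:C *: A z *m adj (H z) (t%:C *: A z) -
  adj (H z) (t%:C *: A z) *m (t%:C *: A z)).
move: f0 P0 K1; rewrite -/r; move: (hn _ (_ - _)) (t ^+ 2 * f z) ((t * M) ^+ 2).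
move=> P g m f0 P0 K1 fP.
rewrite exprS mulrCA ler_wpM2l// /kap mulrC ler_pdivrMr ?mulr_gt0//.
have H1 : g / 2 <= r ^+ 2 * Num.sqrt P by lra.
have H2 : (g / 2) ^+ 2 <= (r ^+ 2 * Num.sqrt P) ^+ 2.
  by rewrite lerXn2r ?nnegrE ?mulr_ge0 ?sqrtr_ge0 ?sqr_ge0 ?invr_ge0.
rewrite [in leRHS]exprMn sqr_sqrtr// -exprM expr_div_n ler_pdivrMr ?exprn_gt0// in H2.
by apply: le_trans H2 _; rewrite le_eqVlt; apply/orP; left; apply/eqP; ring.
Qed.

(** The bracket is at most twice |A|^2, and t^2 |A|^2 is bounded by [energy_bound] whose right-hand
    side increases with t. *)
Lemma bracket_small_time z0 (rho : R) : 0 < rho -> 0 <= M ->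
  (forall z, nm (z - z0) <= rho -> V z) -> t <= 1 ->
  t ^+ 2 * Num.sqrt (b z0) <=
  2 * (2 * n.+1%:R * M ^+ 2 + 8 * n.+1%:R ^+ 4 / rho ^+ 2).
Proof.
move=> rho0 M0 dV t1; have Vz : V z0 by apply: dV; rewrite subrr nm0 ltW.
have [U [H [A [[oU Uz UV] [[kH pH hA harm] F]]]]] := pres Vz.
have [fE bE _ _] := F z0 Uz.
have := hn_commutator_upper (pH z0 Uz) (A z0); rewrite -/(bracket _ _) -bE -fE.
have := hn_ge0 (pH z0 Uz) (A z0); rewrite -fE.
move: (energy_bound rho0 M0 dV); move: (b z0) (f z0) => P g tf f0 Pf.
apply: le_trans (_ : t ^+ 2 * (2 * g) <= _).
  rewrite ler_wpM2l ?sqr_ge0// -[leRHS]ger0_norm ?mulr_ge0// -sqrtr_sqr.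
  by rewrite ler_wsqrtr// exprMn -natrX.
rewrite mulrCA ler_pM2l//; apply: le_trans tf _; rewrite lerD2r.
rewrite ler_wpM2l ?mulr_ge0// lerXn2r ?nnegrE ?mulr_ge0 ?(ltW t0)//.
by rewrite ler_piMl.
Qed.

Section Projections.
Variables (z0 : C) (rho a : R).
Hypotheses (rho0 : 0 < rho) (a0 : 0 <= a) (dV : forall z, nm (z - z0) <= rho -> V z)
  (fa : forall z, nm (z - z0) <= rho -> f z <= a ^+ 2).
Local Notation L := (@lagr_const R n a M delta).

Lemma phi_bounds z i : nm (z - z0) <= rho -> 1 <= phi i z <= L ^+ 2.
Proof.
move=> zd; have Vz := dV zd; have [U [H [A [[oU Uz UV] [[kH pH hA harm] F]]]]] := pres Vz.
have [fE _ phE ev] := F z Uz.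
have evd j : eigenvalue (A z) (d j z) by apply/ev; exists j.
have hnA : hn (H z) (A z) <= a ^+ 2 by rewrite -fE fa.
have sepz j k : j != k -> delta <= nm (d j z - d k z) by exact: sep.
have dMz j : nm (d j z) <= M by exact: dM.
rewrite phE (hn_lagr_ge1 (pH z Uz) delta0 evd dMz sepz a0 hnA).
by rewrite (hn_lagr_le (pH z Uz) delta0 evd dMz sepz a0 hnA).
Qed.

(** Apply [bochner] to the projection and discard the gradient term: the Laplacian of phi is at
    least t^2 |[A, adjoint of pi]|^2, which by [hn_lagr_commutator] and phi >= 1 controls phi - 1.
    The summand 1 in the denominator keeps it positive. *)
Lemma projection_decay (kap : R) i : 0 < kap ->
  kap + kap ^+ 2 * rho ^+ 2 <= t ^+ 2 / ((n.+1%:R * (delta^-1 * L)) ^+ 2 + 1) ->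
  phi i z0 - 1 <= L ^+ 2 * expR (- (kap * rho ^+ 2)).
Proof.
move=> kap0 klam.
have dinj w (Vw : V w) : injective (d^~ w).
  exact: (sep_inj delta0 (fun i j => @sep w i j Vw)).
have hs (U : set C) (A : C -> 'M[C]_n.+1) : U `<=` V -> alg_mx (holo_on U) A ->
    alg_mx (holo_on U) (fun w => lagr (A w) (d^~ w) i).
  move=> UV hA; apply: lagr_holo => // [j w /UV Vw|w /UV/dinj//].
  exact: (@hd j).
apply: (exponential_decay rho0 (psi := fun w => phi i w - 1) kap0 _ klam).
- exact: sqr_ge0.
- move=> z zd; have [U [H [A [[oU Uz UV] [[kH pH hA _] F]]]]] := pres (dV zd).
  apply: (@continuous_near (fun w => hn (H w) (lagr (A w) (d^~ w) i) - 1)).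
    by have := open_nbhs_nbhs (conj oU Uz); apply: filterS => w /F[_ _ ->].
  exact: (cvgB (hn_holo_continuous oU kH pH (hs U A UV hA) Uz) (@cvg_cst _ _ _ _ _)).
- by move=> z zd; rewrite lerBlDr ler_wpDr//; case/andP: (phi_bounds i zd).
move=> z /ltW zd; have Vz := dV zd.
have [U [H [A [[oU Uz UV] [[kH pH hA harm] F]]]]] := pres Vz.
have [fE _ phE ev] := F z Uz.
have evd j : eigenvalue (A z) (d j z) by apply/ev; exists j.
have hnA : hn (H z) (A z) <= a ^+ 2 by rewrite -fE fa.
have sepz j k : j != k -> delta <= nm (d j z - d k z) by exact: sep.
have dMz j : nm (d j z) <= M by exact: dM.
pose s w := lagr (A w) (d^~ w) i.
have [|p [c [q [J ineq]]]] := bochner oU Uz kH pH (s := s) _ (harm z Uz).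
  by move=> k l w Uw; exact: (hs U A UV hA k l w Uw).
exists p, c, q; split.
  apply: (@jet_eq _ _ _ _ _ _ _ _ _ (jet_near _ (jetD J (jet_cst (- 1) z)))).
  - have := open_nbhs_nbhs (conj oU Uz); apply: filterS => w /F[_ _ -> _].
    by rewrite rmorphB.
  - by rewrite addr0.
  - by rewrite addr0.
  - by rewrite addr0.
have cAs : A z *m s z = s z *m A z by exact: (lagr_comm delta0 evd sepz).
have cBs : (t%:C *: A z) *m s z = s z *m (t%:C *: A z).
  by rewrite -scalemxAl cAs scalemxAr.
rewrite (tr_bracket_comm (pH z Uz) cBs) in ineq.
have hB : hn (H z) (t%:C *: A z *m adj (H z) (s z) - adj (H z) (s z) *m (t%:C *: A z)) =
    t ^+ 2 * hn (H z) (A z *m adj (H z) (s z) - adj (H z) (s z) *m A z).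
  by rewrite -scalemxAl -(scalemxAr _ (adj _ _)) -scalerBr hn_scale.
rewrite hB in ineq.
have comm := hn_lagr_commutator (pH z Uz) delta0 evd dMz sepz a0 hnA i.
rewrite -/(s z) in comm.
have /andP[f1 _] := phi_bounds i zd.
rewrite phE -/(s z) in f1 *.
move: ineq comm klam; set c1 := (_ * _) ^+ 2.
have c10 : 0 <= c1 by exact: sqr_ge0.
have hn0 := hn_ge0 (pH z Uz) (A z *m adj (H z) (s z) - adj (H z) (s z) *m A z).
move: hn0 c10 f1; move: c1 (hn _ (_ - _)) (hn _ (s z)) (complex.Re q).
clear => c1 P g Q P0 c10 f1 ineq comm _.
have f0 : 0 < g by exact: lt_le_trans f1.
have PQ : t ^+ 2 * P <= Q.
  rewrite -(ler_pM2l f0); apply: le_trans ineq; by rewrite lerDr sqr_ge0.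
apply: le_trans PQ; rewrite -mulrA ler_wpM2l ?sqr_ge0//.
rewrite mulrC ler_pdivrMr ?ltr_wpDl//.
have : g - 1 <= c1 * P.
  by apply: le_trans comm; rewrite ler_peMl// subr_ge0.
move=> H1; apply: le_trans H1 _; rewrite mulrC ler_wpM2l// lerDl//.
Qed.

Lemma bracket_le : 0 <= M ->
  Num.sqrt (b z0) <= \sum_i M * (2 * a * Num.sqrt (2 * (phi i z0 - 1))).
Proof.
move=> M0; have z0d : nm (z0 - z0) <= rho by rewrite subrr nm0 ltW.
have Vz := dV z0d; have [U [H [A [[oU Uz UV] [[kH pH hA harm] F]]]]] := pres Vz.
have [fE bE phE ev] := F z0 Uz.
have evd j : eigenvalue (A z0) (d j z0) by apply/ev; exists j.
have hnA : hn (H z0) (A z0) <= a ^+ 2 by rewrite -fE fa.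
have sepz j k : j != k -> delta <= nm (d j z0 - d k z0) by exact: sep.
have dMz j : nm (d j z0) <= M by exact: dM.
rewrite bE; apply: le_trans (hn_bracket_le (pH z0 Uz) delta0 evd dMz sepz a0 hnA) _.
by apply: ler_sum => i _; rewrite phE.
Qed.

End Projections.
End Presented.

End LocalEstimates.

(** * Exponential decay at the centre of a disc, with explicit constants *)

Section LocalDecay.
Variable R : realType.
Notation C := (Cx R).

Lemma lagr_const_ge0 n (a M delta : R) : 0 <= a -> 0 <= M -> 0 < delta ->
  0 <= @lagr_const R n a M delta.
Proof.
move=> a0 M0 d0; rewrite mulr_ge0 ?fn_ge0 ?exprn_ge0// divr_ge0 ?(ltW d0)//.
by rewrite addr_ge0// mulr_ge0// fn_ge0.
Qed.

(** The inequality x exp(-x) <= 1 at x = s t / 4, squared: half of the decay rate pays for t^2. *)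
Lemma sqr_exp_absorb (s t : R) : 0 < s -> 0 < t ->
  t ^+ 2 * expR (- s * t) <= 16 / s ^+ 2 * expR (- (s / 2) * t).
Proof.
move=> s0 t0; have -> : - s * t = - (s / 2) * t + - (s * t / 4) + - (s * t / 4) by field.
rewrite !expRD (mulrC (16 / _)) -(mulrA (expR _)) mulrCA ler_pM2l ?expR_gt0//.
have x0 : 0 < s * t / 4 by rewrite !mulr_gt0.
have H : s * t / 4 * expR (- (s * t / 4)) <= 1.
  rewrite expRN ler_pdivrMr ?expR_gt0// mul1r.
  by apply: le_trans (expR_ge1Dx _); rewrite lerDr.
have e0 := expR_gt0 (- (s * t / 4)).
move: e0 H; move: (expR _) => e e0 H.
have : (s * t / 4 * e) * (s * t / 4 * e) <= 1 * 1.
  by apply: ler_pM => //; rewrite mulr_ge0 // ltW.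
rewrite mulr1 ler_pdivlMr ?exprn_gt0// => H1.
have -> : t ^+ 2 * (e * e) * s ^+ 2 = 16 * (s * t / 4 * e * (s * t / 4 * e)) by field.
by rewrite ger_pMr.
Qed.

Section Constants.
Variables (n : nat) (M delta rho : R).
Hypotheses (M0 : 0 <= M) (delta0 : 0 < delta) (rho0 : 0 < rho).

(** For t >= 1 this bounds |theta|^2 on the half disc, by [energy_bound] on the discs of radius
    rho/2 around its points. *)
Let a2 : R := 2 * n.+1%:R * M ^+ 2 + 8 * n.+1%:R ^+ 4 / (rho / 2) ^+ 2.
Let a := Num.sqrt a2.
Let L := @lagr_const R n a M delta.
Let c1 := (n.+1%:R * (delta^-1 * L)) ^+ 2.
(** Chosen so that kap = eps t meets the hypothesis of [projection_decay] for all t >= 1; since eps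
    <= 1 and t >= 1, both eps^2 t^2 and eps t are at most eps t^2. *)
Let eps := ((c1 + 1) * (1 + (rho / 2) ^+ 2))^-1.
(** The factor 1/2 is due to the square root in [bracket_le]. *)
Let s := eps * (rho / 2) ^+ 2 / 2.

Let rho2 : 0 < rho / 2. Proof. by rewrite divr_gt0. Qed.

Let a20 : 0 <= a2.
Proof.
apply: addr_ge0; first by rewrite mulr_ge0 ?sqr_ge0// mulr_ge0.
by rewrite divr_ge0 ?sqr_ge0// mulr_ge0// exprn_ge0.
Qed.

Let L0 : 0 <= L. Proof. exact: lagr_const_ge0 (sqrtr_ge0 _) M0 delta0. Qed.

Let c10 : 0 < c1 + 1. Proof. by rewrite ltr_wpDl ?sqr_ge0. Qed.

Let D0 : 0 < (c1 + 1) * (1 + (rho / 2) ^+ 2).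
Proof. by rewrite mulr_gt0// ltr_pwDl// sqr_ge0. Qed.

Let eps0 : 0 < eps. Proof. by rewrite invr_gt0. Qed.

Let eps1 : eps <= 1.
Proof.
rewrite /eps invf_le1// -[leLHS]mulr1; apply: ler_pM => //.
  by rewrite lerDr sqr_ge0.
by rewrite lerDl sqr_ge0.
Qed.

Let s0 : 0 < s. Proof. by rewrite divr_gt0// mulr_gt0// exprn_gt0. Qed.

Section Estimate.
Variables (V : set C) (d : 'I_n.+1 -> C -> C) (z0 : C) (t : R).
Variables (f b : C -> R) (phi : 'I_n.+1 -> C -> R).
Hypotheses (hd : forall i, holo_on V (d i))
  (dM : forall w i, V w -> nm (d i w) <= M)
  (sep : forall w i j, V w -> i != j -> delta <= nm (d i w - d j w)) (t0 : 0 < t)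
  (pres : forall z, V z -> presented V d t f b phi z)
  (dV : forall z, nm (z - z0) <= rho -> V z).

Let sub_disc z w : nm (z - z0) <= rho / 2 -> nm (w - z) <= rho / 2 -> V w.
Proof.
move=> zd wz; apply: dV; have -> : w - z0 = (w - z) + (z - z0) by rewrite addrA subrK.
apply: le_trans (nm_triangle _ _) _; apply: le_trans (lerD wz zd) _.
by rewrite -splitr.
Qed.

Let sub_disc0 w : nm (w - z0) <= rho / 2 -> V w.
Proof. by apply: sub_disc; rewrite subrr nm0 ltW. Qed.

Lemma bracket_large_time : 1 <= t ->
  Num.sqrt (b z0) <= n.+1%:R * (M * (2 * a * (2 * L))) * expR (- s * t).
Proof.
move=> t1; have a0 : 0 <= a := sqrtr_ge0 _.
have fa z : nm (z - z0) <= rho / 2 -> f z <= a ^+ 2.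
  move=> zd; rewrite sqr_sqrtr//; have t2 : 0 < t ^+ 2 by rewrite exprn_gt0.
  rewrite -(ler_pM2l t2).
  apply: le_trans (energy_bound dM t0 pres rho2 M0 (fun w => @sub_disc z w zd)) _.
  rewrite mulrDr exprMn mulrCA lerD2l.
  by rewrite ler_peMl ?exprn_ege1// mulr_ge0 ?mulr_ge0 ?invr_ge0 ?exprn_ge0// ltW.
apply: le_trans (bracket_le delta0 dM sep pres rho2 a0 sub_disc0 fa M0) _.
rewrite -mulrA; apply: le_trans
    (_ : \sum_(i < n.+1) (M * (2 * a * (2 * L)) * expR (- s * t)) <= _); last first.
  by rewrite sumr_const card_ord -[leLHS]mulr_natl.
apply: ler_sum => i _; rewrite -(mulrA M) ler_wpM2l//.
rewrite -(mulrA (2 * a)) ler_wpM2l ?mulr_ge0 ?sqrtr_ge0// -(mulrA 2).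
have e0 := expR_gt0 (- s * t).
have B0 : 0 <= 2 * (L * expR (- s * t)).
  by apply: mulr_ge0 => //; exact: mulr_ge0 L0 (ltW e0).
rewrite -(ger0_norm B0) -sqrtr_sqr ler_wsqrtr// (exprMn _ 2 (L * _)) (exprMn _ L).
have kap0 : 0 < eps * t by rewrite mulr_gt0.
have := @projection_decay R n V d t M delta f b phi hd delta0 dM sep pres z0 (rho / 2) a
  rho2 a0 sub_disc0 fa (eps * t) i kap0.
rewrite -/L -/c1 => H1.
have {}H1 : phi i z0 - 1 <= L ^+ 2 * expR (- (eps * t * (rho / 2) ^+ 2)).
  apply: H1; have E : (c1 + 1)^-1 = eps * (1 + (rho / 2) ^+ 2).
    by rewrite /eps invfM -mulrA mulVf ?mulr1// gt_eqF// ltr_pwDl// sqr_ge0.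
  rewrite E mulrDr mulr1 mulrDr; apply: lerD.
    by rewrite mulrC ler_pM2r// expr2 ler_pMl.
  rewrite [leRHS]mulrA ler_wpM2r ?sqr_ge0// exprMn mulrC ler_wpM2l ?sqr_ge0//.
  by rewrite expr2 ger_pMr.
have -> : expR (- s * t) ^+ 2 = expR (- (eps * t * (rho / 2) ^+ 2)).
  by rewrite expr2 -expRD; congr expR; rewrite /s; field.
apply: le_trans (_ : 2 * (L ^+ 2 * expR (- (eps * t * (rho / 2) ^+ 2))) <= _).
  by rewrite ler_pM2l.
have X0 : 0 <= L ^+ 2 * expR (- (eps * t * (rho / 2) ^+ 2)).
  exact: mulr_ge0 (sqr_ge0 _) (expR_ge0 _).
by apply: ler_wpM2r => //; rewrite -natrX ler_nat.
Qed.

Lemma bracket_decay : t ^+ 2 * Num.sqrt (b z0) <=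
  (n.+1%:R * (M * (2 * a * (2 * L))) * (16 / s ^+ 2) + 2 * a2 * expR (s / 2) + 1) *
    expR (- (s / 2) * t).
Proof.
have K0 : 0 <= n.+1%:R * (M * (2 * a * (2 * L))).
  have a0 : 0 <= a := sqrtr_ge0 _.
  apply: mulr_ge0 => //; apply: mulr_ge0 => //; apply: mulr_ge0; exact: mulr_ge0.
have e0 := expR_gt0 (- (s / 2) * t).
have e1 : 0 <= 2 * a2 * expR (s / 2) by rewrite !mulr_ge0 ?expR_ge0.
have e2 : 0 <= n.+1%:R * (M * (2 * a * (2 * L))) * (16 / s ^+ 2).
  by rewrite mulr_ge0// divr_ge0// sqr_ge0.
have [t1|/ltW t1] := leP t 1.
  (* For t <= 1 the factor exp(s/2) makes up for exp(-(s/2) t), their product being at least 1. *)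
  apply: le_trans (bracket_small_time dM t0 pres rho2 M0 sub_disc0 t1) _; rewrite -/a2.
  apply: le_trans (_ : 2 * a2 * expR (s / 2) * expR (- (s / 2) * t) <= _).
    rewrite -mulrA -expRD ler_peMr ?mulr_ge0//; apply: le_trans (expR_ge1Dx _).
    rewrite lerDl mulNr subr_ge0 ger_pMr// divr_gt0//.
  by rewrite ler_pM2r// -addrA; apply: ler_wpDl => //; rewrite lerDl.
have t2 : 0 <= t ^+ 2 by exact: sqr_ge0.
apply: le_trans (ler_wpM2l t2 (bracket_large_time t1)) _; rewrite mulrCA.
apply: le_trans (ler_wpM2l K0 (sqr_exp_absorb s0 t0)) _.
by rewrite (mulrA (n.+1%:R * _)) ler_pM2r// -addrA lerDl addr_ge0.
Qed.

End Estimate.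

(** The order of quantifiers is the point: the constants depend on n, M, delta and rho, and precede
    the metric, the parameter t and the centre of the disc. *)
Lemma local_decay : exists C0 eps0 : R, 0 < C0 /\ 0 < eps0 /\
  forall (V : set C) (d : 'I_n.+1 -> C -> C) (z0 : C) (t : R)
    (f b : C -> R) (phi : 'I_n.+1 -> C -> R),
  (forall i, holo_on V (d i)) -> (forall w i, V w -> nm (d i w) <= M) ->
  (forall w i j, V w -> i != j -> delta <= nm (d i w - d j w)) -> 0 < t ->
  (forall z, V z -> presented V d t f b phi z) ->
  (forall z, nm (z - z0) <= rho -> V z) ->
  t ^+ 2 * Num.sqrt (b z0) <= C0 * expR (- eps0 * t).
Proof.
exists (n.+1%:R * (M * (2 * a * (2 * L))) * (16 / s ^+ 2) + 2 * a2 * expR (s / 2) + 1), (s / 2).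
split; [|split].
- have a0 : 0 <= a := sqrtr_ge0 _.
  have K0 : 0 <= n.+1%:R * (M * (2 * a * (2 * L))).
    apply: mulr_ge0 => //; apply: mulr_ge0 => //; apply: mulr_ge0; exact: mulr_ge0.
  apply: ltr_wpDl ltr01; apply: addr_ge0.
    by apply: (mulr_ge0 K0); rewrite divr_ge0// sqr_ge0.
  by apply: mulr_ge0 (expR_ge0 _); apply: mulr_ge0.
- by apply: (divr_gt0 s0).
- move=> V d z0 t f b phi hd dM sep t0 pres dV.
  exact: (bracket_decay hd dM sep t0 pres dV).
Qed.

End Constants.

End LocalDecay.

(** * Characteristic polynomials and distinct eigenvalues *)

Section CharacteristicPolynomial.
Variable F : closedFieldType.
Variable n : nat.
Implicit Types (A : 'M[F]_n.+1) (d : 'I_n.+1 -> F).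

Lemma horner_char_poly A a : (char_poly A).[a] = \det (a%:M - A).
Proof.
rewrite -horner_evalE -det_map_mx; congr (\det _); apply/matrixP => i j.
by rewrite !mxE /= horner_evalE !hornerE hornerMn hornerX.
Qed.

Lemma char_poly_split A : exists e : n.+1.-tuple F,
  (forall a, \det (a%:M - A) = \prod_(b <- e) (a - b)) /\ forall b, b \in e -> eigenvalue A b.
Proof.
have [r rE] := closed_field_poly_normal (char_poly A).
rewrite (monicP (char_poly_monic A)) scale1r in rE.
have sr : size r == n.+1.
  by have := size_char_poly A; rewrite rE size_prod_XsubC => -[->].
exists (Tuple sr); split=> [a|b br].
  by rewrite -horner_char_poly rE horner_prod; apply: eq_bigr => b _; rewrite !hornerE.
by rewrite eigenvalue_root_char rE root_prod_XsubC.
Qed.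

Section DistinctEigenvalues.
Variables (A : 'M[F]_n.+1) (d : 'I_n.+1 -> F).
Hypotheses (dinj : injective d) (ev : forall i, eigenvalue A (d i)).

Lemma det_distinct_eigenvalues a : \det (a%:M - A) = \prod_i (a - d i).
Proof.
have := @all_roots_prod_XsubC _ (char_poly A) (codom d).
rewrite size_char_poly size_codom card_ord => /(_ erefl) H.
rewrite -horner_char_poly H ?(monicP (char_poly_monic A)) ?scale1r.
- rewrite horner_prod big_image /=; apply: eq_bigr => i _.
  by rewrite !hornerE.
- by apply/allP => b /codomP[i ->]; rewrite -eigenvalue_root_char.
- by rewrite uniq_rootsE; apply/injectiveP.
Qed.

Lemma distinct_eigenvalues_all a : eigenvalue A a -> exists i, a = d i.
Proof.
rewrite eigenvalue_root_char /root horner_char_poly det_distinct_eigenvalues.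
by move=> /prodf_eq0[i _]; rewrite subr_eq0 => /eqP; exists i.
Qed.

End DistinctEigenvalues.

End CharacteristicPolynomial.

(** * Holomorphic branches of simple eigenvalues *)

Section EigenvalueBranches.
Variable R : realType.
Notation C := (Cx R).
Variable n : nat.

(** The inverse of 1 plus the sum of the inverses replaces a minimum and is positive even when I is
    empty. *)
Lemma finite_lower_bound (I : finType) (F : I -> R) : (forall i, 0 < F i) ->
  exists2 m, 0 < m & forall i, m <= F i.
Proof.
move=> F0; have S0 : 0 <= \sum_i (F i)^-1 by apply: sumr_ge0 => i _; rewrite invr_ge0 ltW.
exists (1 + \sum_i (F i)^-1)^-1; first by rewrite invr_gt0 ltr_pwDl.
move=> i; rewrite -[leRHS]invrK lef_pV2 ?posrE ?invr_gt0 ?ltr_pwDl//.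
rewrite (bigD1 i)//= addrCA lerDl addr_ge0//.
by apply: sumr_ge0 => j _; rewrite invr_ge0 ltW.
Qed.

Lemma nm_prod (I : Type) (r : seq I) (P : pred I) (F : I -> C) :
  nm (\prod_(i <- r | P i) F i) = \prod_(i <- r | P i) nm (F i).
Proof.
elim/big_rec2: _ => [|i x y _ <-]; last by rewrite nmM.
by rewrite -[X in nm X]/((1 : R)%:C) nm_real normr1.
Qed.

(** The determinant is the product of the n + 1 differences a - b over the eigenvalues b; it could
    not be this small if all of them were at distance at least e. *)
Lemma eigenvalue_near (A : 'M[C]_n.+1) a (e : R) : 0 < e ->
  nm (\det (a%:M - A)) < e ^+ n.+1 -> exists2 b, eigenvalue A b & nm (b - a) < e.
Proof.
move=> e0; have [s [-> sev]] := char_poly_split A; move=> H.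
apply: contrapT => far; have {}far b : b \in tval s -> e <= nm (b - a).
  by move=> bs; rewrite leNgt; apply/negP => ba; apply: far; exists b => //; exact: sev.
move: H; apply/negP; rewrite -leNgt nm_prod -[X in e ^+ X](size_tuple s).
elim: (tval s) far => [|b r IH] far; first by rewrite big_nil expr0.
rewrite big_cons exprS; apply: ler_pM; rewrite ?(ltW e0) ?exprn_ge0 ?(ltW e0)//.
  by rewrite nmB; apply: far; exact: mem_head.
by apply: IH => c cr; apply: far; rewrite in_cons cr orbT.
Qed.

(** At a zero of p, continuity of q suffices, which lets differentiability of the eigenvalues be
    deduced from their continuity. *)
Lemma derivable_zero_mul (p q : C -> C) z : derivable p z 1 -> p z = 0 ->
  {for z, continuous q} -> derivable (fun w => p w * q w) z 1.
Proof.
move=> /derivable_cdiff; set l := derive p z 1; move: l => l dp pz cq.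
apply: (proj1 (@cdiff_derivable _ _ z (l * q z) _)) => e e0.
have Q0 : 0 < nm (q z) + 1 by rewrite ltr_wpDl// nm_ge0.
have L0 : 0 < nm l + 1 by rewrite ltr_wpDl// nm_ge0.
pose e1 := Num.min 1 (e / 2 / (nm l + 1)); pose e2 := e / 2 / (nm (q z) + 1).
have e10 : 0 < e1 by rewrite lt_min ltr01 !divr_gt0.
have e20 : 0 < e2 by rewrite !divr_gt0.
have [d1 d10 H1] := dp e2 e20.
have /nbhsCP[d2 d20 H2] : \forall w \near z, nm (q w - q z) < e1.
  by move/cvgCP: cq; exact.
exists (Num.min d1 d2) => [|w]; first by rewrite lt_min d10.
rewrite lt_min => /andP[/H1 pw /H2 qw]; rewrite pz subr0 in pw; rewrite pz mul0r subr0.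
have -> : p w * q w - l * q z * (w - z) =
  (p w - l * (w - z)) * q w + l * (w - z) * (q w - q z) by ring.
apply: le_trans (nm_triangle _ _) _; rewrite !nmM.
have qb : nm (q w) <= nm (q z) + 1.
  rewrite -lerBlDl; apply: le_trans (nm_triangleB _ _) _.
  by apply: le_trans (ltW qw) _; rewrite ge_min lexx.
have h1 : nm (p w - l * (w - z)) * nm (q w) <= e / 2 * nm (w - z).
  apply: le_trans (ler_pM (nm_ge0 _) (nm_ge0 _) pw qb) _.
  by rewrite mulrAC /e2 divfK ?gt_eqF.
have h2 : nm l * nm (w - z) * nm (q w - q z) <= e / 2 * nm (w - z).
  rewrite mulrAC ler_wpM2r ?nm_ge0//.
  apply: le_trans (ler_pM (nm_ge0 _) (nm_ge0 _) (_ : _ <= nm l + 1) (ltW qw)) _.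
    by rewrite lerDl.
  apply: le_trans (_ : (nm l + 1) * (e / 2 / (nm l + 1)) <= _).
    by rewrite ler_wpM2l ?(ltW L0)// ge_min lexx orbT.
  by rewrite mulrC divfK ?gt_eqF.
by apply: le_trans (lerD h1 h2) _; rewrite -mulrDl -splitr.
Qed.

(** An implicit function theorem for simple roots. Near w0 each al_i has an eigenvalue of A(w) close
    by; the discs around the al_i are disjoint, so these are all the eigenvalues. The factorization
    of det(l - A(w)) then yields continuity of the branches and, after that, differentiability. *)
Lemma eigen_branches (V0 : set C) (A : C -> 'M[C]_n.+1) w0 (al : 'I_n.+1 -> C) :
  open V0 -> V0 w0 -> alg_mx (holo_on V0) A -> injective al ->
  (forall i, eigenvalue (A w0) (al i)) ->
  exists (rho delta M : R) (d : 'I_n.+1 -> C -> C), let V := [set w | nm (w - w0) < rho] in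
  [/\ 0 < rho, 0 < delta, 0 <= M & V `<=` V0] /\
  [/\ forall i, holo_on V (d i),
      forall w a, V w -> eigenvalue (A w) a <-> exists i, a = d i w,
      forall w i, V w -> nm (d i w) <= M &
      forall w i j, V w -> i != j -> delta <= nm (d i w - d j w)].
Proof.
move=> oV0 V0w0 hA alinj ev0.
have [dl dl0 dlP] : exists2 dl : R, 0 < dl & forall i j, i != j -> dl <= nm (al i - al j).
  have [|m m0 mP] := @finite_lower_bound {ij : 'I_n.+1 * 'I_n.+1 | ij.1 != ij.2}
    (fun ij => nm (al (val ij).1 - al (val ij).2)).
    move=> [[i j] /= ij]; rewrite lt0r nm_ge0 nm_eq0 subr_eq0 andbT.
    by apply: contra ij => /eqP/alinj ->.
  by exists m => // i j ij; exact: (mP (exist _ (i, j) ij)).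
(* Moving two eigenvalues by less than dl/4 each leaves a gap of at least dl/2, even when they are
   taken at different points w. *)
pose e := dl / 4; have e0 : 0 < e by rewrite divr_gt0.
have hdet a : holo_on V0 (fun w => \det (a%:M - A w)).
  have := alg_det (@holo_on_cst R V0) (@holo_onD R V0) (@holo_onM R V0)
    (A := fun w => a%:M - A w); apply=> i j.
  have := holo_onD (@holo_on_cst R V0 ((a%:M : 'M[C]_n.+1) i j))
    (holo_onM (@holo_on_cst R V0 (-1)) (@hA i j)).
  by congr holo_on; apply/funext => w; rewrite !mxE mulN1r.
have [rho rho0 rhoP] : exists2 rho, 0 < rho & forall w, nm (w - w0) < rho ->
    V0 w /\ forall i, nm (\det ((al i)%:M - A w)) < e ^+ n.+1.
  have H i : \forall w \near w0, nm (\det ((al i)%:M - A w)) < e ^+ n.+1.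
    have c := derivable_continuous (hdet (al i) w0 V0w0).
    have /cvgCP/(_ (e ^+ n.+1) (exprn_gt0 _ e0)) := c.
    apply: filterS => w; suff -> : \det ((al i)%:M - A w0) = 0 by rewrite subr0.
    apply/eqP; rewrite -horner_char_poly -/(root _ _) -eigenvalue_root_char; exact: ev0.
  have /nbhsCP[rho rho0 rhoP] : \forall w \near w0,
      V0 w /\ forall i, nm (\det ((al i)%:M - A w)) < e ^+ n.+1.
    exact: filterI (open_nbhs_nbhs (conj oV0 V0w0)) (filter_forall _ H).
  by exists rho.
(* The value 0 outside the disc is a dummy. *)
have /choice[f fP] : forall iw : 'I_n.+1 * C, exists b, nm (iw.2 - w0) < rho ->
    eigenvalue (A iw.2) b /\ nm (b - al iw.1) < e.
  move=> [i w] /=; have [wr|wr] := pselect (nm (w - w0) < rho); last by exists 0 => /wr.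
  by have [_ /(_ i)/(eigenvalue_near e0)[b b1 b2]] := rhoP w wr; exists b.
pose d i w := f (i, w).
have dP i w : nm (w - w0) < rho -> eigenvalue (A w) (d i w) /\ nm (d i w - al i) < e.
  exact: (fP (i, w)).
have far i j w w' : i != j -> nm (w - w0) < rho -> nm (w' - w0) < rho ->
    dl / 2 <= nm (d i w - d j w').
  move=> ij /(dP i)[_ di] /(dP j)[_ dj].
  have : nm (al i - al j) <= nm (d i w - al i) + nm (d i w - d j w') + nm (d j w' - al j).
    have -> : al i - al j = (al i - d i w) + (d i w - d j w') + (d j w' - al j) by ring.
    apply: le_trans (nm_triangle _ _) _; rewrite lerD2r.
    by apply: le_trans (nm_triangle _ _) _; rewrite lerD2r nmB.
  have := dlP i j ij; move: di dj; rewrite /e.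
  move: (nm _) (nm _) (nm _) (nm _) => x y u v; lra.
have dinj w : nm (w - w0) < rho -> injective (d^~ w).
  move=> wr i j dij; apply/eqP; apply: contraT => ij; have := far i j w w ij wr wr.
  by rewrite dij subrr nm0 leNgt divr_gt0.
exists rho, (dl / 2), (\sum_i nm (al i) + e), d => V; split.
  split=> //; first by rewrite divr_gt0.
    by rewrite addr_ge0 ?(ltW e0)// sumr_ge0// => i _; exact: nm_ge0.
  by move=> w /rhoP[].
have evd w : V w -> forall i, eigenvalue (A w) (d i w) by move=> Vw i; case: (dP i w Vw).
have pE i l w : V w -> \det (l%:M - A w) = (l - d i w) * \prod_(j | j != i) (l - d j w).
  by move=> Vw; rewrite (det_distinct_eigenvalues (dinj w Vw) (evd w Vw)) (bigD1 i).
pose c i : R := \prod_(j < n.+1 | j != i) (dl / 2).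
have c0 i : 0 < c i by apply: prodr_gt0 => j _; rewrite divr_gt0.
have cP i z w : V z -> V w -> c i <= nm (\prod_(j | j != i) (d i z - d j w)).
  move=> Vz Vw; rewrite nm_prod; apply: ler_prod => j ji; rewrite ltW ?divr_gt0//=.
  by apply: far => //; rewrite eq_sym.
have n0 i z w : V z -> V w -> \prod_(j | j != i) (d i z - d j w) != 0.
  by move=> Vz Vw; rewrite -nm_eq0 gt_eqF// (lt_le_trans (c0 i)) ?cP.
have oV : open V := @open_discC R w0 rho.
have p0 i z : V z -> \det ((d i z)%:M - A z) = 0.
  by move=> Vz; rewrite (pE i)// subrr mul0r.
have dp l z : V z -> derivable (fun w => \det (l%:M - A w)) z 1.
  by move=> Vz; apply: hdet; case: (rhoP z Vz).
have dc i z : V z -> cont_at z (d i).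
  move=> Vz; apply: (proj2 (@cvgCP R C (nbhs z) (nbhs_filter z) (d i) (d i z))) => eta eta0.
  have /nbhsCP[r1 r10 H1] : \forall w \near z, nm (\det ((d i z)%:M - A w)) < eta * c i.
    have /cvgCP/(_ (eta * c i) (mulr_gt0 eta0 (c0 i))) := derivable_continuous (dp (d i z) z Vz).
    by apply: filterS => w; rewrite p0// subr0.
  have [r2 r20 H2] := openCP oV Vz.
  apply: (proj2 (nbhsCP z [set w | nm (d i w - d i z) < eta])).
  exists (Num.min r1 r2) => [|w]; first by rewrite lt_min r10.
  rewrite lt_min => /andP[/H1 + /H2 Vw] /=; rewrite (pE i)// nmM nmB => H3.
  rewrite -(ltr_pM2r (c0 i)); apply: le_lt_trans H3.
  by rewrite ler_wpM2l ?nm_ge0// cP.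
split.
(* With l = d_i(z) frozen, d_i(w) = l - det(l - A(w)) / prod (l - d_j(w)). The determinant is
   holomorphic in w and vanishes at z; the product over j != i is so far only known to be continuous
   and nonzero there. *)
- move=> i z Vz; set l := d i z.
  pose q w := (\prod_(j | j != i) (l - d j w))^-1.
  have cp : cont_at z (fun w => \prod_(j | j != i) (l - d j w)).
    apply: (alg_prod (@cont_at_cst R z) (@cont_atM R z)) => j.
    exact: (cvgB (@cvg_cst _ _ _ _ _) (dc j z Vz)).
  have cq : cont_at z q by exact: (cvgV (n0 i z z Vz Vz) cp).
  have D := derivable_zero_mul (dp l z Vz) (p0 i z Vz) cq.
  have D2 := derivableB (derivable_cst l z 1) D.
  apply: near_eq_derivable D2.
  have := open_nbhs_nbhs (conj oV Vz); apply: filterS => w Vw.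
  have := n0 i z w Vz Vw; rewrite /q /= -/l => N.
  by rewrite -[LHS]/(l - _ * _) (pE i)// mulfK// opprB addrC subrK.
- move=> w a Vw; split; first exact: distinct_eigenvalues_all (dinj w Vw) (evd w Vw) a.
  by move=> [i ->]; exact: evd.
- move=> w i Vw; have [_ di] := dP i w Vw.
  rewrite -(subrK (al i) (d i w)); apply: le_trans (nm_triangle _ _) _.
  rewrite addrC lerD ?(ltW di)// (bigD1 i)//= lerDl sumr_ge0// => j _; exact: nm_ge0.
- by move=> w i j Vw ij; exact: far.
Qed.

End EigenvalueBranches.

(** * Invariance of adjoint, norm and bracket under change of frame *)

Section ChangeOfFrame.
Variable R : realType.
Notation C := (Cx R).

Lemma gc_mul n (F G X : 'M[C]_n) : F \in unitmx -> G \in unitmx ->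
  gc F (gc G X) = gc (F *m G) X.
Proof.
move=> uF uG; have uFG : F *m G \in unitmx by rewrite unitmx_mul uF.
apply: (can_inj (mulmxK uFG)).
rewrite /gc (mulmxKV uFG) (mulmxA _ F G) (mulmxKV uF) -(mulmxA F _ G) (mulmxKV uG).
exact: mulmxA.
Qed.

Lemma gc_inj n (F : 'M[C]_n) : F \in unitmx -> injective (gc F).
Proof.
move=> uF X Y XY; apply: (can_inj (mulKmx uF)).
by apply: (can_inj (mulmxK (_ : invmx F \in unitmx))); rewrite ?unitmx_inv.
Qed.

(** If F factors H' then F G factors H; after conjugation by F both sides are the conjugate
    transpose of the same matrix. *)
Lemma adj_gc n (G H H' X : 'M[C]_n) : G \in unitmx -> posdef H' -> H = G ^t* *m H' *m G ->
  adj H' (gc G X) = gc G (adj H X).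
Proof.
move=> uG pH HE; have [F uF FE] := posdef_factor pH.
have uFG : F *m G \in unitmx by rewrite unitmx_mul uF.
have HE' : H = (F *m G) ^t* *m (F *m G) by rewrite HE FE ctM !mulmxA.
apply: (gc_inj uF); rewrite (gc_adj uF FE) (gc_mul _ uF uG) (gc_mul _ uF uG).
by rewrite (gc_adj uFG HE').
Qed.

Lemma hn_gc_frame n (G H H' X : 'M[C]_n) : G \in unitmx -> posdef H' ->
  H = G ^t* *m H' *m G -> hn H' (gc G X) = hn H X.
Proof.
by move=> uG pH HE; rewrite /hn (adj_gc _ uG pH HE) -(gcM uG) (gc_tr uG).
Qed.

Lemma bracket_gc n (G H H' X : 'M[C]_n) : G \in unitmx -> posdef H' ->
  H = G ^t* *m H' *m G -> bracket H' (gc G X) = gc G (bracket H X).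
Proof.
move=> uG pH HE; rewrite /bracket (adj_gc _ uG pH HE) gcB.
by rewrite (gcM uG X) (gcM uG (adj H X) X).
Qed.

End ChangeOfFrame.

Lemma scalemx_inj (F : fieldType) m n (A : 'M[F]_(m, n)) (k l : F) :
  A != 0 -> k *: A = l *: A -> k = l.
Proof.
move=> A0 /eqP; rewrite -subr_eq0 -scalerBl scaler_eq0 (negbTE A0) orbF subr_eq0.
by move=> /eqP.
Qed.

(** * Points of the spectral curve and eigenvalues in a frame and chart *)

Section SpectralFibre.
Variables (R : realType) (X : riemannSurface R) (r : nat) (E : bundle X r)
  (theta : higgsField E).
Notation C := (Cx R).
Implicit Types (P : X) (i j : frame E) (c : chart X) (xi : covector X).

Lemma trans_unit i j P : fdom i P -> fdom j P -> trans i j P \in unitmx.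
Proof.
move=> iP jP; have := trans_cocycle iP jP iP; rewrite trans_id// => /mulmx1_unit[uT _]; exact: uT.
Qed.

Lemma hcoef_gc i j c P : fdom i P -> fdom j P -> cdom c P ->
  hcoef theta i c P = gc (trans i j P) (hcoef theta j c P).
Proof.
move=> iP jP cP; apply: (can_inj (mulmxK (trans_unit iP jP))).
by rewrite /gc mulmxKV ?trans_unit// hcoef_frame.
Qed.

Lemma cotangent_inj c P xi xi' : cdom c P -> cotangent_space P xi ->
  cotangent_space P xi' -> xi c = xi' c -> xi = xi'.
Proof.
move=> cP [x0 x1] [y0 y1] xy; apply/funext => c'.
have [c'P|c'P] := pselect (cdom c' P); last by rewrite x0// y0.
by rewrite (x1 c c')// (y1 c c')// xy.
Qed.

(** The link between the invariant curve and matrices. An eigenvalue a in the chart c extends to the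
    covector with coefficients [dcoord c c' P * a], and the eigenvector is carried to the other
    frames by the transition matrices. *)
Lemma spectral_curve_eigenvalue i c P a : fdom i P -> cdom c P ->
  eigenvalue (hcoef theta i c P) a <-> exists2 xi, spectral_curve theta (P, xi) & xi c = a.
Proof.
move=> iP cP; split; last by move=> [xi [_ xiP] <-]; exact: xiP.
move=> ev; pose xi c' := if pselect (cdom c' P) then dcoord c c' P * a else 0 : C.
have xiE c' : cdom c' P -> xi c' = dcoord c c' P * a.
  by rewrite /xi; case: pselect.
(* The cocycle rule for [dcoord] is needed only after multiplication by a. If a is nonzero, so is
   the matrix of theta, and comparing its own coordinate changes forces the rule. *)
have [dM d1] : (forall c1 c2, cdom c1 P -> cdom c2 P ->
    dcoord c c2 P * a = dcoord c1 c2 P * (dcoord c c1 P * a)) /\ dcoord c c P * a = a.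
  have [->|a0] := eqVneq a 0.
    split=> [c1 c2 _ _|]; last exact: mulr0.
    exact: (etrans (mulr0 _) (esym (etrans (congr1 _ (mulr0 _)) (mulr0 _)))).
  have A0 : hcoef theta i c P != 0.
    apply: contraNneq a0 => A0; move: ev; rewrite A0 => /eigenvalueP[v].
    by rewrite mulmx0 => /esym/eqP; rewrite scaler_eq0 => /orP[//|/eqP ->]; rewrite eqxx.
  split=> [c1 c2 c1P c2P|].
    have e2 := hcoef_chart theta iP c1P c2P; rewrite (hcoef_chart theta iP cP c1P) in e2.
    have e := etrans (esym (hcoef_chart theta iP cP c2P)) (etrans e2 (scalerA _ _ _)).
    exact: (etrans (congr1 (fun x => x * a) (scalemx_inj A0 e)) (esym (mulrA _ _ _))).
  have e := etrans (esym (hcoef_chart theta iP cP cP)) (esym (scale1r _)).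
  exact: (etrans (congr1 (fun x => x * a) (scalemx_inj A0 e)) (mul1r _)).
have cot : cotangent_space P xi.
  split=> [c' c'P|c1 c2 c1P c2P].
    by rewrite /xi; case: (pselect (cdom c' P)) => [q|//]; case: (c'P q).
  exact: (etrans (xiE c2 c2P) (etrans (dM c1 c2 c1P c2P) (congr1 _ (esym (xiE c1 c1P))))).
exists xi; last exact: (etrans (xiE c cP) d1).
split=> [|j c' jP c'P] /=; first exact: cot.
rewrite (hcoef_chart theta jP cP c'P) (hcoef_gc jP iP cP) (xiE c' c'P).
move/eigenvalueP: ev => [v vA v0].
have uT := trans_unit jP iP.
apply/eigenvalueP; exists (v *m invmx (trans j i P)).
  by rewrite /gc -scalemxAr !mulmxA mulmxKV// vA -scalemxAl scalerA.
apply: contra v0 => /eqP v0; by rewrite -(mulmxKV uT v) v0 mul0mx.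
Qed.

End SpectralFibre.

(** * From the Riemann surface to open sets of the plane *)

Section RiemannSurfaceGeometry.
Variables (R : realType) (X : riemannSurface R).
Notation C := (Cx R).
Implicit Types (P : X) (c : chart X).

Lemma chart_open c (O : set X) : open O -> open (cmap c @` (O `&` cdom c)).
Proof.
move=> oO; have cinvc := @cinv_continuous _ X c; have oimg := @cimg_open _ X c.
rewrite continuous_open_subspace// in cinvc.
have := (proj1 (continuous_inP _ oimg) cinvc) O oO; congr open.
apply/seteqP; split=> [w [[P cP <-]]|w [P [OP cP] <-]] /=.
  by rewrite cmapK// => OP; exists P.
by split; [exists P|rewrite /= cmapK].
Qed.

Lemma Ck_on_sub k (U V : set C) F : U `<=` V -> Ck_on k V F -> Ck_on k U F.
Proof.
move=> UV; elim: k F => [|k IH] F [cF H].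
  by split=> // z /UV; exact: cF.
split=> [z /UV|v /H[dF kF]]; first exact: cF.
by split=> [z /UV/dF//|]; exact: IH.
Qed.

(** With k < n + 1 distinct eigenvalues, their positions in the list [s] would biject the fibre of
    the spectral curve with [I_k], and P would lie in the discriminant. *)
Lemma distinct_eigenvalues_of_fibre n (E : bundle X n.+1) (theta : higgsField E) i c P :
  ~ discriminant theta P -> fdom i P -> cdom c P ->
  exists al : 'I_n.+1 -> C, injective al /\ forall k, eigenvalue (hcoef theta i c P) (al k).
Proof.
move=> nD iP cP; set A := hcoef theta i c P.
have [e [eP eev]] := char_poly_split A.
pose s := undup e; have us : uniq s := undup_uniq e.
have sP a : eigenvalue A a <-> a \in s.
  rewrite mem_undup; split; last exact: eev.
  rewrite eigenvalue_root_char /root horner_char_poly eP.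
  by rewrite prodf_seq_eq0 => /hasP[b be] /=; rewrite subr_eq0 => /eqP ->.
have ss : (size s <= n.+1)%N by rewrite -[X in (_ <= X)%N](size_tuple e) size_undup.
have [sn|sn] := ltnP (size s) n.+1; last first.
  have sE : size s = n.+1 by apply/eqP; rewrite eqn_leq ss.
  exists (fun k => nth 0 s k); split=> [k l kl|k]; last by apply/sP; rewrite mem_nth// sE.
  have ks (m : 'I_n.+1) : (m < size s)%N by rewrite sE.
  by apply/val_inj/eqP; have := nth_uniq 0 (ks k) (ks l) us; rewrite [in LHS]kl eqxx => <-.
have fs xi : spectral_curve theta (P, xi) -> xi c \in s.
  by move=> xiP; apply/sP/(spectral_curve_eigenvalue theta _ iP cP); exists xi.
case: nD; exists (size s) => //; apply/card_set_bijP.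
exists (fun xi : covector X => index (xi c) s); split.
- by move=> xi [_ xiP] /=; rewrite index_mem; exact: fs.
- move=> xi xi' /set_mem[cot sc] /set_mem[cot' sc'] E1; apply: (cotangent_inj cP cot cot').
  exact: (etrans (esym (nth_index 0 (fs xi sc))) (etrans (congr1 (nth 0 s) E1)
    (nth_index 0 (fs xi' sc')))).
- move=> k /= ks; have : eigenvalue A (nth 0 s k) by apply/sP; rewrite mem_nth.
  move=> /(spectral_curve_eigenvalue theta _ iP cP)[xi xiP xic].
  exists xi; first by split=> //; case: xiP.
  by rewrite xic index_uniq.
Qed.

Section Metric.
Variables (r : nat) (E : bundle X r) (theta : higgsField E) (h : hermMetric E)
  (g : kahlerMetric X).

Lemma hmx_posdef i P : fdom i P -> posdef (hmx h i P).
Proof. by move=> iP; split; [exact: hmx_herm|exact: (@hmx_gt0 _ _ _ _ h i P iP)]. Qed.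

Lemma norm11E i c P B : norm11 h g i c P B = Num.sqrt (hn (hmx h i P) B) * (2 / kcoef g c P).
Proof. by []. Qed.

Lemma norm11_scale i c P (k : R) B :
  norm11 h g i c P (k%:C *: B) = `|k| * norm11 h g i c P B.
Proof. by rewrite !norm11E hn_scale sqrtrM ?sqr_ge0// sqrtr_sqr [RHS]mulrA. Qed.

Lemma bracket_scale n (H A : 'M[C]_n) (z : C) :
  bracket H (z *: A) = (nm z ^+ 2)%:C *: bracket H A.
Proof.
have adjZ : adj H (z *: A) = (z^*)%R *: adj H A.
  by rewrite /adj ctZ -scalemxAr -scalemxAl.
rewrite /bracket adjZ -!scalemxAl -!scalemxAr !scalerA (mulrC (z^*)%R) -scalerBr.
by rewrite nm_mulconj.
Qed.

Lemma kcoef_nm c c' P : cdom c P -> cdom c' P ->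
  kcoef g c' P = nm (dcoord c c' P) ^+ 2 * kcoef g c P.
Proof.
move=> cP c'P; have := kcoef_chart g cP c'P; rewrite nmE -rmorphXn -rmorphM.
exact: complexI.
Qed.

(** The bracket and [kcoef] both acquire the factor |dcoord|^2, nonzero because [kcoef] is positive;
    the two factors cancel. *)
Lemma norm11_bracket_chart i c c' P : fdom i P -> cdom c P -> cdom c' P ->
  norm11 h g i c' P (higgs_bracket theta h i c' P) =
  norm11 h g i c P (higgs_bracket theta h i c P).
Proof.
move=> iP cP c'P; have := kcoef_gt0 g cP; have := kcoef_gt0 g c'P.
rewrite !norm11E (kcoef_nm cP c'P); move: (kcoef g c P) => k k'0 k0.
have -> : higgs_bracket theta h i c' P =
    (nm (dcoord c c' P) ^+ 2)%:C *: higgs_bracket theta h i c P.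
  by rewrite -bracket_scale -hcoef_chart.
rewrite hn_scale sqrtrM ?sqr_ge0// sqrtr_sqr ger0_norm ?sqr_ge0//.
have D0 : nm (dcoord c c' P) != 0.
  by apply: contraTneq k'0 => ->; rewrite expr0n mul0r ltxx.
move: (nm _) D0 (Num.sqrt _) => D D0 x; field.
by rewrite gt_eqF.
Qed.

Lemma curvature_norm11 i c P (t : R) : harmonic_metric (scale_higgs t%:C theta) h ->
  fdom i P -> cdom c P ->
  norm11 h g i c P (curvature h i c P) =
    `|t| ^+ 2 * norm11 h g i c P (higgs_bracket theta h i c P).
Proof.
move=> hE iP cP; have /eqP := hE i c P iP cP; rewrite addr_eq0 => /eqP ->.
have -> : higgs_bracket (scale_higgs t%:C theta) h i c P =
    (nm t%:C ^+ 2)%:C *: higgs_bracket theta h i c P by rewrite -bracket_scale.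
by rewrite -scaleNr -rmorphN norm11_scale normrN nm_real ger0_norm ?sqr_ge0.
Qed.

End Metric.

Section Presentation.
Variables (n : nat) (E : bundle X n.+1) (theta : higgsField E) (h : hermMetric E) (t : R)
  (c : chart X) (V : set C) (d : 'I_n.+1 -> C -> C) (fr : X -> frame E).
Hypotheses (frP : forall P, fdom (fr P) P) (oV : open V) (Vc : V `<=` cmap c @` cdom c)
  (harm : harmonic_metric (scale_higgs t%:C theta) h).

Let H w := hmx h (fr (cinv c w)) (cinv c w).
Let A w := hcoef theta (fr (cinv c w)) c (cinv c w).

(** The choice [fr] of a frame at each point need not vary continuously. Near z everything is
    recomputed in the single frame chosen at z, which changes no norm and no eigenvalue. *)
Lemma harmonic_presented :
  (forall w a, V w -> eigenvalue (A w) a <-> exists i, a = d i w) ->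
  forall z, V z -> presented V d t (fun w => hn (H w) (A w))
    (fun w => hn (H w) (bracket (H w) (A w)))
    (fun i w => hn (H w) (lagr (A w) (d^~ w) i)) z.
Proof.
move=> ev z Vz; pose j := fr (cinv c z).
pose W := cmap c @` (fdom j `&` cdom c).
have oW : open W by apply: chart_open; exact: fdom_open.
have cW w : W w -> [/\ fdom j (cinv c w), cdom c (cinv c w) & cmap c (cinv c w) = w].
  by move=> [P [jP cP] <-]; rewrite cmapK.
exists (V `&` W), (fun w => hmx h j (cinv c w)), (fun w => hcoef theta j c (cinv c w)).
split; [|split; [split|]].
- split; [exact: openI| |by move=> w []].
  split=> //; have [P cP zP] := Vc Vz; exists P => //; split=> //.
  by rewrite /j -zP cmapK.
- move=> a b; have := hmx_smooth h j a b c 2; apply: Ck_on_sub; by move=> w [].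
- by move=> w [_ /cW[jw _ _]]; exact: hmx_posdef.
- move=> a b w [_ /cW[jw cw wE]].
  by have := @hcoef_holomorphic _ _ _ _ theta j c a b c (cinv c w) (conj jw cw) cw; rewrite wE.
- by move=> w [_ /cW[jw cw wE]]; have := harm jw cw; rewrite /curvature wE.
move=> w [Vw /cW[jw cw wE]].
have iw := frP (cinv c w); set i := fr (cinv c w) in iw.
have uT := trans_unit iw jw; have pH := hmx_posdef h iw.
have HE := hmx_frame h iw jw; have AE := hcoef_gc theta iw jw cw.
rewrite /H /A -/i AE; split.
- by rewrite (hn_gc_frame _ uT pH HE).
- by rewrite (bracket_gc _ uT pH HE) (hn_gc_frame _ uT pH HE).
- by move=> k; rewrite (lagr_gc _ _ _ uT) (hn_gc_frame _ uT pH HE).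
- by move=> a; rewrite -(eigenvalue_gc uT) -AE; exact: ev.
Qed.

End Presentation.

End RiemannSurfaceGeometry.

(** * Uniformity over all Higgs bundles with a given curve, and compactness *)

Section Gluing.
Variables (R : realType) (X : riemannSurface R) (g : kahlerMetric X)
  (Sigma : set (X * covector X)).
Notation C := (Cx R).
Implicit Types (P : X) (c : chart X).

(** A property of the point alone: rank, bundle, metric and t are all quantified inside, so that
    bounds at neighbouring points can be combined by compactness. *)
Definition bracket_bound P (C0 eps0 : R) :=
  forall r (E : bundle X r) (theta : higgsField E) (h : hermMetric E) (t : R) i c,
  (0 < r)%N -> spectral_curve theta = Sigma -> ~ discriminant theta P -> 0 < t ->
  harmonic_metric (scale_higgs t%:C theta) h -> fdom i P -> cdom c P ->
  t ^+ 2 * norm11 h g i c P (higgs_bracket theta h i c P) <= C0 * expR (- eps0 * t).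

Lemma bracket_bound_le P C0 eps0 C1 eps1 : 0 <= C0 -> C0 <= C1 -> eps1 <= eps0 ->
  bracket_bound P C0 eps0 -> bracket_bound P C1 eps1.
Proof.
move=> C00 C01 e10 H r E theta h t i c r0 sc nD t0 harm iP cP.
apply: le_trans (H r E theta h t i c r0 sc nD t0 harm iP cP) _.
apply: ler_pM => //; rewrite ?expR_ge0//.
by rewrite ler_expR !mulNr lerN2 ler_pM2r.
Qed.

Lemma inj_range_leq m n (al : 'I_m -> C) (be : 'I_n -> C) : injective al ->
  (forall k, exists l, al k = be l) -> (m <= n)%N.
Proof.
move=> alinj /choice[f fP].
have finj : injective f by move=> k l kl; apply: alinj; rewrite !fP kl.
by have := leq_card f finj; rewrite !card_ord.
Qed.

Lemma kcoef_lower_bound c P0 : cdom c P0 -> exists2 rho : R, 0 < rho & forall P,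
  cdom c P -> nm (cmap c P - cmap c P0) < rho -> kcoef g c P0 / 2 <= kcoef g c P.
Proof.
move=> cP0; have k0 := kcoef_gt0 g cP0.
have [cont _] := @kcoef_smooth _ _ g c c 0%N.
have /cont/cvgCP/(_ (kcoef g c P0 / 2) (divr_gt0 k0 (ltr0n _ 2)))/nbhsCP[rho rho0 H] :
  (cmap c @` (cdom c `&` cdom c)) (cmap c P0) by exists P0.
exists rho => // P cP /H /=; rewrite !cmapK// -rmorphB nm_real ltr_distl => /andP[+ _].
by move=> /ltW; rewrite lerBlDr => h; lra.
Qed.

Lemma chart_disc_nbhs c P0 (rho : R) : cdom c P0 -> 0 < rho ->
  nbhs P0 [set P | cdom c P /\ nm (cmap c P - cmap c P0) < rho].
Proof.
move=> cP0 rho0; have cc := @cmap_continuous _ X c; have oc := @cdom_open _ X c.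
rewrite continuous_open_subspace// in cc.
have := (proj1 (continuous_inP _ oc) cc) _ (@open_discC R (cmap c P0) rho).
by move=> oO; apply: open_nbhs_nbhs; split=> //; split=> //=; rewrite subrr nm0.
Qed.

(** The field [theta1] is a reference from which the holomorphic branches, their bound and their gap
    are obtained. Since these branches describe [Sigma] over a disc, they are the eigenvalue
    branches of every other Higgs bundle with this curve, and [local_decay] applies with the same
    constants. *)
Lemma local_bracket_bound n (E1 : bundle X n.+1) (theta1 : higgsField E1) P0 :
  spectral_curve theta1 = Sigma -> ~ discriminant theta1 P0 ->
  exists C0 eps0 : R, 0 < C0 /\ 0 < eps0 /\ \forall P \near P0, bracket_bound P C0 eps0.
Proof.
move=> sc1 nD1; have [c cP0] := @cdom_cover _ X P0; have [i1 iP0] := @fdom_cover _ _ _ E1 P0.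
have [al [alinj alev]] := distinct_eigenvalues_of_fibre nD1 iP0 cP0.
pose w0 := cmap c P0; pose V0 := cmap c @` (fdom i1 `&` cdom c).
have oV0 : open V0 by apply: chart_open; exact: fdom_open.
have V0w0 : V0 w0 by exists P0.
pose A1 w := hcoef theta1 i1 c (cinv c w).
have hA1 : alg_mx (holo_on V0) A1.
  move=> a b w [P [iP cP] <-].
  exact: (@hcoef_holomorphic _ _ _ _ theta1 i1 c a b c P (conj iP cP) cP).
have alev' k : eigenvalue (A1 w0) (al k) by rewrite /A1 /w0 cmapK.
have [rho [delta [M [d [[rho0 delta0 M0 VV0] [hd ev dM sep]]]]]] :=
  eigen_branches oV0 V0w0 hA1 alinj alev'.
set V := [set w | nm (w - w0) < rho] in VV0 hd ev dM sep.
have rho2 : 0 < rho / 2 by rewrite divr_gt0.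
have [C1 [eps1 [C10 [eps10 decay]]]] := local_decay n M0 delta0 rho2.
have [rho' rho'0 kP] := kcoef_lower_bound cP0.
have k0 := kcoef_gt0 g cP0; set k := kcoef g c P0 in kP k0.
(* Near P0 the metric coefficient is at least k/2, so the factor 2 / [kcoef] of the norm is at most
   4/k. *)
exists (C1 * (4 / k)), eps1; split; first by rewrite mulr_gt0// divr_gt0.
split=> //.
have rho''0 : 0 < Num.min (rho / 2) rho' by rewrite lt_min rho2.
apply: filterS (chart_disc_nbhs cP0 rho''0) => P [cP]; rewrite lt_min => /andP[Pr /(kP P cP) kP'].
move=> r E theta h t i c' r0 sc nD t0 harm iP c'P.
have cV w : V w -> [/\ fdom i1 (cinv c w), cdom c (cinv c w) & cmap c (cinv c w) = w].
  by move=> /VV0[Q [iQ cQ] <-]; rewrite cmapK.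
have ev1 w a : V w -> (exists k, a = d k w) <->
    exists2 xi, Sigma (cinv c w, xi) & xi c = a.
  move=> Vw; have [iw cw wE] := cV w Vw; rewrite -sc1.
  by rewrite -(spectral_curve_eigenvalue theta1 a iw cw); symmetry; exact: ev.
have Vw : V (cmap c P).
  by apply: lt_le_trans Pr _; rewrite ler_pdivrMr// ler_peMr ?(ltW rho0)// ler1n.
have Pw : cinv c (cmap c P) = P by rewrite cmapK.
case: r E theta h i r0 sc nD harm iP => // m E theta h i _ sc nD harm iP.
have evP a : eigenvalue (hcoef theta i c P) a <-> exists k, a = d k (cmap c P).
  by rewrite (ev1 _ _ Vw) Pw -sc; exact: spectral_curve_eigenvalue.
have [be [beinj beev]] := distinct_eigenvalues_of_fibre nD iP cP.
(* At a point outside the discriminant of theta both ranks are the number of points of [Sigma] over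
   it. *)
have mn : m = n.
  apply/eqP; rewrite -eqSS eqn_leq; apply/andP; split.
    by apply: (inj_range_leq beinj) => k1; apply/evP.
  apply: (inj_range_leq (al := d^~ (cmap c P)) (be := be)).
    exact: (sep_inj delta0 (fun i j => sep _ i j Vw)).
  by move=> k1; apply: (distinct_eigenvalues_all beinj beev); apply/evP; exists k1.
subst m.
have /choice[fr0 fr0P] := @fdom_cover _ _ _ E.
(* The choice is adjusted so that at P it is the frame in which the norm is to be estimated. *)
pose fr Q := if pselect (Q = P) then i else fr0 Q.
have frP Q : fdom (fr Q) Q by rewrite /fr; case: (pselect (Q = P)) => [QP|_] /=; rewrite ?QP.
have frPi : fr P = i by rewrite /fr; case: (pselect (P = P)).
have Vc : V `<=` cmap c @` cdom c by move=> w /VV0[Q [_ cQ] <-]; exists Q.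
have evE w a : V w -> eigenvalue (hcoef theta (fr (cinv c w)) c (cinv c w)) a <->
    exists k, a = d k w.
  move=> Vw'; have [iw cw wE] := cV w Vw'.
  by rewrite (ev1 _ _ Vw') -sc; exact: spectral_curve_eigenvalue.
have oV : open V := @open_discC R w0 rho.
have pres := harmonic_presented frP oV Vc harm evE.
have Vdisc z : nm (z - cmap c P) <= rho / 2 -> V z.
  move=> zP; have -> : z = (z - cmap c P) + cmap c P by rewrite subrK.
  rewrite /V /= -addrA; apply: le_lt_trans (nm_triangle _ _) _.
  by rewrite [ltRHS]splitr; apply: ler_ltD.
have := decay V d (cmap c P) t _ _ _ hd dM sep t0 pres Vdisc.
rewrite Pw frPi => D.
rewrite (norm11_bracket_chart theta h g iP cP c'P) norm11E mulrA.
have kP0 := kcoef_gt0 g cP.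
have K4 : 2 / kcoef g c P <= 4 / k.
  by rewrite ler_pdivrMr// mulrAC ler_pdivlMr//; lra.
rewrite [leRHS]mulrAC; apply: ler_pM => //.
- by rewrite mulr_ge0 ?sqr_ge0 ?sqrtr_ge0.
- by rewrite divr_ge0// ltW.
Qed.

End Gluing.

Theorem theorem1p2 (R : realType) (X : riemannSurface R)
    (X_compact : compact [set: X]) (X_connected : connected [set: X])
    (g : kahlerMetric X) (N : set X) (Sigma : set (X * covector X)) :
  exists C0 eps0 : R, 0 < C0 /\ 0 < eps0 /\
    forall (r : nat) (E : bundle X r) (theta : higgsField E)
      (hdet : hermMetric (det_bundle E)) (h : R -> hermMetric E),
      stable theta ->
      has_degree E 0 ->
      generically_regular_semisimple theta ->
      spectral_curve theta = Sigma ->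
      (forall P : X, discriminant theta P -> nbhs P N) ->
      flat_metric hdet ->
      (forall t : R, 0 < t ->
         harmonic_metric (scale_higgs t%:C theta) (h t) /\
         det_metric_eq (h t) hdet) ->
      forall t : R, 0 < t ->
      forall (P : X) (i : frame E) (c : chart X),
        ~ N P -> fdom i P -> cdom c P ->
        norm11 (h t) g i c P (curvature (h t) i c P) =
          `|t| ^+ 2 *
            norm11 (h t) g i c P (higgs_bracket theta (h t) i c P) /\
        `|t| ^+ 2 *
            norm11 (h t) g i c P (higgs_bracket theta (h t) i c P) <=
          C0 * expR (- eps0 * t).
Proof.
pose admissible n (E : bundle X n.+1) (theta : higgsField E) :=
  spectral_curve theta = Sigma /\ forall P, discriminant theta P -> nbhs P N.
suff [C0 [eps0 [C00 [eps00 bound]]]] : exists C0 eps0 : R, 0 < C0 /\ 0 < eps0 /\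
    forall n (E : bundle X n.+1) (theta : higgsField E) P, admissible n E theta ->
    ~ N P -> bracket_bound g Sigma P C0 eps0.
  exists C0, eps0; split=> //; split=> //.
  (* Stability includes positive rank, so rank 0 drops out. *)
  move=> -[|n] E theta hdet h [] // _ _ _ _ sc dN _ harm t t0 P i c NP iP cP.
  have [hE _] := harm t t0; rewrite (curvature_norm11 g hE iP cP); split=> //.
  rewrite (ger0_norm (ltW t0)).
  apply: (bound n E theta P (conj sc dN) NP n.+1 E theta (h t) t i c (ltn0Sn n) sc _ t0 hE iP cP).
  by move=> /dN/nbhs_singleton.
(* The constants are chosen before any Higgs bundle is given: either some admissible one exists and
   serves as reference, or any constants do. *)
have [[n [E [theta [sc dN]]]]|none] := pselect (exists n (E : bundle X n.+1)
    (theta : higgsField E), admissible n E theta); last first.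
  exists 1, 1; split=> //; split=> // n E theta P adm; exfalso; apply: none.
  by exists n, E, theta.
(* Contains the complement of N, is closed, and misses the discriminant, of which N is a
   neighbourhood. *)
pose K := ~` (interior N).
have cK : compact K.
  apply: (subclosed_compact _ X_compact) => //.
  exact: open_closedC (open_interior N).
(* The constants k + 1 and 1/(k + 1) only weaken the bound as k grows, so every local bound is
   implied for all large k, and compactness yields one k valid on all of K. *)
have := proj1 (compact_near_coveringP K) cK nat \oo
  (fun k P => bracket_bound g Sigma P k.+1%:R k.+1%:R^-1) _.
case=> [P KP|k _ /(_ k (leqnn k)) bound].
  have [|C0 [eps0 [C00 [eps00 near_bound]]]] := @local_bracket_bound _ _ g Sigma n E theta P sc.
    by move=> /dN.
  have large (a : R) : \forall k \near \oo, a <= k.+1%:R.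
    by have := nbhs_infty_ger a; apply: filterS => k ak; rewrite (le_trans ak)// ler_nat.
  exists ([set Q | bracket_bound g Sigma Q C0 eps0],
    [set k : nat | C0 <= k.+1%:R /\ eps0^-1 <= k.+1%:R]).
    by split=> //=; exact: filterI (large _) (large _).
  move=> [Q k] [/= HQ [k1 k2]]; apply: bracket_bound_le k1 _ HQ; first exact: ltW.
  by rewrite -[leRHS]invrK lef_pV2 ?posrE ?invr_gt0.
exists k.+1%:R, k.+1%:R^-1; split; first by rewrite ltr0n.
split; first by rewrite invr_gt0 ltr0n.
by move=> m E' theta' P _ NP; apply: bound => /interior_subset.
Qed.
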